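(* Let $(F,f)\colon(L'\rightrightarrows L'_N;H\rightrightarrows N)\to(L\rightrightarrows L_M;G\rightrightarrows M)$ be a VB Morita map between line bundle groupoids, and let $\theta\in\Omega^1(G,L)$ be a multiplicative $L$-valued $1$-form. Then the map $\mathsf F\colon\mathsf MK_{F^*\theta}\to\mathsf MK_\theta$ between the Morita kernels defined by $\mathsf F(v,\lambda)=(df(v),F(\lambda))$ is a VB Morita map.
   Context: A VB groupoid (VBG) $(V\rightrightarrows V_M;G\rightrightarrows M)$ consists of Lie groupoids $V\rightrightarrows V_M$, $G\rightrightarrows M$ (Hausdorff) and vector bundles $V\to G$, $V_M\to M$ such that all structure maps $s,t,m,i,u$ of $V$ are vector bundle (VB) morphisms covering those of $G$; products $gg'$ are defined when $s(g)=t(g')$. A VBG morphism $(F,f)$ is a VB morphism $F$ covering $f$ with $F$, $f$ Lie groupoid morphisms; it is a VB Morita map if $F$ is a Morita map of Lie groupoids. A line bundle groupoid is a VBG $(L\rightrightarrows L_M;G\rightrightarrows M)$ with $L\to G$, $L_M\to M$ line bundles; its structure maps, as well as VB Morita maps between line bundle groupoids, are isomorphisms on fibers, and line bundle valued forms are pulled back along fiberwise invertible $(F,f)$ by $F^*\theta=F^{-1}\circ\theta\circ df$. $s_g:=s|_{L_g}$. $\theta\in\Omega^1(G,L)$ is multiplicative if $\partial\theta=\mathrm{pr}_2^*\theta-m^*\theta+\mathrm{pr}_1^*\theta=0$ (then $F^*\theta$ is multiplicative too). The Morita kernel $\mathsf MK_\theta$ of a multiplicative $\theta\in\Omega^1(G,L)$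 is the VBG $TG\oplus L\rightrightarrows TM\oplus L_M$ over $G\rightrightarrows M$ with $s(v,\lambda)=(ds(v),s(\lambda))$, $t(v,\lambda)=(dt(v),t(\lambda+\theta(v)))$, $u(v,\lambda)=(du(v),u(\lambda))$, $(v,\lambda)^{-1}=(v^{-1},s_{g^{-1}}^{-1}(t(\lambda+\theta(v))))$ for $(v,\lambda)$ over $g$, and $(v,\lambda)(v',\lambda')=(vv',s_{gg'}^{-1}(s(\lambda')))$ for composable elements over $g,g'$. *)

(* Defs.v *)
From HB Require Import structures.
From mathcomp Require Import all_boot all_order all_algebra.
From mathcomp Require Import all_classical all_reals all_analysis.
Set Implicit Arguments.
Unset Strict Implicit.
Unset Printing Implicit Defensive.
Import Order.TTheory GRing.Theory Num.Theory.
Import numFieldNormedType.Exports.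
Local Open Scope classical_set_scope.
Local Open Scope ring_scope.

(* Every geometric object below comes in two parts: a record of raw data, on
   which the constructions (tangent bundle, Whitney sum, Morita kernel, ...)
   are defined outright, and a predicate [is_...] carrying all its axioms. *)

(* "The" element of [P], when there is one; [d] is a dummy value. *)
Definition the {A : Type} (d : A) (P : set A) : A := @xget {classic A} d P.

(** * Smooth functions on open subsets of normed spaces *)

Fixpoint Ck {R : realType} (k : nat) {V W : normedModType R}
    (U : set V) (f : V -> W) : Prop :=
  match k with
  | 0%N => forall x, U x -> {for x, continuous f}
  | k'.+1 => (forall x, U x -> differentiable f x) /\
             forall v : V, Ck k' U (fun x => 'd f x v)
  end.

Definition Coo {R : realType} {V W : normedModType R}
    (U : set V) (f : V -> W) : Prop := forall k, Ck k U f.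

(** * Manifolds *)

(* A set with an atlas [(cdom i, chart i)]; the topology is the one the atlas
   induces ([mopen]).  [chart i] is only meaningful on [cdom i]. *)
Record mfd (R : realType) := Mfd {
  pt :> Type;
  mdim : nat;
  idx : Type;
  cdom : idx -> set pt;
  chart : idx -> pt -> 'rV[R]_mdim }.
Arguments cdom {R m}.
Arguments chart {R m}.

Definition mopen {R : realType} (X : mfd R) (O : set X) : Prop :=
  forall i : idx X, open (chart i @` (O `&` cdom i)).

(* The coordinate expression [chart j \o f \o (chart i)^-1]. *)
Definition rep {R : realType} {X Y : mfd R} (f : X -> Y)
    (i : idx X) (j : idx Y) (x : 'rV[R]_(mdim X)) : 'rV[R]_(mdim Y) :=
  the 0 [set chart j (f q) | q in [set q : X | cdom i q /\ chart i q = x]].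

Definition smooth_on {R : realType} {X Y : mfd R} (O : set X) (f : X -> Y) :=
  forall (i : idx X) (j : idx Y),
    let D := chart i @` (O `&` cdom i `&` f @^-1` cdom j) in
    open D /\ Coo D (rep f i j).

Definition smooth {R : realType} {X Y : mfd R} (f : X -> Y) : Prop :=
  smooth_on setT f.

(* Hausdorff, second countable, of pure dimension. *)
Definition is_mfd {R : realType} (X : mfd R) : Prop :=
  [/\ forall (i : idx X) (p q : X),
        cdom i p -> cdom i q -> chart i p = chart i q -> p = q,
      (exists D : set (idx X), countable D /\
         forall p : X, exists2 i, D i & cdom i p),
      smooth (id : X -> X) &
      forall p q : X, p <> q -> exists O O' : set X,
        [/\ mopen O, mopen O', O p, O' q & O `&` O' = set0]].

Definition eucl (R : realType) (n : nat) : mfd R :=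
  @Mfd R 'rV[R]_n n unit (fun=> setT) (fun=> id).

Definition prodm {R : realType} (X Y : mfd R) : mfd R :=
  @Mfd R (X * Y)%type (mdim X + mdim Y) (idx X * idx Y)%type
    (fun k => [set p | cdom k.1 p.1 /\ cdom k.2 p.2])
    (fun k p => row_mx (chart k.1 p.1) (chart k.2 p.2)).

(* Maps defined on an arbitrary subset [A] of a manifold (here always a fibre
   product, e.g. composable pairs); smooth means locally the restriction of a
   smooth map of the ambient manifold. *)
Definition local_ext {R : realType} {X Y : mfd R}
    (A : set X) (f : X -> Y) (p : X) (e : X -> Y) : Prop :=
  exists O : set X, [/\ O p, smooth_on O e & forall q, O q -> A q -> e q = f q].

Definition smooth_sub {R : realType} {X Y : mfd R}
    (A : set X) (f : X -> Y) : Prop :=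
  forall p, A p -> exists e, local_ext A f p e.

(** * Tangent bundles *)

(* A tangent vector at [p] is the family of its components in all the charts
   around [p] (0 in the other charts), subject to the transformation law. *)
Definition is_tan {R : realType} {X : mfd R} (p : X)
    (v : idx X -> 'rV[R]_(mdim X)) : Prop :=
  (forall i, ~ cdom i p -> v i = 0) /\
  (forall i j, cdom i p -> cdom j p ->
     v j = 'd (rep (id : X -> X) i j) (chart i p) (v i)).

Definition tvec {R : realType} (X : mfd R) : Type :=
  {pv : X * (idx X -> 'rV[R]_(mdim X)) | is_tan pv.1 pv.2}.

Definition foot {R : realType} {X : mfd R} (v : tvec X) : X := (sval v).1.
Definition comps {R : realType} {X : mfd R} (v : tvec X) :
  idx X -> 'rV[R]_(mdim X) := (sval v).2.

Lemma is_tan0 {R : realType} {X : mfd R} (p : X) :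
  @is_tan R X p (fun=> 0).
Proof. by split=> // i j _ _; rewrite linear0. Qed.

Definition tzero {R : realType} {X : mfd R} (p : X) : tvec X :=
  exist _ (p, fun=> 0) (is_tan0 p).

Definition tanm {R : realType} (X : mfd R) : mfd R :=
  @Mfd R (tvec X) (mdim X + mdim X) (idx X)
    (fun i => [set v | cdom i (foot v)])
    (fun i v => row_mx (chart i (foot v)) (comps v i)).

Definition tadd {R : realType} {X : mfd R} (v w : tvec X) : tvec X :=
  the v [set u | foot u = foot v /\ forall i, comps u i = comps v i + comps w i].

Definition tscale {R : realType} {X : mfd R} (a : R) (v : tvec X) : tvec X :=
  the v [set u | foot u = foot v /\ forall i, comps u i = a *: comps v i].

(* The differential of [f], as a map of tangent bundles. *)
Definition tmap {R : realType} {X Y : mfd R} (f : X -> Y)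
    (v : tanm X) : tanm Y :=
  the (tzero (f (foot v)) : tanm Y)
    [set w | foot w = f (foot v) /\
       forall i j, cdom i (foot v) -> cdom j (f (foot v)) ->
         comps w j = 'd (rep f i j) (chart i (foot v)) (comps v i)].

(* The differential of a map defined on a subset [A], at vectors tangent
   to [A]. *)
Definition tmap_sub {R : realType} {X Y : mfd R} (A : set X) (f : X -> Y)
    (v : tanm X) : tanm Y :=
  the (tzero (f (foot v)) : tanm Y)
    [set w | exists2 e, local_ext A f (foot v) e & w = tmap e v].

(* T(X x Y) = TX x TY. *)
Definition tpair {R : realType} {X Y : mfd R} (v : tanm X) (w : tanm Y) :
    tanm (prodm X Y) :=
  the (tzero ((foot v, foot w) : prodm X Y) : tanm (prodm X Y))
    [set u | tmap (fst : prodm X Y -> X) u = v /\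
             tmap (snd : prodm X Y -> Y) u = w].

Definition submersion {R : realType} {X Y : mfd R} (f : X -> Y) : Prop :=
  smooth f /\
  forall (p : X) (w : tanm Y), foot w = f p ->
    exists2 v : tanm X, foot v = p & tmap f v = w.

(** * Vector bundles *)

(* [vadd] is only meaningful on pairs in the same fibre. *)
Record vb (R : realType) (E X : mfd R) := VB {
  vrank : nat;
  vproj : E -> X;
  vzero : X -> E;
  vzeroK : forall x, vproj (vzero x) = x;
  vadd : E -> E -> E;
  vscale : R -> E -> E }.

Definition is_triv {R : realType} {E X : mfd R} (V : vb E X)
    (U : set X) (phi : E -> 'rV[R]_(vrank V)) : Prop :=
  [/\ mopen U,
      smooth_on (vproj V @^-1` U) (phi : E -> eucl R (vrank V)),
      exists psi : prodm X (eucl R (vrank V)) -> E,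
        [/\ smooth_on [set xy : prodm X (eucl R (vrank V)) | U xy.1] psi,
            forall x y, U x -> vproj V (psi (x, y)) = x /\ phi (psi (x, y)) = y &
            forall e, U (vproj V e) -> psi (vproj V e, phi e) = e],
      forall x, U x -> phi (vzero V x) = 0 &
      (forall e e', U (vproj V e) -> vproj V e = vproj V e' ->
         phi (vadd V e e') = phi e + phi e') /\
      (forall a e, U (vproj V e) -> phi (vscale V a e) = a *: phi e)].

Definition is_vb {R : realType} {E X : mfd R} (V : vb E X) : Prop :=
  [/\ is_mfd E, is_mfd X, smooth (vproj V),
      (forall e e', vproj V e = vproj V e' -> vproj V (vadd V e e') = vproj V e) /\
      (forall a e, vproj V (vscale V a e) = vproj V e) &
      forall x : X, exists (U : set X) (phi : E -> 'rV[R]_(vrank V)),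
        U x /\ is_triv U phi].

Definition vb_map {R : realType} {E X E' X' : mfd R}
    (V : vb E X) (V' : vb E' X') (F : E -> E') (f : X -> X') : Prop :=
  [/\ smooth F, smooth f,
      forall e, vproj V' (F e) = f (vproj V e),
      forall e1 e2, vproj V e1 = vproj V e2 ->
        F (vadd V e1 e2) = vadd V' (F e1) (F e2) &
      forall a e, F (vscale V a e) = vscale V' a (F e)].

(* The preimage [F_x^-1 (y)] of [y] in the fibre over [x], for [F]
   invertible on fibres. *)
Definition fibinv {R : realType} {E X E' : mfd R} (V : vb E X)
    (F : E -> E') (x : X) (y : E') : E :=
  the (vzero V x) [set e | vproj V e = x /\ F e = y].

Definition tvb {R : realType} (X : mfd R) : vb (tanm X) X :=
  @VB R (tanm X) X (mdim X) (@foot R X) (@tzero R X)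
    (fun=> erefl) (@tadd R X) (@tscale R X).

(* Whitney sum. Its charts are built from a chart of the base and local
   trivializations of the two summands. *)
Definition triv {R : realType} {E X : mfd R} (V : vb E X) : Type :=
  {t : set X * (E -> 'rV[R]_(vrank V)) | is_triv t.1 t.2}.

Definition wpt {R : realType} {E E' X : mfd R}
    (V : vb E X) (V' : vb E' X) : Type :=
  {e : E * E' | vproj V e.1 = vproj V' e.2}.

Definition wproj {R : realType} {E E' X : mfd R} {V : vb E X} {V' : vb E' X}
  (e : wpt V V') : X := vproj V (sval e).1.

Definition whitney {R : realType} {E E' X : mfd R}
    (V : vb E X) (V' : vb E' X) : mfd R :=
  @Mfd R (wpt V V') (mdim X + (vrank V + vrank V'))
    (idx X * (triv V * triv V'))%type
    (fun k => [set e | [/\ cdom k.1 (wproj e),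
       (sval k.2.1).1 (wproj e) & (sval k.2.2).1 (wproj e)]])
    (fun k e => row_mx (chart k.1 (wproj e))
       (row_mx ((sval k.2.1).2 (sval e).1) ((sval k.2.2).2 (sval e).2))).

Definition wzero {R : realType} {E E' X : mfd R}
    (V : vb E X) (V' : vb E' X) (x : X) : whitney V V' :=
  exist _ (vzero V x, vzero V' x) (etrans (vzeroK V x) (esym (vzeroK V' x))).

(* The element [(e, e')]; a dummy unless [e] and [e'] lie over the same point. *)
Definition wpair {R : realType} {E E' X : mfd R}
    (V : vb E X) (V' : vb E' X) (e : E) (e' : E') : whitney V V' :=
  the (wzero V V' (vproj V e)) [set w : wpt V V' | sval w = (e, e')].

Definition wvb {R : realType} {E E' X : mfd R}
    (V : vb E X) (V' : vb E' X) : vb (whitney V V') X :=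
  @VB R (whitney V V') X (vrank V + vrank V') wproj (wzero V V') (vzeroK V)
    (fun w1 w2 => wpair V V' (vadd V (sval w1).1 (sval w2).1)
                             (vadd V' (sval w1).2 (sval w2).2))
    (fun a w => wpair V V' (vscale V a (sval w).1) (vscale V' a (sval w).2)).

(** * Lie groupoids *)

(* [gmul g g'] is only meaningful when [gsrc g = gtgt g']. *)
Record gpd (R : realType) := Gpd {
  arr : mfd R;
  obj : mfd R;
  gsrc : arr -> obj;
  gtgt : arr -> obj;
  gmul : arr -> arr -> arr;
  ginv : arr -> arr;
  gunt : obj -> arr }.

Definition composable {R : realType} (G : gpd R) : set (prodm (arr G) (arr G)) :=
  [set p | gsrc p.1 = gtgt p.2].
Arguments composable {R} G _.

Definition is_liegpd {R : realType} (G : gpd R) : Prop :=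
  [/\ is_mfd (arr G) /\ is_mfd (obj G),
      submersion (@gsrc R G) /\ submersion (@gtgt R G),
      [/\ smooth_sub (composable G)
            ((fun p => gmul p.1 p.2) : prodm (arr G) (arr G) -> arr G),
          smooth (@ginv R G) & smooth (@gunt R G)],
      [/\ forall g g' : arr G, gsrc g = gtgt g' ->
            gsrc (gmul g g') = gsrc g' /\ gtgt (gmul g g') = gtgt g,
          forall g : arr G, gsrc (ginv g) = gtgt g /\ gtgt (ginv g) = gsrc g &
          forall x : obj G, gsrc (gunt x) = x /\ gtgt (gunt x) = x] &
      [/\ forall g h k : arr G, gsrc g = gtgt h -> gsrc h = gtgt k ->
            gmul g (gmul h k) = gmul (gmul g h) k,
          forall g : arr G, gmul (gunt (gtgt g)) g = g /\ gmul g (gunt (gsrc g)) = g &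
          forall g : arr G, gmul g (ginv g) = gunt (gtgt g) /\
                            gmul (ginv g) g = gunt (gsrc g)]].

Record gmap {R : realType} (H G : gpd R) := GMap {
  onarr : arr H -> arr G;
  onobj : obj H -> obj G }.

Definition is_gmap {R : realType} (H G : gpd R) (f : gmap H G) : Prop :=
  [/\ smooth (onarr f), smooth (onobj f),
      forall h, gsrc (onarr f h) = onobj f (gsrc h) /\
                gtgt (onarr f h) = onobj f (gtgt h),
      forall h h', gsrc h = gtgt h' ->
        onarr f (gmul h h') = gmul (onarr f h) (onarr f h') &
      forall x, onarr f (gunt x) = gunt (onobj f x)].

(* The square formed by [onarr f], [onobj f * onobj f] and the two maps
   [(gtgt, gsrc)] is a pullback: [h |-> (f h, (gtgt h, gsrc h))] is a
   diffeomorphism onto the fibre product. *)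
Definition fully_faithful {R : realType} (H G : gpd R) (f : gmap H G) : Prop :=
  let P := prodm (arr G) (prodm (obj H) (obj H)) in
  let A := [set z : P | gtgt z.1 = onobj f z.2.1 /\ gsrc z.1 = onobj f z.2.2] in
  exists K : P -> arr H,
    [/\ smooth_sub A K,
        forall h, K (onarr f h, (gtgt h, gsrc h)) = h &
        forall z, A z -> (onarr f (K z), (gtgt (K z), gsrc (K z))) = z].

(* [(g, x) |-> gtgt g] is a surjective submersion on the fibre product of [gsrc]
   and [onobj f], whose tangent spaces are the fibre products of the tangent
   spaces, [gsrc] being a submersion. *)
Definition essentially_surjective {R : realType} (H G : gpd R) (f : gmap H G) :
    Prop :=
  (forall y : obj G, exists g x, gsrc g = onobj f x /\ gtgt g = y) /\
  (forall (g : arr G) (x : obj H), gsrc g = onobj f x ->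
   forall u : tanm (obj G), foot u = gtgt g ->
   exists (v : tanm (arr G)) (w : tanm (obj H)),
     [/\ foot v = g, foot w = x, tmap (@gsrc R G) v = tmap (onobj f) w &
         tmap (@gtgt R G) v = u]).

Definition is_morita {R : realType} (H G : gpd R) (f : gmap H G) : Prop :=
  [/\ is_liegpd H, is_liegpd G, is_gmap f, fully_faithful f &
      essentially_surjective f].

Definition tgpd {R : realType} (G : gpd R) : gpd R :=
  @Gpd R (tanm (arr G)) (tanm (obj G)) (tmap (@gsrc R G)) (tmap (@gtgt R G))
    (fun v v' => tmap_sub (composable G)
       ((fun p => gmul p.1 p.2) : prodm (arr G) (arr G) -> arr G) (tpair v v'))
    (tmap (@ginv R G)) (tmap (@gunt R G)).

(** * VB groupoids *)

Record vbg (R : realType) := VBG {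
  vgpd : gpd R;
  bgpd : gpd R;
  varr : vb (arr vgpd) (arr bgpd);
  vobj : vb (obj vgpd) (obj bgpd) }.

Definition is_vbg {R : realType} (V : vbg R) : Prop :=
  [/\ is_liegpd (vgpd V) /\ is_liegpd (bgpd V),
      is_vb (varr V) /\ is_vb (vobj V),
      vb_map (varr V) (vobj V) (@gsrc R (vgpd V)) (@gsrc R (bgpd V)) /\
      vb_map (varr V) (vobj V) (@gtgt R (vgpd V)) (@gtgt R (bgpd V)),
      vb_map (varr V) (varr V) (@ginv R (vgpd V)) (@ginv R (bgpd V)) /\
      vb_map (vobj V) (varr V) (@gunt R (vgpd V)) (@gunt R (bgpd V)) &
      [/\ forall e e', gsrc e = gtgt e' ->
            vproj (varr V) (gmul e e') = gmul (vproj (varr V) e) (vproj (varr V) e'),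
          forall e1 e2 e1' e2',
            gsrc e1 = gtgt e1' -> gsrc e2 = gtgt e2' ->
            vproj (varr V) e1 = vproj (varr V) e2 ->
            vproj (varr V) e1' = vproj (varr V) e2' ->
            gmul (vadd (varr V) e1 e2) (vadd (varr V) e1' e2') =
              vadd (varr V) (gmul e1 e1') (gmul e2 e2') &
          forall a e e', gsrc e = gtgt e' ->
            gmul (vscale (varr V) a e) (vscale (varr V) a e') =
              vscale (varr V) a (gmul e e')]].

Definition is_vbg_map {R : realType} (V W : vbg R)
    (F : gmap (vgpd V) (vgpd W)) (f : gmap (bgpd V) (bgpd W)) : Prop :=
  [/\ is_gmap F, is_gmap f, vb_map (varr V) (varr W) (onarr F) (onarr f) &
      vb_map (vobj V) (vobj W) (onobj F) (onobj f)].

Definition is_vb_morita {R : realType} (V W : vbg R)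
    (F : gmap (vgpd V) (vgpd W)) (f : gmap (bgpd V) (bgpd W)) : Prop :=
  [/\ is_vbg V, is_vbg W, is_vbg_map F f & is_morita F].

Definition is_lbg {R : realType} (L : vbg R) : Prop :=
  [/\ is_vbg L, vrank (varr L) = 1%N & vrank (vobj L) = 1%N].

(** * Multiplicative forms and Morita kernels *)

(* An [L]-valued 1-form on [G], as a vector bundle map [TG -> L] over [id]. *)
Definition is_form {R : realType} (L : vbg R)
    (theta : tanm (arr (bgpd L)) -> arr (vgpd L)) : Prop :=
  vb_map (tvb (arr (bgpd L))) (varr L) theta id.

(* [a], [b], [c], in the fibre of [L^(2)] over a composable pair, are the values
   on [(v, v')] of the pullbacks of [theta] along [pr_2], [gmul] and [pr_1]. *)
Definition is_multiplicative {R : realType} (L : vbg R)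
    (theta : tanm (arr (bgpd L)) -> arr (vgpd L)) : Prop :=
  forall v v' : arr (tgpd (bgpd L)), gsrc v = gtgt v' ->
  let over (p : prodm (arr (vgpd L)) (arr (vgpd L))) :=
    [/\ composable (vgpd L) p, vproj (varr L) p.1 = foot v &
        vproj (varr L) p.2 = foot v'] in
  forall a b c, over a -> over b -> over c ->
    a.2 = theta v' -> gmul b.1 b.2 = theta (gmul v v') -> c.1 = theta v ->
    let alt x y z := vadd (varr L) (vadd (varr L) x (vscale (varr L) (-1) y)) z in
    alt a.1 b.1 c.1 = vzero (varr L) (foot v) /\
    alt a.2 b.2 c.2 = vzero (varr L) (foot v').

Definition pullform {R : realType} (L' L : vbg R)
    (F : gmap (vgpd L') (vgpd L)) (f : gmap (bgpd L') (bgpd L))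
    (theta : tanm (arr (bgpd L)) -> arr (vgpd L)) :
    tanm (arr (bgpd L')) -> arr (vgpd L') :=
  fun v => fibinv (varr L') (onarr F) (foot v) (theta (tmap (onarr f) v)).

Definition MK {R : realType} (L : vbg R)
    (theta : tanm (arr (bgpd L)) -> arr (vgpd L)) : vbg R :=
  let G := bgpd L in
  let TG := tgpd G in
  let VG := tvb (arr G) in
  let VM := tvb (obj G) in
  let sinv g y := fibinv (varr L) (@gsrc R (vgpd L)) g y in
  let ttheta (e : whitney VG (varr L)) :=
    gtgt (vadd (varr L) (sval e).2 (theta (sval e).1)) in
  @VBG R
    (@Gpd R (whitney VG (varr L)) (whitney VM (vobj L))
      (fun e => wpair VM (vobj L) (@gsrc R TG (sval e).1) (gsrc (sval e).2))
      (fun e => wpair VM (vobj L) (@gtgt R TG (sval e).1) (ttheta e))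
      (fun e e' => wpair VG (varr L) (@gmul R TG (sval e).1 (sval e').1)
         (sinv (gmul (wproj e) (wproj e')) (gsrc (sval e').2)))
      (fun e => wpair VG (varr L) (@ginv R TG (sval e).1)
         (sinv (ginv (wproj e)) (ttheta e)))
      (fun e => wpair VG (varr L) (@gunt R TG (sval e).1) (gunt (sval e).2)))
    G (wvb VG (varr L)) (wvb VM (vobj L)).

Definition MKmap {R : realType} (L' L : vbg R)
    (F : gmap (vgpd L') (vgpd L)) (f : gmap (bgpd L') (bgpd L))
    (theta : tanm (arr (bgpd L)) -> arr (vgpd L)) :
    gmap (vgpd (MK (pullform F f theta))) (vgpd (MK theta)) :=
  @GMap R (vgpd (MK (pullform F f theta))) (vgpd (MK theta))
    (fun e => wpair (tvb (arr (bgpd L))) (varr L)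
       (tmap (onarr f) (sval e).1) (onarr F (sval e).2))
    (fun e => wpair (tvb (obj (bgpd L))) (vobj L)
       (tmap (onobj f) (sval e).1) (onobj F (sval e).2)).

(* Main.v *)
Require Import Defs.
From HB Require Import structures.
From mathcomp Require Import all_boot all_order all_algebra ring.
From mathcomp Require Import all_classical all_reals all_analysis.
Set Implicit Arguments.
Unset Strict Implicit.
Unset Printing Implicit Defensive.
Import Order.TTheory GRing.Theory Num.Theory.
Import numFieldNormedType.Exports.
Local Open Scope classical_set_scope.
Local Open Scope ring_scope.

(** A tangent vector is handled as the velocity of a curve.  By Lyusternik's
    theorem curves lift along submersions, so every tangent vector of a fibre
    product defined by a submersion is the velocity of a curve inside it, and
    the identities of a tangent groupoid, or of the tangent map of a smooth
    inverse, are the pointwise identities differentiated along curves.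

    For line bundle groupoids [gsrc] and [gtgt] are isomorphisms on fibres:
    vertical tangent vectors along the zero section show that a submersion of
    vector bundles is surjective on fibres.  In the same way the essential
    surjectivity of [F] makes [F] an isomorphism on fibres.  Conversely, a vector
    bundle map that is surjective on fibres over a submersion is a submersion,
    since tangent vectors of the total space with the same base point and the
    same projection differ by a vertical vector; this gives the submersion
    conditions for the Morita kernels.  The base map [f] is a Morita map, as one
    sees by restricting the conditions for [F] to the zero section, and the
    inverse witnessing that the map of Morita kernels is fully faithful is the
    tangent map of the one for [f] paired with the fibrewise inverse of [F]. *)

(** * Differential calculus on normed modules *)

(** Fibre products are not given a manifold structure: they stay subsets of products, and [tmap_sub]
    differentiates a map on such a subset through a chosen local extension. Independence of that
    choice holds on velocities of curves staying in the subset, and this is what makes curve lifting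
    indispensable. For composable pairs the lift comes from [gsrc]. For the fibre product in
    [fully_faithful], neither [(t, s)] nor [f x f] need be a submersion; their transversality comes
    from adding a vector with the right source to one that corrects the target, the latter from
    essential surjectivity. Rank one is used to pass between injectivity and surjectivity on fibres
    and to write fibrewise inverses as quotients of functions, which makes them smooth. The form
    [theta] enters the Morita kernel through its target. That the target of a product is the target
    of its left factor is the multiplicativity of [theta] read through [gtgt]; the [L]-components of
    the other groupoid identities are settled by comparing sources. *)

Section Differentials.
Context {R : realType}.
Implicit Types V W : normedModType R.

(** The expansion that characterises the differential at [x] depends on values near [x] only, and
    uniqueness of the differential does the rest. *)
Lemma near_is_diff {V W} (f g : V -> W) (x : V) :
  (\forall y \near x, f y = g y) -> differentiable f x ->
  is_diff x g ('d f x).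
Proof.
move=> fg df.
have [dfc fE] := (diff_locallyP x f).1 df.
have gE : g \o shift x = cst (g x) + 'd f x +o_ 0 id.
  have fx : f x = g x by exact: (nbhs_singleton fg).
  have fg0 : \forall h \near 0, f (h + x) = g (h + x).
    by move: fg; rewrite (near_shift 0 x) /= subr0.
  apply/eqaddoP => _/posnumP[e].
  have /eqaddoP/(_ e%:num (gt0 e)) fE' := fE.
  near=> h.
  have -> : (g \o shift x - (cst (g x) + 'd f x)) h =
      (f \o shift x - (cst (f x) + 'd f x)) h.
    by rewrite !fctE /= fx (near fg0 h).
  by near: h.
have dg := diff_unique dfc gE.
apply: DiffDef; last exact: dg.
apply/diff_locallyP; rewrite dg; exact: (conj dfc gE).
Unshelve. all: by end_near. Qed.

Lemma is_diff_germ {V W} (f g : V -> W) (x : V) d :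
  (\forall y \near x, f y = g y) -> is_diff x f d -> is_diff x g d.
Proof.
move=> fg [df dv]; have [dg gv] := near_is_diff fg df.
by apply: DiffDef; [exact: dg|rewrite gv].
Qed.

Lemma is_diff0P {V W} (f : V -> W) (x : V) :
  is_diff x f 0 <-> forall e : R, 0 < e ->
    \forall h \near 0, `|f (h + x) - f x| <= e * `|h|.
Proof.
split=> [[df dE] e e0|H].
  have [_] := (diff_locallyP x f).1 df; rewrite dE => /eqaddoP/(_ e e0).
  apply: filterS => h; rewrite !fctE /=.
  by rewrite (_ : (0 : V -> W) h = 0)// addr0.
pose z : {linear V -> W} := \0.
have zc : continuous z by apply: cst_continuous.
have fE : f \o shift x = cst (f x) + z +o_ 0 id.
  apply/eqaddoP => e e0; apply: filterS (H e e0) => h; rewrite !fctE /=.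
  by rewrite addr0.
have dE := diff_unique zc fE.
apply: DiffDef; last exact: dE.
apply/diff_locallyP; rewrite dE; exact: (conj zc fE).
Qed.

(** Negligibility to first order passes to any smaller increment. In [curve_lifting] this gives the
    correction zero velocity, since it is bounded by twice the defect of the uncorrected line. *)
Lemma is_diff0_dominated {V W W'} (f : V -> W) (g : V -> W') (c : R) (x : V) :
  0 < c -> (\forall y \near x, `|f y - f x| <= c * `|g y - g x|) ->
  is_diff x g 0 -> is_diff x f 0.
Proof.
move=> c0 fg /is_diff0P Hg; apply/is_diff0P => e e0.
have fg' : \forall h \near 0, `|f (h + x) - f x| <= c * `|g (h + x) - g x|.
  by move: fg; rewrite (near_shift 0 x) /= subr0.
have Hg' := Hg _ (divr_gt0 e0 c0).
apply: filterS2 fg' Hg' => h /le_trans fgh; rewrite mulrAC => Hgh; apply: fgh.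
by rewrite mulrC -ler_pdivlMr.
Qed.

Lemma is_diffZZ {V W} (k : V -> R) (g : V -> W) x dk dg :
  is_diff x k dk -> is_diff x g dg ->
  is_diff x (fun y => k y *: g y) (fun v => k x *: dg v + dk v *: g x).
Proof.
move=> Hk Hg.
(* Scaling is packed as a continuous bilinear map, so that the product rule becomes the chain rule
   for this map and the pair [(k, g)]. *)
have B : bilinear_for (GRing.Scale.Law.clone _ _ *:%R _)
    (GRing.Scale.Law.clone _ _ *:%R _) (@GRing.scale R W : R -> W -> W).
  by split=> [u'|u] a y z /=; rewrite ?scalerDl ?scalerDr !scalerA // mulrC.
pose bM := bilinear_isBilinear.Build R R W W _ _ (@GRing.scale R W) B.
pose b : {bilinear R -> W -> W} := HB.pack (@GRing.scale R W : R -> W -> W) bM.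
have bc : continuous (fun p : R * W => b p.1 p.2).
  by move=> p; apply: scale_continuous.
have Hb p : is_diff p (fun q : R * W => b q.1 q.2)
    (fun q => b p.1 q.2 + b q.1 p.2).
  by apply: DiffDef; [apply: differentiable_bilin|rewrite diff_bilin].
exact: (is_diff_comp (is_diff_pair Hk Hg) (Hb _)).
Qed.

Lemma is_diffZc {V W} (k : V -> R) (c : W) x dk :
  is_diff x k dk -> is_diff x (fun y => k y *: c) (fun v => dk v *: c).
Proof.
move=> Hk; have := is_diffZZ Hk (is_diff_cst c x).
have -> // : (fun v => k x *: (0 : V -> W) v + dk v *: c) = (fun v => dk v *: c).
by apply/funext => v; rewrite (_ : (0 : V -> W) v = 0)// scaler0 add0r.
Qed.

Lemma is_diff_sum {V W} n (f df : 'I_n -> V -> W) x :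
  (forall i, is_diff x (f i) (df i)) ->
  is_diff x (fun y => \sum_i f i y) (fun v => \sum_i df i v).
Proof.
elim: n f df => [|n IH] f df H.
  have -> : (fun y => \sum_(i < 0) f i y) = cst 0.
    by apply/funext => y; rewrite big_ord0.
  have -> : (fun v => \sum_(i < 0) df i v) = 0.
    by apply/funext => y; rewrite big_ord0.
  exact: is_diff_cst.
have -> : (fun y => \sum_(i < n.+1) f i y) =
    (fun y => \sum_(i < n) f (widen_ord (leqnSn n) i) y) + f ord_max.
  by apply/funext => y; rewrite big_ord_recr.
have -> : (fun y => \sum_(i < n.+1) df i y) =
    (fun y => \sum_(i < n) df (widen_ord (leqnSn n) i) y) + df ord_max.
  by apply/funext => y; rewrite big_ord_recr.
have H1 := IH _ _ (fun i => H (widen_ord (leqnSn n) i)).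
have H2 := H ord_max.
exact: is_diffD.
Qed.

Lemma is_diff_coord n (x : 'rV[R]_n) i :
  is_diff x (fun y : 'rV[R]_n => y 0 i) (fun y => y 0 i).
Proof.
have lin : linear (fun y : 'rV[R]_n => y 0 i) by move=> a u v; rewrite !mxE.
pose lM := GRing.isLinear.Build _ _ _ _ _ lin.
pose l : {linear 'rV[R]_n -> R} := HB.pack (fun y : 'rV[R]_n => y 0 i) lM.
have lc : continuous l by apply: coord_continuous.
by apply: DiffDef; [apply: (linear_differentiable (f := l))|
  rewrite (diff_lin (f := l))].
Qed.

Lemma is_diff_rV {V} n (f df : V -> 'rV[R]_n) x :
  (forall i, is_diff x (fun y => f y 0 i) (fun v => df v 0 i)) <->
  is_diff x f df.
Proof.
split=> [H|H i]; last exact: (is_diff_comp H (is_diff_coord (f x) i)).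
have -> : f = fun y => \sum_i (f y 0 i *: delta_mx 0 i).
  by apply/funext => y; rewrite -row_sum_delta.
have -> : df = fun y => \sum_i (df y 0 i *: delta_mx 0 i).
  by apply/funext => y; rewrite -row_sum_delta.
by apply: is_diff_sum => i; apply: is_diffZc.
Qed.

Lemma is_diff_lin n m (f : {linear 'rV[R]_n -> 'rV[R]_m}) x : is_diff x f f.
Proof.
apply/is_diff_rV => i.
have E (y : 'rV[R]_n) : f y 0 i = \sum_j y 0 j * f (delta_mx 0 j) 0 i.
  rewrite {1}(row_sum_delta y) linear_sum summxE.
  by apply: eq_bigr => j _; rewrite linearZ !mxE.
have -> : (fun y => f y 0 i) =
    fun y : 'rV[R]_n => \sum_j y 0 j *: f (delta_mx 0 j) 0 i.
  by apply/funext => y.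
by apply: is_diff_sum => j; apply: is_diffZc (is_diff_coord x j).
Qed.

Lemma diff_rV_sum {W} n (f : 'rV[R]_n -> W) x v :
  'd f x v = \sum_i v 0 i *: 'd f x (delta_mx 0 i).
Proof.
by rewrite {1}(row_sum_delta v) linear_sum; apply: eq_bigr => i _; rewrite linearZ.
Qed.

End Differentials.

(** * Maps of class [C^k] *)

Section Ck.
Context {R : realType}.
Implicit Types V W : normedModType R.

Lemma Ck_sub {V W} k (U U' : set V) (f : V -> W) :
  U `<=` U' -> Ck k U' f -> Ck k U f.
Proof.
move=> UU'; elim: k f => [|k IH] f /=; first by move=> H x /UU'; apply: H.
by move=> [H1 H2]; split=> [x /UU'/H1//|v]; apply: IH.
Qed.

Lemma CkS {V W} k (U : set V) (f : V -> W) : Ck k.+1 U f -> Ck k U f.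
Proof.
elim: k f => [|k IH] f [H1 H2]; first by move=> x /H1/differentiable_continuous.
by split=> // v; apply: IH.
Qed.

Lemma Ck_loc {V W} k (U : set V) (f : V -> W) :
  (forall x, U x -> exists2 U', U' x & Ck k U' f) -> Ck k U f.
Proof.
elim: k f => [|k IH] f H; first by move=> x /H[U' /[swap]]; apply.
split=> [x /H[U' U'x [H1 _]]|v]; first exact: H1.
by apply: IH => x /H[U' U'x [_ /(_ v)]]; exists U'.
Qed.

(** Openness of [U] turns equality on [U] into equality of germs, so that it passes to the
    differentials. *)
Lemma Ck_ext {V W} k (U : set V) (f g : V -> W) :
  open U -> (forall x, U x -> f x = g x) -> Ck k U f -> Ck k U g.
Proof.
move=> oU; elim: k f g => [|k IH] f g fg.
  move=> H x Ux; have := H _ Ux; rewrite /prop_for /continuous_at -fg//.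
  apply: cvg_trans; apply: near_eq_cvg.
  by near do rewrite fg//; apply: open_nbhs_nbhs.
have nfg x : U x -> \forall y \near x, f y = g y.
  by move=> Ux; near do rewrite fg//; apply: open_nbhs_nbhs.
move=> [H1 H2]; split=> [x Ux|v].
  by have [] := near_is_diff (nfg x Ux) (H1 x Ux).
apply: IH (H2 v) => x Ux.
by have [_ ->] := near_is_diff (nfg x Ux) (H1 x Ux).
Unshelve. all: by end_near. Qed.

Lemma Ck_cst {V W} k (U : set V) (c : W) : Ck k U (fun _ : V => c).
Proof.
elim: k c => [|k IH] c; first by move=> x _; apply: cst_continuous.
split=> [x _|v]; first by have [] := is_diff_cst c x.
rewrite (_ : (fun x => _) = fun _ => 0); first exact: IH.
by apply/funext => x; have [_ ->] := is_diff_cst c x.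
Qed.

(** The inductions on [k] go through this form: the differential is replaced by a formula [df] valid
    on [U], whose values on a fixed vector are left to the induction hypothesis. *)
Lemma Ck_eqd {V W} k (U : set V) (f : V -> W) (df : V -> V -> W) :
  open U -> (forall x, U x -> is_diff x f (df x)) ->
  (forall v, Ck k U (df ^~ v)) -> Ck k.+1 U f.
Proof.
move=> oU H1 H2; split=> [x Ux|v]; first by have [] := H1 x Ux.
by apply: Ck_ext (H2 v) => // x Ux; have [_ ->] := H1 x Ux.
Qed.

Lemma CkSd {V W} k (U : set V) (f : V -> W) x :
  Ck k.+1 U f -> U x -> is_diff x f ('d f x).
Proof. by move=> [H _] /H; apply: differentiableP. Qed.

Lemma Ck_add {V W} k (U : set V) (f g : V -> W) : open U ->
  Ck k U f -> Ck k U g -> Ck k U (fun x => f x + g x).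
Proof.
move=> oU; elim: k f g => [|k IH] f g Cf Cg.
  by move=> x Ux; apply: cvgD; [apply: Cf|apply: Cg].
apply: (Ck_eqd (df := fun x v => 'd f x v + 'd g x v)) => // [x Ux|v].
  exact: is_diffD (CkSd Cf Ux) (CkSd Cg Ux).
by apply: IH; [apply: Cf.2|apply: Cg.2].
Qed.

Lemma Ck_scale {V W} k (U : set V) (f : V -> R) (g : V -> W) : open U ->
  Ck k U f -> Ck k U g -> Ck k U (fun x => f x *: g x).
Proof.
move=> oU; elim: k f g => [|k IH] f g Cf Cg.
  by move=> x Ux; apply: cvgZ; [apply: Cf|apply: Cg].
apply: (Ck_eqd (df := fun x v => f x *: 'd g x v + 'd f x v *: g x)) =>
  // [x Ux|v].
  exact: is_diffZZ (CkSd Cf Ux) (CkSd Cg Ux).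
apply: Ck_add => [//||].
  exact: IH (CkS Cf) (Cg.2 v).
exact: IH (Cf.2 v) (CkS Cg).
Qed.

Lemma Ck_sum {V W} k (U : set V) n (f : 'I_n -> V -> W) : open U ->
  (forall i, Ck k U (f i)) -> Ck k U (fun x => \sum_i f i x).
Proof.
move=> oU; elim: n f => [|n IH] f H.
  by rewrite (_ : (fun x => _) = fun=> 0);
    [apply: Ck_cst|apply/funext=> x; rewrite big_ord0].
rewrite (_ : (fun y => _) =
    fun y => (\sum_i f (widen_ord (leqnSn n) i) y) + f ord_max y).
  by apply: Ck_add => //; apply: IH.
by apply/funext => y; rewrite big_ord_recr.
Qed.

Lemma Ck_coord n k (U : set 'rV[R]_n) i :
  Ck k U (fun x : 'rV[R]_n => x 0 i).
Proof.
case: k => [|k]; first by move=> x _; apply: coord_continuous.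
split=> [x _|v]; first by have [] := is_diff_coord x i.
rewrite (_ : (fun x => _) = fun _ => v 0 i); first exact: Ck_cst.
by apply/funext => x; have [_ ->] := is_diff_coord x i.
Qed.

Lemma Ck_rV {V} n k (U : set V) (f : V -> 'rV[R]_n) : open U ->
  (forall i, Ck k U (fun x => f x 0 i)) -> Ck k U f.
Proof.
move=> oU H.
rewrite (_ : f = fun y => \sum_i (f y 0 i *: delta_mx 0 i)); last first.
  by apply/funext => y; rewrite -row_sum_delta.
by apply: Ck_sum => // i; apply: Ck_scale => //; apply: Ck_cst.
Qed.

Lemma Ck_comp {V W} n k (U : set V) (U' : set 'rV[R]_n) (f : V -> 'rV[R]_n)
    (g : 'rV[R]_n -> W) : open U -> (forall x, U x -> U' (f x)) ->
  Ck k U f -> Ck k U' g -> Ck k U (g \o f).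
Proof.
move=> oU UU'; elim: k W U' f g UU' => [|k IH] W U' f g UU' Cf Cg.
  by move=> x Ux; apply: continuous_comp; [apply: Cf|apply/Cg/UU'].
apply: (Ck_eqd (df := fun x v => 'd g (f x) ('d f x v))) => // [x Ux|v].
  exact: is_diff_comp (CkSd Cf Ux) (CkSd Cg (UU' _ Ux)).
(* [Ck] controls ['d g y v] for a fixed vector [v], while here the vector moves with [x]. Expanding
   it in the standard basis turns the chain rule into a sum of products to which the induction
   hypothesis applies. *)
rewrite (_ : (fun x => _) =
  fun x => \sum_i ('d f x v) 0 i *: 'd g (f x) (delta_mx 0 i)); last first.
  by apply/funext => x; rewrite /= diff_rV_sum.
apply: Ck_sum => // i; apply: Ck_scale => //.
  apply: (IH R setT (fun x => 'd f x v) (fun y : 'rV[R]_n => y 0 i)) => //.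
    exact: Cf.2.
  exact: Ck_coord.
apply: (IH _ U' f (fun y => 'd g y (delta_mx 0 i))) => //; first exact: CkS.
exact: Cg.2.
Qed.

End Ck.

(** * Lifting curves through submersions *)

Section Lusternik.
Context {R : realType}.

Lemma subrBB (V : zmodType) (a b p q c : V) :
  a - (p - c) - (b - (q - c)) = - (p - q - (a - b)).
Proof.
have -> : a - (p - c) - (b - (q - c)) = a - b - ((p - c) - (q - c)).
  move: (p - c) (q - c) => x y.
  by rewrite [in LHS]opprB [in RHS]opprB addrACA [RHS]addrACA [- x - b]addrC.
have -> : (p - c) - (q - c) = p - q by rewrite opprB addrA subrK.
by rewrite [RHS]opprB.
Qed.

Lemma ler_coord_norm n (v : 'rV[R]_n) i : `|v 0 i| <= `|v|.
Proof.
rewrite [leRHS]/Num.Def.normr /= mx_normrE.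
exact: (le_bigmax _ (fun ij : 'I_1 * 'I_n => `|v ij.1 ij.2|) (0, i)).
Qed.

Lemma normr_rV_le n (v : 'rV[R]_n) c :
  0 <= c -> (forall i, `|v 0 i| <= c) -> `|v| <= c.
Proof.
move=> c0 H; rewrite [leLHS]/Num.Def.normr /= mx_normrE.
by apply: bigmax_le => // -[i j] _ /=; rewrite ord1.
Qed.

(** The mean value theorem on the segment from [y] to [x], for one coordinate of [f] at a time.
    Continuity of the partial derivatives at [p] makes the estimate uniform in the pair [(x, y)],
    and this uniformity is what makes the iteration in [curve_lifting] a contraction. *)
Lemma strictly_differentiable n m (U : set 'rV[R]_n)
    (f : 'rV[R]_n -> 'rV[R]_m) (df : 'rV[R]_n -> {linear 'rV[R]_n -> 'rV[R]_m})
    p : open U -> U p -> (forall x, U x -> is_diff x f (df x)) ->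
  (forall v, {for p, continuous (df ^~ v)}) ->
  forall e : R, 0 < e -> \forall d \near 0^'+, forall x y, ball p d x -> ball p d y ->
    `|f x - f y - df p (x - y)| <= e * `|x - y|.
Proof.
move=> oU Up Hf Cf e e0.
(* Each of the [n] partial derivatives contributes an error of at most [eta] times the length of the
   segment; the successor keeps the quotient meaningful for [n = 0]. *)
pose eta := e / n.+1%:R.
have eta0 : 0 < eta by rewrite divr_gt0.
have : \forall x \near p, U x /\ forall j : 'I_n,
    `|df p (delta_mx 0 j) - df x (delta_mx 0 j)| < eta.
  apply: filterI; first exact: open_nbhs_nbhs.
  apply: (filter_forall (F := nbhs p)) => j.
  by have /cvgrPdist_lt := Cf (delta_mx 0 j); apply.
move=> /nbhs_ballP[r /= r0 Hr].
near=> d => x y px py.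
have d0 : 0 < d by near: d; apply: nbhs_right_gt.
have dr : d <= r by near: d; apply: nbhs_right_le.
apply: normr_rV_le => [|i]; first by rewrite mulr_ge0// ltW.
pose g (t : R) : R := f (t *: (x - y) + y) 0 i.
have pt (t : R) : t \in `[0, 1]%R -> ball p d (t *: (x - y) + y).
  rewrite in_itv /= => /andP[t0 t1].
  have -> : t *: (x - y) + y = t *: x + (1 - t) *: y.
    by rewrite scalerBr scalerBl scale1r -addrA [- _ + y]addrC.
  move: px py; rewrite -ball_normE /= => px py.
  have -> : p - (t *: x + (1 - t) *: y) = t *: (p - x) + (1 - t) *: (p - y).
    rewrite !scalerBr opprD addrACA -scalerDl.
    by rewrite [t + _]addrC subrK scale1r.
  have := ler_normD (t *: (p - x)) ((1 - t) *: (p - y)).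
  rewrite !normrZ (ger0_norm t0) ger0_norm ?subr_ge0//.
  move=> /le_lt_trans; apply.
  (* The strict inequality below comes from the term with factor [t], which vanishes at [t = 0]. *)
  have [->|tn0] := eqVneq t 0; first by rewrite mul0r add0r subr0 mul1r.
  apply: (@lt_le_trans _ _ (t * d + (1 - t) * d)).
    apply: ltr_leD; first by rewrite ltr_pM2l // lt0r tn0.
    by apply: ler_wpM2l; [rewrite subr_ge0|apply: ltW].
  by rewrite -mulrDl [t + _]addrC subrK mul1r.
have dg (t : R) : t \in `[0, 1]%R ->
    is_derive t 1 g (df (t *: (x - y) + y) (x - y) 0 i).
  move=> /pt bt.
  have Ut : U (t *: (x - y) + y) by apply: (Hr _ (le_ball dr bt)).1.
  have D1 : is_diff t (fun t : R => t *: (x - y) + y) (fun h => h *: (x - y)).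
    have := is_diffD (is_diff_scalel t (x - y)) (is_diff_cst y t).
    by rewrite (_ : _ + 0 = fun h => h *: (x - y)) //; apply/funext => h;
      rewrite fctE addr0.
  have := (is_diff_rV _ _ _).2 (is_diff_comp D1 (Hf _ Ut)) => /(_ i) D2.
  apply: DeriveDef.
    by apply: diff_derivable; apply: ex_diff.
  by rewrite deriveE ?diff_val /= ?scale1r//; apply: ex_diff.
pose F (t : R) : R := df (t *: (x - y) + y) (x - y) 0 i.
have H1 (t : R) : t \in `]0, 1[%R -> is_derive t 1 g (F t).
  rewrite in_itv /= => /andP[t0 t1].
  by apply: dg; rewrite in_itv /= !ltW.
have H2 : {within `[0, 1], continuous g}.
  by apply: derivable_within_continuous => t /dg[].
have [s sI] := @MVT_segment R g F 0 1 ler01 H1 H2.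
rewrite /g /F scale1r scale0r add0r subrK subr0 mulr1 => gE.
have -> : (f x - f y - df p (x - y)) 0 i =
    df (s *: (x - y) + y) (x - y) 0 i - df p (x - y) 0 i.
  by rewrite -gE !mxE.
have E z : df z (x - y) 0 i =
    \sum_j (x - y) 0 j * df z (delta_mx 0 j) 0 i.
  rewrite [in LHS](row_sum_delta (x - y)) linear_sum summxE.
  by apply: eq_bigr => j _; rewrite linearZ [LHS]mxE.
rewrite (E p) (E (s *: (x - y) + y)) -sumrB.
apply: (le_trans (ler_norm_sum _ _ _)).
apply: (@le_trans _ _ (\sum_(j < n) `|x - y| * eta)).
  apply: ler_sum => j _; rewrite -mulrBr normrM.
  apply: ler_pM => //; first exact: ler_coord_norm.
  have := ltW ((Hr _ (le_ball dr (pt s sI))).2 j); rewrite distrC.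
  by apply: le_trans; have := ler_coord_norm
    (df (s *: (x - y) + y) (delta_mx 0 j) - df p (delta_mx 0 j)) i;
    rewrite !mxE.
rewrite sumr_const card_ord -mulr_natr -mulrA mulrC; apply: ler_wpM2r => //.
by rewrite /eta -mulrA ler_piMr ?(ltW e0)// mulrC ler_pdivrMr// mul1r ler_nat.
Unshelve. all: by end_near. Qed.

(** The closed ball of radius [rho] is stable because [N w] has norm at most that of [N 0] plus half
    that of [w]; Banach's fixed point theorem then applies on it. *)
Lemma contraction_fixpoint m (N : 'rV[R]_m -> 'rV[R]_m) (rho : R) :
  `|N 0| <= rho / 2 ->
  (forall w w', `|w| <= rho -> `|w'| <= rho -> `|N w - N w'| <= `|w - w'| / 2) ->
  exists2 w, `|w| <= rho & N w = w.
Proof.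
move=> N0 NL.
have rho0 : 0 <= rho.
  by rewrite -(pmulr_lge0 _ (_ : 0 < 2^-1)) ?invr_gt0// (le_trans _ N0).
pose A := [set w : 'rV[R]_m | `|w| <= rho].
have NA : {homo N : w / A w >-> A w}.
  move=> w Aw; rewrite /A /=.
  have -> : N w = N 0 + (N w - N 0) by rewrite addrC subrK.
  apply: (le_trans (ler_normD _ _)); rewrite [leRHS]splitr lerD//.
  have A0 : `|0 : 'rV[R]_m| <= rho by rewrite normr0.
  apply: (le_trans (NL w 0 Aw A0)).
  by rewrite subr0 ler_wpM2r// invr_ge0.
pose X : completeNormedModType R := HB.pack 'M[R]_(1, m)
  (Uniform_isComplete.Build 'M[R]_(1, m) (@mx_complete R 1 m)).
have cN : is_contraction (mkfun_fun NA : {fun (A : set X) >-> (A : set X)}).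
  exists ((2^-1)%:nng); split => /=; first by rewrite invf_lt1// ltr1n.
  by move=> [w w'] [/= Aw Aw']; rewrite mulrC; apply: NL.
have cA : closed (A : set X).
  rewrite (_ : A = (fun w : 'rV_m => `|w|) @^-1` [set x | x <= rho])//.
  by apply: preimage_closed; [move=> x _; apply: norm_continuous|exact: closed_le].
have A0 : (A : set X) !=set0 by exists 0; rewrite /A /= normr0.
have [w Aw wE] := banach_fixed_point cN cA A0.
by exists w; [exact: Aw|exact: esym wE].
Qed.

(* Lyusternik's theorem, with parameters: the correction [w] solving
   [Phi (p + t u + B w) = c t], where [B] is a right inverse of [d Phi], is the
   fixed point of a contraction and is [o(t)]. *)
Lemma curve_lifting n m (U : set 'rV[R]_n) (Phi : 'rV[R]_n -> 'rV[R]_m)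
    (dPhi : 'rV[R]_n -> {linear 'rV[R]_n -> 'rV[R]_m}) p u
    (c dc : R -> 'rV[R]_m) :
  open U -> U p -> (forall x, U x -> is_diff x Phi (dPhi x)) ->
  (forall v, {for p, continuous (dPhi ^~ v)}) -> (forall w, exists v, dPhi p v = w) ->
  is_diff 0 c dc -> c 0 = Phi p -> dc 1 = dPhi p u ->
  exists gamma : R -> 'rV[R]_n,
    [/\ gamma 0 = p, is_diff 0 gamma (fun h => h *: u) &
        \forall t \near 0, Phi (gamma t) = c t].
Proof.
move=> oU Up HPhi CPhi surj Dc c0 dc1.
have [b Hb] : exists b : 'I_m -> 'rV[R]_n,
    forall j, dPhi p (b j) = delta_mx 0 j.
  have [b Hb] := choice (fun j : 'I_m => surj (delta_mx 0 j)).
  by exists b.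
pose B (w : 'rV[R]_m) : 'rV[R]_n := \sum_j w 0 j *: b j.
have Blin : linear B.
  move=> a x y; rewrite /B scaler_sumr -big_split /=; apply: eq_bigr => j _.
  by rewrite !mxE scalerDl scalerA.
pose BlM := GRing.isLinear.Build _ _ _ _ _ Blin.
pose BL : {linear 'rV[R]_m -> 'rV[R]_n} := HB.pack B BlM.
have dPhiB w : dPhi p (B w) = w.
  rewrite {2}(row_sum_delta w) /B linear_sum; apply: eq_bigr => j _.
  by rewrite linearZ /= Hb.
(* [C] bounds the operator norm of [B]; the summand 1 makes it positive, so that it can be divided
   by. *)
pose C : R := 1 + \sum_j `|b j|.
have C0 : 0 < C by rewrite ltr_pwDl// sumr_ge0.
have BC w : `|B w| <= C * `|w|.
  apply: (le_trans (ler_norm_sum _ _ _)).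
  apply: (@le_trans _ _ (\sum_j `|b j| * `|w|)).
    by apply: ler_sum => j _; rewrite normrZ mulrC ler_wpM2l// ler_coord_norm.
  by rewrite -mulr_suml ler_wpM2r// lerDr.
(* With the constant [(2 * C)^-1] the map [N] below contracts by one half: the factor [C] lost in
   passing from [w] to [B w] is compensated. *)
have e0 : 0 < (2 * C)^-1 by rewrite invr_gt0 mulr_gt0.
have [d [d0 Hd]] : exists d : R, 0 < d /\ forall x y, ball p d x -> ball p d y ->
    `|Phi x - Phi y - dPhi p (x - y)| <= (2 * C)^-1 * `|x - y|.
  have := strictly_differentiable oU Up HPhi CPhi e0.
  move=> H; near (0 : R)^'+ => d; exists d; split; last exact: (near H d).
  by near: d; apply: nbhs_right_gt.
(* The defect of the straight line. Its differential at 0 vanishes because [dc 1 = dPhi p u]. *)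
pose D (t : R) := Phi (p + t *: u) - c t.
have D1 : is_diff 0 (fun t : R => p + t *: u) (fun h => h *: u).
  apply: is_diff_eq (is_diffD (is_diff_cst p (0 : R)) (is_diff_scalel (0 : R) u)) _.
  by apply/funext => h; exact: add0r.
have dcE h : dc h = h *: dc 1.
  by have [_ <-] := Dc; rewrite -linearZ /= [h *: _]mulr1.
have DD : is_diff 0 D 0.
  have E : p + (0 : R) *: u = p by rewrite scale0r addr0.
  have HP : is_diff (p + (0 : R) *: u) Phi (dPhi p) by rewrite E; apply: HPhi.
  apply: is_diff_eq (is_diffB (is_diff_comp D1 HP) Dc) _.
  apply/funext => h.
  have Eh : dPhi p (h *: u) = dc h by rewrite [dc h]dcE dc1 linearZ.
  exact: etrans (congr1 (fun z => z - dc h) Eh) (subrr _).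
have D00 : D 0 = 0 by rewrite /D scale0r addr0 c0 subrr.
have Dcont : D t @[t --> 0] --> (0 : 'rV[R]_m).
  have [dD _] := DD.
  by have := differentiable_continuous dD; rewrite /prop_for /continuous_at D00.
(* The factor 2 in the radius is there because [N 0 = - D t] must have at most half the norm of the
   radius. *)
have [w Hw] : exists w : R -> 'rV[R]_m, \forall t \near 0,
    `|w t| <= 2 * `|D t| /\ Phi (p + t *: u + B (w t)) = c t.
  have : \forall t \near 0, exists w : 'rV[R]_m,
      `|w| <= 2 * `|D t| /\ Phi (p + t *: u + B w) = c t.
    near=> t.
    have tu : `|t *: u| < d / 2.
      near: t; have : (t *: u @[t --> 0]) --> (0 : 'rV[R]_n).
        by rewrite -(scale0r u); apply: scalel_continuous.
      move=> /cvgrPdist_lt/(_ (d / 2)); rewrite divr_gt0//= => /(_ isT).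
      by apply: filterS => t; rewrite sub0r normrN.
    (* This bound makes the norm of [B w] at most [d / 4]; together with [t *: u] being shorter than
       [d / 2] it keeps all the points considered in the ball where the estimate [Hd] holds. *)
    have Dt : 2 * `|D t| <= d / (4 * C).
      have : `|D t| <= d / (8 * C).
        near: t; move: Dcont => /cvgrPdist_le/(_ (d / (8 * C))).
        rewrite divr_gt0 ?mulr_gt0//= => /(_ isT).
        by apply: filterS => t; rewrite sub0r normrN.
      rewrite -(ler_pM2l (_ : 0 < 2))// => /le_trans; apply.
      rewrite le_eqVlt; apply/orP; left; apply/eqP.
      by field; rewrite gt_eqF.
    have pb w : `|w| <= 2 * `|D t| -> ball p d (p + t *: u + B w).
      move=> Hw; rewrite -ball_normE /= opprD opprD addrA addrA subrr sub0r.
      rewrite -opprD normrN (le_lt_trans (ler_normD _ _))// [ltRHS]splitr.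
      apply: ltr_leD => //; apply: (le_trans (BC _)).
      apply: (@le_trans _ _ (C * (d / (4 * C)))).
        by rewrite ler_pM2l//; apply: le_trans Dt.
      have -> : C * (d / (4 * C)) = d / 4 by field; rewrite gt_eqF.
      by rewrite ler_pM2l// lef_pV2 ?posrE// ler_nat.
    (* A Newton step with the differential frozen at [p], written through the right inverse [B]; its
       fixed points are exactly the solutions. *)
    pose N w := w - (Phi (p + t *: u + B w) - c t).
    have [||w Hw1 Hw2] := @contraction_fixpoint m N (2 * `|D t|).
    - rewrite /N /B big1 => [|j _]; last by rewrite mxE scale0r.
      by rewrite addr0 sub0r normrN -/(D t) mulrC mulKf.
    - move=> w1 w2 H1 H2.
      have := Hd _ _ (pb _ H1) (pb _ H2).
      set x1 := p + t *: u + B w1; set x2 := p + t *: u + B w2.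
      have -> : x1 - x2 = B (w1 - w2).
        have -> : B (w1 - w2) = B w1 - B w2 by exact: (raddfB BL).
        by rewrite /x1 /x2 opprD addrACA subrr add0r.
      rewrite dPhiB => H.
      have -> : N w1 - N w2 = - (Phi x1 - Phi x2 - (w1 - w2)).
        exact: subrBB.
      rewrite normrN; apply: (le_trans H).
      rewrite mulrC ler_pdivrMr ?mulr_gt0//; apply: (le_trans (BC _)).
      by rewrite mulrC -mulrA mulrA mulrA -(mulrA _ 2^-1) mulVf// mulr1.
    - exists w; split=> //.
      move/eqP: Hw2; rewrite /N subr_eq addrC -subr_eq subrr eq_sym subr_eq0.
      by move/eqP.
  move=> H; have H' t : exists w : 'rV[R]_m, (exists w : 'rV[R]_m,
      `|w| <= 2 * `|D t| /\ Phi (p + t *: u + B w) = c t) ->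
      `|w| <= 2 * `|D t| /\ Phi (p + t *: u + B w) = c t.
    have [[w ?]|] := pselect (exists w : 'rV[R]_m,
      `|w| <= 2 * `|D t| /\ Phi (p + t *: u + B w) = c t); first by exists w.
    by exists 0.
  have [w Hw] := choice H'; exists w.
  by apply: filterS H => t; apply: Hw.
have w0 : w 0 = 0.
  have [] := nbhs_singleton Hw; rewrite D00 normr0 mulr0 normr_le0 => /eqP //.
have Dw : is_diff 0 w 0.
  apply: (is_diff0_dominated (ltr0Sn _ 1) _ DD).
  by apply: filterS Hw => t [+ _]; rewrite w0 D00 !subr0.
exists (fun t => p + t *: u + B (w t)); split.
- by rewrite w0 scale0r addr0 (linear0 BL : B 0 = 0) addr0.
- apply: is_diff_eq (is_diffD D1 (is_diff_comp Dw (is_diff_lin BL (w 0)))) _.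
  apply/funext => h; have E0 : BL 0 = 0 by exact: linear0.
  exact: etrans (congr1 (fun z => h *: u + z) E0) (addr0 _).
- by apply: filterS Hw => t [].
Unshelve. all: by end_near. Qed.

End Lusternik.

(** * Smooth maps on open subsets of normed spaces *)

Section Coo.
Context {R : realType}.
Implicit Types V W : normedModType R.

Lemma Coo_ext {V W} (U : set V) (f g : V -> W) :
  open U -> (forall x, U x -> f x = g x) -> Coo U f -> Coo U g.
Proof. by move=> oU fg H k; apply: Ck_ext (H k). Qed.

Lemma Coo_sub {V W} (U U' : set V) (f : V -> W) :
  U `<=` U' -> Coo U' f -> Coo U f.
Proof. by move=> UU' H k; apply: Ck_sub (H k). Qed.

Lemma Coo_loc {V W} (U : set V) (f : V -> W) :
  (forall x, U x -> exists2 U', U' x & Coo U' f) -> Coo U f.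
Proof. by move=> H k; apply: Ck_loc => x /H[U' ? ?]; exists U'. Qed.

Lemma Coo_comp {V W} n (U : set V) (U' : set 'rV[R]_n) (f : V -> 'rV[R]_n)
    (g : 'rV[R]_n -> W) : open U -> (forall x, U x -> U' (f x)) ->
  Coo U f -> Coo U' g -> Coo U (fun x => g (f x)).
Proof. by move=> oU UU' Cf Cg k; apply: (Ck_comp oU UU') (Cf k) (Cg k). Qed.

Lemma Coo_cst {V W} (U : set V) (c : W) : Coo U (fun _ : V => c).
Proof. by move=> k; apply: Ck_cst. Qed.

Lemma Coo_add {V W} (U : set V) (f g : V -> W) : open U ->
  Coo U f -> Coo U g -> Coo U (fun x => f x + g x).
Proof. by move=> oU Cf Cg k; apply: Ck_add (Cf k) (Cg k). Qed.

Lemma Coo_scale {V W} (U : set V) (f : V -> R) (g : V -> W) : open U ->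
  Coo U f -> Coo U g -> Coo U (fun x => f x *: g x).
Proof. by move=> oU Cf Cg k; apply: Ck_scale (Cf k) (Cg k). Qed.

Lemma Coo_sum {V W} (U : set V) n (f : 'I_n -> V -> W) : open U ->
  (forall i, Coo U (f i)) -> Coo U (fun x => \sum_i f i x).
Proof. by move=> oU H k; apply: Ck_sum => // i; apply: H. Qed.

Lemma Coo_coord n (U : set 'rV[R]_n) i : Coo U (fun x : 'rV[R]_n => x 0 i).
Proof. by move=> k; apply: Ck_coord. Qed.

Lemma Coo_rV {V} n (U : set V) (f : V -> 'rV[R]_n) : open U ->
  (forall i, Coo U (fun x => f x 0 i)) -> Coo U f.
Proof. by move=> oU H k; apply: Ck_rV => // i; apply: H. Qed.

Lemma Coo_lin n m (U : set 'rV[R]_n) (f : {linear 'rV[R]_n -> 'rV[R]_m}) :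
  open U -> Coo U f.
Proof.
move=> oU; have -> : (f : _ -> _) = fun x => \sum_i x 0 i *: f (delta_mx 0 i).
  apply/funext => x; rewrite {1}(row_sum_delta x) linear_sum.
  by apply: eq_bigr => i _; rewrite linearZ.
apply: Coo_sum => // i; apply: Coo_scale => //; first exact: Coo_coord.
exact: Coo_cst.
Qed.

Lemma Coo_id n (U : set 'rV[R]_n) : open U -> Coo U (fun x => x).
Proof. by move=> oU; apply: Coo_rV => // i; apply: Coo_coord. Qed.

Lemma Coo_row_mx {V} n m (U : set V) (f : V -> 'rV[R]_n) (g : V -> 'rV[R]_m) :
  open U -> Coo U f -> Coo U g -> Coo U (fun x => row_mx (f x) (g x)).
Proof.
move=> oU Cf Cg; apply: Coo_rV => // i.
rewrite -(splitK i); case: (fintype.split i) => j /=.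
  apply: (Coo_ext oU (f := fun x => f x 0 j)).
    by move=> x _; rewrite row_mxEl.
  by apply: (Coo_comp (U' := setT) (g := fun x => x 0 j)) => //; apply: Coo_coord.
apply: (Coo_ext oU (f := fun x => g x 0 j)).
  by move=> x _; rewrite row_mxEr.
by apply: (Coo_comp (U' := setT) (g := fun x => x 0 j)) => //; apply: Coo_coord.
Qed.

Lemma Coo_is_diff {V W} (U : set V) (f : V -> W) x : Coo U f -> U x ->
  is_diff x f ('d f x).
Proof. by move=> /(_ 1%N); apply: CkSd. Qed.

Lemma Coo_continuous {V W} (U : set V) (f : V -> W) x : Coo U f -> U x ->
  {for x, continuous f}.
Proof. by move=> /(_ 0%N); apply. Qed.

Lemma Coo_d {V W} (U : set V) (f : V -> W) v : Coo U f ->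
  Coo U (fun x => 'd f x v).
Proof. by move=> H k; apply: (H k.+1).2. Qed.

Lemma Coo_open_preim {V W} (U : set V) (U' : set W) (f : V -> W) :
  open U -> Coo U f -> open U' -> open [set x | U x /\ U' (f x)].
Proof.
move=> oU Cf oU'; rewrite openE => x [Ux U'x]; apply: filterI.
  exact: open_nbhs_nbhs.
by apply: (Coo_continuous Cf Ux); apply: open_nbhs_nbhs.
Qed.

Lemma Coo_lsubmx n m (U : set 'rV[R]_(n + m)) : open U ->
  Coo U (lsubmx : 'rV[R]_(n + m) -> 'rV[R]_n).
Proof. exact: (Coo_lin (@lsubmx R 1 n m : {linear _ -> _})). Qed.

Lemma Coo_rsubmx n m (U : set 'rV[R]_(n + m)) : open U ->
  Coo U (rsubmx : 'rV[R]_(n + m) -> 'rV[R]_m).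
Proof. exact: (Coo_lin (@rsubmx R 1 n m : {linear _ -> _})). Qed.

Lemma open_lsubmx n m (U : set 'rV[R]_n) : open U ->
  open [set z : 'rV[R]_(n + m) | U (lsubmx z)].
Proof.
move=> oU; have := Coo_open_preim (@openT _) (Coo_lsubmx (n:=n) (m:=m) (@openT _)) oU.
by congr open; apply/seteqP; split => z //= [].
Qed.

Lemma open_rsubmx n m (U : set 'rV[R]_m) : open U ->
  open [set z : 'rV[R]_(n + m) | U (rsubmx z)].
Proof.
move=> oU; have := Coo_open_preim (@openT _) (Coo_rsubmx (n:=n) (m:=m) (@openT _)) oU.
by congr open; apply/seteqP; split => z //= [].
Qed.

(** The coordinate form of a tangent map. The vector is a variable as well, so it is expanded in the
    standard basis before smoothness of the directional derivatives can be used. *)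
Lemma Coo_tangent n m (U : set 'rV[R]_n) (f : 'rV[R]_n -> 'rV[R]_m) :
  open U -> Coo U f ->
  Coo [set z : 'rV[R]_(n + n) | U (lsubmx z)]
    (fun z => 'd f (lsubmx z) (rsubmx z)).
Proof.
move=> oU Cf; have oU2 := @open_lsubmx n n U oU.
apply: (Coo_ext oU2 (f := fun z : 'rV[R]_(n + n) => \sum_i (rsubmx z) 0 i *:
    'd f (lsubmx z) (delta_mx 0 i))).
  by move=> z _; rewrite -diff_rV_sum.
apply: Coo_sum => // i; apply: Coo_scale => //.
  apply: (Coo_comp (U' := setT) (g := fun x => x 0 i)) => //.
    exact: Coo_rsubmx.
  exact: Coo_coord.
apply: (Coo_comp (U' := U) (g := fun x => 'd f x (delta_mx 0 i))) => //.
  exact: Coo_lsubmx.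
exact: Coo_d.
Qed.

(** Induction on the order with [a] kept smooth: the derivative of [1 / a] is a product of two
    inverses, of the order already treated, and of the derivative of [a]. *)
Lemma Coo_inv {V} (U : set V) (a : V -> R) : open U ->
  (forall x, U x -> a x != 0) -> Coo U a -> Coo U (fun x => (a x)^-1).
Proof.
move=> oU a0 Ca; elim=> [|k IH].
  by move=> x Ux; apply: cvgV; [apply: a0|apply: Coo_continuous Ux].
have dV x : U x ->
    is_diff x (fun y => (a y)^-1) (fun v => - ((a x)^-1 * (a x)^-1) *: 'd a x v).
  move=> Ux; have [da _] := Coo_is_diff Ca Ux.
  apply: DiffDef; first exact: differentiableV (a0 _ Ux).
  rewrite (diffV da (a0 _ Ux)); apply/funext => v.
  by rewrite expr2 invfM.
apply: (Ck_eqd oU dV) => v; apply: Ck_scale => //; last exact: (Ca k.+1).2.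
apply: (Ck_ext oU (f := fun x => (-1) *: ((a x)^-1 *: (a x)^-1))).
  by move=> x _; rewrite /GRing.scale /= mulN1r.
by apply: Ck_scale => //; [apply: Ck_cst|apply: Ck_scale].
Qed.

End Coo.

(** * Manifolds *)

Section Choice.
Context {A : Type}.

Lemma theP (d : A) (P : set A) : (exists x, P x) -> P (the d P).
Proof. by case=> x Px; apply: (@xgetI {classic A} d P x). Qed.

Lemma the_uniq (d : A) (P : set A) x :
  P x -> (forall y, P y -> y = x) -> the d P = x.
Proof. exact: (@xget_unique {classic A} d P x). Qed.

End Choice.

Section Manifolds.
Context {R : realType}.
Implicit Types X Y Z W : mfd R.

Definition mnbhs {X} (p : X) (P : set X) :=
  exists O : set X, [/\ mopen O, O p & O `<=` P].

(** When the target is a manifold, [O] is automatically open, since [smooth_on] includes the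
    openness of the relevant chart images; see [smooth_on_open]. *)
Definition smooth_at {X Y} (f : X -> Y) (p : X) :=
  exists2 O : set X, O p & smooth_on O f.

Lemma chart_inj {X} (i : idx X) (p q : X) : is_mfd X ->
  cdom i p -> cdom i q -> chart i p = chart i q -> p = q.
Proof. by case=> + _ _ _; apply. Qed.

Lemma chart_cover {X} (p : X) : is_mfd X -> exists i : idx X, cdom i p.
Proof. by case=> _ [D [_ /(_ p)[i _ ip]]] _ _; exists i. Qed.

Lemma repE {X Y} (f : X -> Y) i j (q : X) : is_mfd X -> cdom i q ->
  rep f i j (chart i q) = chart j (f q).
Proof.
move=> mX iq; apply: the_uniq; first by exists q.
by move=> _ [q' [iq' qq'] <-]; rewrite (chart_inj mX iq' iq qq').
Qed.

Lemma mopenI {X} (O O' : set X) : is_mfd X -> mopen O -> mopen O' ->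
  mopen (O `&` O').
Proof.
move=> mX oO oO' i; have := openI (oO i) (oO' i); congr open.
apply/seteqP; split=> [x [[p [ Op ip] <-] [p' [ O'p' ip'] pp']] |
  x [p [[ Op O'p] ip] <-]].
  by exists p => //; split=> //; split=> //; rewrite -(chart_inj mX ip' ip pp').
by split; exists p.
Qed.

Lemma mopen_bigcup {X} (O : set X) :
  (forall p, O p -> exists O', [/\ mopen O', O' p & O' `<=` O]) -> mopen O.
Proof.
move=> H i; rewrite openE => _ [p [ Op ip] <-].
have [ O' [ oO' O'p O'O]] := H p Op.
have : nbhs (chart i p) (chart i @` (O' `&` cdom i)).
  by apply: open_nbhs_nbhs; split; [exact: oO'|exists p].
by apply: filterS => _ [q [ O'q iq] <-]; exists q => //; split=> //; exact: O'O.
Qed.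

Lemma mopen_cdom {X} (i : idx X) : is_mfd X -> mopen (cdom i).
Proof.
case=> _ _ sX _ j; have [+ _] := sX j i; congr open.
by apply/seteqP; split=> [_ [p [[_ jp] ip] <-] |_ [p [ip jp] <-] ]; exists p.
Qed.

Lemma mopenT {X} : is_mfd X -> mopen [set: X].
Proof.
move=> mX; apply: mopen_bigcup => p _; have [i ip] := chart_cover p mX.
by exists (cdom i); split=> //; apply: mopen_cdom.
Qed.

Lemma open_chart_image {X} (i : idx X) : is_mfd X -> open (chart i @` cdom i).
Proof.
move=> mX; have oc : mopen (cdom i) by apply: mopen_cdom.
have := oc i; congr open.
by apply/seteqP; split=> [_ [p [? ?] <-] |_ [p ? <-] ]; exists p.
Qed.

Lemma mopen_chart_preim {X} (i : idx X) (U : set 'rV[R]_(mdim X)) :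
  is_mfd X -> open U -> mopen [set q | cdom i q /\ U (chart i q)].
Proof.
move=> mX oU j; have [_ _ sX _] := mX; have [ oD CD] := sX j i.
have := Coo_open_preim oD CD oU; congr open.
apply/seteqP; split=> [_ [[p [[_ jp] ip] <-]] |_ [p [[ip Uip] jp] <-]].
  by rewrite repE// => Up; exists p.
by rewrite /= repE//; split=> //; exists p.
Qed.

Lemma mnbhs_chartI {X} (i : idx X) (p : X) (U : set 'rV[R]_(mdim X))
    (P : set X) : is_mfd X -> cdom i p -> open U -> U (chart i p) ->
  (forall q, cdom i q -> U (chart i q) -> P q) -> mnbhs p P.
Proof.
move=> mX ip oU Up H; exists [set q | cdom i q /\ U (chart i q)].
by split=> //; [apply: mopen_chart_preim|move=> q [? ?]; apply: H].
Qed.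

Lemma mnbhs_chart {X} (i : idx X) (p : X) (P : set X) : is_mfd X ->
  mnbhs p P -> cdom i p -> exists U, [/\ open U, U (chart i p) &
    forall x, U x -> exists q, [/\ cdom i q, chart i q = x & P q]].
Proof.
move=> mX [ O [ oO Op OP]] ip; exists (chart i @` (O `&` cdom i)); split.
- exact: oO.
- by exists p.
- by move=> _ [q [ Oq iq] <-]; exists q; split=> //; apply: OP.
Qed.

Lemma mnbhs_singleton {X} (p : X) P : mnbhs p P -> P p.
Proof. by case=> O [_ Op]; apply. Qed.

Lemma mnbhsS {X} (p : X) (P Q : set X) : P `<=` Q -> mnbhs p P -> mnbhs p Q.
Proof.
by move=> PQ [ O [ oO Op OP]]; exists O; split=> //; apply: subset_trans PQ.
Qed.

Lemma mnbhsI {X} (p : X) (P Q : set X) : is_mfd X ->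
  mnbhs p P -> mnbhs p Q -> mnbhs p (P `&` Q).
Proof.
move=> mX [ O [ oO Op OP]] [ O' [ oO' O'p O'Q]]; exists (O `&` O'); split=> //.
  exact: mopenI.
by apply: setISS.
Qed.

Lemma mnbhsT {X} (p : X) : is_mfd X -> mnbhs p setT.
Proof. by move=> mX; exists setT; split=> //; apply: mopenT. Qed.

Lemma mnbhs_open {X} (p : X) O : mopen O -> O p -> mnbhs p O.
Proof. by move=> oO Op; exists O; split. Qed.

Lemma mnbhs_nbhs {X} (p : X) P : mnbhs p P -> mnbhs p (fun q => mnbhs q P).
Proof.
by move=> [ O [ oO Op OP]]; exists O; split=> // q Oq; exists O; split.
Qed.

Lemma smooth_on_open {X Y} (O : set X) (f : X -> Y) : is_mfd Y ->
  smooth_on O f -> mopen O.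
Proof.
move=> mY sf i; rewrite openE => _ [p [ Op ip] <-].
have [j jp] := chart_cover (f p) mY; have [ oD _] := sf i j.
have : nbhs (chart i p) (chart i @` (O `&` cdom i `&` f @^-1` cdom j)).
  by apply: open_nbhs_nbhs; split=> //; exists p.
by apply: filterS => _ [q [[ Oq iq] _] <-]; exists q.
Qed.

Lemma smooth_at_chart {X Y} (f : X -> Y) (p : X) i j : is_mfd X ->
  smooth_at f p -> cdom i p -> cdom j (f p) ->
  exists U, [/\ open U, U (chart i p),
    forall x, U x -> exists q, [/\ cdom i q, chart i q = x & cdom j (f q)] &
    Coo U (rep f i j)].
Proof.
move=> mX [ O Op sf] ip jp; have [ oD CD] := sf i j; eexists; split.
- exact: oD.
- by exists p.
- by move=> _ [q [[_ iq] jq] <-]; exists q.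
- exact: CD.
Qed.

(** One pair of charts around [p] suffices: in any other pair the coordinate expression is [phi]
    composed with two transition maps, and its domain is cut out by theirs. *)
Lemma smooth_at_chartI {X Y} (f : X -> Y) (p : X) i j U phi : is_mfd X ->
  is_mfd Y -> cdom i p -> open U -> U (chart i p) ->
  (forall q, cdom i q -> U (chart i q) ->
     cdom j (f q) /\ chart j (f q) = phi (chart i q)) ->
  Coo U phi -> smooth_at f p.
Proof.
move=> mX mY ip oU Up Hf Cphi.
exists [set q | cdom i q /\ U (chart i q)] => // i' j' D.
have [_ _ sX _] := mX; have [_ _ sY _] := mY.
have [ oDi CDi] := sX i' i; have [ oDj CDj] := sY j j'.
set Di := (X in open X) in oDi; set Dj := (X in open X) in oDj.
pose tau := rep (id : X -> X) i' i.
have oE := Coo_open_preim oDi CDi oU.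
set E := (X in open X) in oE.
have CE : Coo E (fun x => phi (tau x)).
  apply: (Coo_comp (U' := U) (f := tau) (g := phi)) => //; first by move=> x [].
  by apply: Coo_sub CDi => x [].
have oF := Coo_open_preim oE CE oDj.
have DE : D = [set x | E x /\ Dj (phi (tau x))].
  apply/seteqP; split=> [_ [p' [[[ip' Up'] i'p'] j'p'] <-] |
      _ [[[p' [[_ i'p'] ip'] <-] Up'] Dp']].
    rewrite /E /tau /= repE//; split; first by split=> //; exists p'.
    have [jp' <-] := Hf _ ip' Up'; by exists (f p').
  move: Up' Dp'; rewrite /tau /= repE// => Up' Dp'.
  have [jp' E1] := Hf _ ip' Up'.
  exists p' => //; split=> //; move: Dp'; rewrite -E1 => -[q' [[_ jq'] j'q']] qq'.
  by rewrite /= -(chart_inj mY jq' jp' qq').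
split; first by rewrite DE.
rewrite DE; apply: (Coo_ext oF (f := fun x => rep (id : Y -> Y) j j' (phi (tau x)))).
  move=> _ [[[p' [[_ i'p'] ip'] <-] Up'] Dp'].
  move: Up' Dp'; rewrite /tau /= !repE// => Up' Dp'.
  by have [jp' <-] := Hf _ ip' Up'; rewrite repE.
apply: (Coo_comp (U' := Dj) (f := fun x => phi (tau x))) => //.
  by move=> x [].
by apply: Coo_sub CE => x [].
Qed.

Lemma smooth_on_at {X Y} (O : set X) (f : X -> Y) p :
  smooth_on O f -> O p -> smooth_at f p.
Proof. by move=> sf Op; exists O. Qed.

Lemma smooth_onI {X Y} (O : set X) (f : X -> Y) : is_mfd X -> mopen O ->
  (forall p, O p -> smooth_at f p) -> smooth_on O f.
Proof.
move=> mX oO H i j D.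
have L x : D x -> exists U, [/\ open U, U x, U `<=` D & Coo U (rep f i j)].
  move=> [p [[ Op ip] jp] <-].
  have [U [ oU Up HU CU]] := smooth_at_chart mX (H p Op) ip jp.
  exists (U `&` (chart i @` (O `&` cdom i))); split.
  - by apply: openI => //; exact: oO.
  - by split=> //; exists p.
  - move=> y [/HU[q' [iq' qq' jq']] [q [ Oq iq] E]]; exists q => //.
    have qE : q = q' by apply: (chart_inj mX iq iq'); rewrite E.
    by split=> //; rewrite qE.
  - by apply: Coo_sub CU => y [].
split.
  rewrite openE => x /L[U [ oU Ux UD _]].
  by apply: (filterS UD); apply: open_nbhs_nbhs.
by apply: Coo_loc => x /L[U [_ Ux _ CU]]; exists U.
Qed.

Lemma smoothP {X Y} (f : X -> Y) : is_mfd X ->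
  smooth f <-> forall p, smooth_at f p.
Proof.
move=> mX; split=> [sf p|H]; first exact: smooth_on_at sf _.
by apply: smooth_onI => //; exact: mopenT.
Qed.

Lemma mnbhs_preim {X Y} (f : X -> Y) (p : X) P : is_mfd X -> is_mfd Y ->
  smooth_at f p -> mnbhs (f p) P -> mnbhs p (f @^-1` P).
Proof.
move=> mX mY sf nP; have [i ip] := chart_cover p mX.
have [j jp] := chart_cover (f p) mY.
have [U [ oU Up HU CU]] := smooth_at_chart mX sf ip jp.
have [U' [ oU' Up' HU']] := mnbhs_chart mY nP jp.
apply: (mnbhs_chartI mX ip (Coo_open_preim oU CU oU')).
  by rewrite /= repE.
move=> q iq [/HU[q' [iq' + jq']]]; rewrite repE// => qq' /HU'[r [jr rq Pr]].
rewrite (chart_inj mX iq' iq qq') in jq'.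
by rewrite /= -(chart_inj mY jr jq' rq).
Qed.

Lemma smooth_at_comp {X Y Z} (f : X -> Y) (g : Y -> Z) (p : X) :
  is_mfd X -> is_mfd Y -> is_mfd Z ->
  smooth_at f p -> smooth_at g (f p) -> smooth_at (fun x => g (f x)) p.
Proof.
move=> mX mY mZ sf sg; have [i ip] := chart_cover p mX.
have [j jp] := chart_cover (f p) mY; have [k kp] := chart_cover (g (f p)) mZ.
have [U [ oU Up HU CU]] := smooth_at_chart mX sf ip jp.
have [V [ oV Vp HV CV]] := smooth_at_chart mY sg jp kp.
have oW := Coo_open_preim oU CU oV.
apply: (smooth_at_chartI (j := k) (phi := fun x => rep g j k (rep f i j x))
  mX mZ ip oW).
- by rewrite /= repE.
- move=> q iq [/HU[q' [iq' + jq']]]; rewrite repE// => qq'.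
  rewrite (chart_inj mX iq' iq qq') in jq' * => /HV[r [jr rq kr]].
  by rewrite repE// -(chart_inj mY jr jq' rq).
- apply: (Coo_comp (U' := V) (f := rep f i j)) => //; first by move=> x [].
  by apply: Coo_sub CU => x [].
Qed.

Lemma smooth_at_germ {X Y} (f g : X -> Y) (p : X) : is_mfd X -> is_mfd Y ->
  mnbhs p (fun q => f q = g q) -> smooth_at f p -> smooth_at g p.
Proof.
move=> mX mY fg sf; have [i ip] := chart_cover p mX.
have [j jp] := chart_cover (f p) mY.
have [U [ oU Up HU CU]] := smooth_at_chart mX sf ip jp.
have [V [ oV Vp HV]] := mnbhs_chart mX fg ip.
apply: (smooth_at_chartI (j := j) (phi := rep f i j) mX mY ip (openI oU oV)).
- by split.
- move=> q iq [/HU[q' [iq' qq' jq']] /HV[r [ir rq]]].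
  rewrite (chart_inj mX ir iq rq) => <-.
  by rewrite repE// -(chart_inj mX iq' iq qq').
- by apply: Coo_sub CU => x [].
Qed.

Lemma smooth_at_id {X} (p : X) : is_mfd X -> smooth_at (fun x : X => x) p.
Proof. by case=> _ _ sX _; exists setT. Qed.

Lemma smooth_at_cst {X Y} (c : Y) (p : X) : is_mfd X -> is_mfd Y ->
  smooth_at (fun _ : X => c) p.
Proof.
move=> mX mY; have [i ip] := chart_cover p mX; have [j jc] := chart_cover c mY.
apply: (smooth_at_chartI (j := j) (phi := fun=> chart j c) mX mY ip
  (@openT _)) => //.
exact: Coo_cst.
Qed.

Lemma smooth_at_nbhs {X Y} (f : X -> Y) (p : X) : is_mfd Y ->
  smooth_at f p -> mnbhs p (fun q => smooth_at f q).
Proof.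
move=> mY [ O Op sf]; exists O; split=> //; first exact: smooth_on_open sf.
by move=> q Oq; exists O.
Qed.

Lemma eucl_mfd n : is_mfd (eucl R n).
Proof.
split=> //.
- by exists setT; split=> [|p]; [exact: countableP|exists tt].
- move=> i j D.
  have DE : D = setT by apply/seteqP; split=> // x _; exists x.
  rewrite DE; split; first exact: openT.
  have CI : Coo [set: 'rV[R]_n] (fun x : 'rV[R]_n => x).
    by apply: Coo_id; exact: openT.
  apply: (Coo_ext (@openT 'rV[R]_n) _ CI).
  move=> x _; apply/esym/the_uniq; first by exists x.
  by move=> _ [q [_ /= ->] <-].
- move=> p q pq.
  have : hausdorff_space 'rV[R]_n by exact: norm_hausdorff.
  rewrite open_hausdorff => /(_ p q (introN eqP pq))[[A B] /=].
  rewrite !inE => -[Ap Bq] [ oA oB AB]; exists A, B; split=> //.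
  + by move=> i; move: oA; congr open; apply/seteqP; split=> [x|_ [x [? _] <-]//];
      exists x.
  + by move=> i; move: oB; congr open; apply/seteqP; split=> [x|_ [x [? _] <-]//];
      exists x.
Qed.

End Manifolds.

(** * Products of manifolds *)

Section Products.
Context {R : realType}.
Implicit Types X Y Z W : mfd R.

(** Points of a common chart are separated by Euclidean open sets, so the Hausdorff property is at
    stake only for points that share no chart. Transition maps are asked for as explicit formulas on
    explicit open sets, the form in which they are at hand for products, tangent bundles and Whitney
    sums. *)
Lemma mfdI X :
  (forall (i : idx X) (p q : X),
     cdom i p -> cdom i q -> chart i p = chart i q -> p = q) ->
  (exists D : set (idx X), countable D /\
     forall p : X, exists2 i, D i & cdom i p) ->
  (forall i j : idx X, exists U phi, [/\ open U, Coo U phi,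
     forall x, U x -> exists2 p : X, cdom i p & chart i p = x,
     forall p : X, cdom i p -> U (chart i p) <-> cdom j p &
     forall p : X, cdom i p -> cdom j p -> chart j p = phi (chart i p)]) ->
  (forall p q : X, p <> q -> (exists2 i, cdom i p & cdom i q) \/
     exists O O' : set X,
        [/\ mopen O, mopen O', O p, O' q & O `&` O' = set0]) ->
  is_mfd X.
Proof.
move=> inj cov tr sep.
have repE' f i j (q : X) : cdom i q -> rep f i j (chart i q) = chart j (f q).
  move=> iq; apply: the_uniq; first by exists q.
  by move=> _ [q' [iq' qq'] <-]; rewrite (inj i q' q iq' iq qq').
have sid : smooth (id : X -> X).
  move=> i j; have [U [phi [oU CU UI UE phiE]]] := tr i j.
  have -> : chart i @` ([set: X] `&` cdom i `&` id @^-1` cdom j) = U.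
    apply/seteqP; split=> [_ [q [[_ iq] jq] <-] |x Ux]; first by apply/UE.
    have [q iq qx] := UI x Ux; rewrite -qx in Ux *.
    by exists q => //; split=> //; apply/UE.
  split=> //; apply: (Coo_ext oU _ CU) => x Ux.
  have [q iq qx] := UI x Ux; rewrite -qx in Ux *.
  by rewrite repE'// phiE//; apply/UE.
split=> // p q pq; have [[i ip iq]|//] := sep p q pq.
have cpq : chart i p != chart i q by apply/eqP => /(inj i p q ip iq).
have : hausdorff_space 'rV[R]_(mdim X) by exact: norm_hausdorff.
rewrite open_hausdorff => /(_ _ _ cpq)[[A B] /=].
rewrite !inE => -[Ap Bq] [oA oB AB].
have oP (C : set 'rV[R]_(mdim X)) : open C ->
    mopen [set q | cdom i q /\ C (chart i q)].
  move=> oC j; have [U [phi [oU CU UI UE phiE]]] := tr j i.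
  have := Coo_open_preim oU CU oC; congr open.
  apply/seteqP; split=> [x [Ux Cx] |_ [r [[ir Cr] jr] <-] ].
    have [r jr rx] := UI x Ux; rewrite -rx in Ux Cx *.
    have ir : cdom i r by apply/UE.
    by exists r => //; split=> //; split=> //; rewrite phiE.
  by split; [apply/UE|rewrite -phiE].
exists [set q | cdom i q /\ A (chart i q)], [set q | cdom i q /\ B (chart i q)].
split; [exact: oP|exact: oP|by []|by []|].
apply/seteqP; split=> // r [[_ Ar] [_ Br]].
by have : (A `&` B) (chart i r) by []; rewrite AB.
Qed.

Lemma prodm_mfd X Y : is_mfd X -> is_mfd Y -> is_mfd (prodm X Y).
Proof.
move=> mX mY.
have oL (A : set X) (B : set Y) : mopen A -> mopen B ->
    mopen ([set p | A p.1 /\ B p.2] : set (prodm X Y)).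
  move=> oA oB [i i'].
  have := openI (@open_lsubmx R (mdim X) (mdim Y) _ (oA i))
    (@open_rsubmx R (mdim X) (mdim Y) _ (oB i')); congr open.
  apply/seteqP; split=> [z [[p [Ap ip] pz] [q [Bq iq] qz]] |
      _ [[p q] [[/= Ap Bq] [/= ip iq]] <-] ].
    by exists (p, q) => //=; rewrite pz qz hsubmxK.
  by rewrite /= row_mxKl row_mxKr; split; [exists p|exists q].
apply: mfdI.
- move=> [i i'] [p p'] [q q'] /= [ip ip'] [iq iq'] /eq_row_mx[E E'].
  by rewrite (chart_inj mX ip iq E) (chart_inj mY ip' iq' E').
- have [_ [D [cD HD]] _ _] := mX; have [_ [D' [cD' HD']] _ _] := mY.
  exists (D `*` D'); split; first exact: countableX.
  move=> [p p']; have [i Di ip] := HD p; have [i' Di' ip'] := HD' p'.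
  by exists (i, i').
- move=> [i i'] [j j']; have [_ _ sX _] := mX; have [_ _ sY _] := mY.
  have [oD CD] := sX i j; have [oD' CD'] := sY i' j'.
  set D := (X in open X) in oD; set D' := (X in open X) in oD'.
  have oL' := @open_lsubmx R (mdim X) (mdim Y) _ oD.
  have oR' := @open_rsubmx R (mdim X) (mdim Y) _ oD'.
  have oU := openI oL' oR'.
  exists ([set z | D (lsubmx z)] `&` [set z | D' (rsubmx z)]).
  exists (fun z => row_mx (rep (id : X -> X) i j (lsubmx z))
    (rep (id : Y -> Y) i' j' (rsubmx z))); split=> //.
  + apply: Coo_row_mx => //.
      apply: (Coo_comp (U' := D) (g := rep (id : X -> X) i j)) => //.
        by move=> z [].
      exact: Coo_lsubmx.
    apply: (Coo_comp (U' := D') (g := rep (id : Y -> Y) i' j')) => //.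
      by move=> z [].
    exact: Coo_rsubmx.
  + move=> z [[p [[_ ip] jp] pz] [q [[_ iq] jq] qz]].
    by exists (p, q) => //=; rewrite pz qz hsubmxK.
  + move=> [p q] [/= ip iq]; rewrite /= row_mxKl row_mxKr; split.
      move=> [[p' [[_ ip'] jp'] pp] [q' [[_ iq'] jq'] qq]].
      by rewrite -(chart_inj mX ip' ip pp) -(chart_inj mY iq' iq qq).
    by move=> [jp jq]; split; [exists p|exists q].
  + by move=> [p q] [/= ip iq] [jp jq]; rewrite row_mxKl row_mxKr !repE.
- move=> [p p'] [q q'] pq.
  have oT := mopenT mX; have oT' := mopenT mY; right.
  have [pq1|pq1] := pselect (p = q).
    have pq2 : p' <> q' by move=> E; apply: pq; rewrite pq1 E.
    have [_ _ _ /(_ p' q' pq2)[ O [ O' [ oO oO' Op Oq E]]]] := mY.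
    exists [set z | setT z.1 /\ O z.2], [set z | setT z.1 /\ O' z.2].
    split; [exact: oL|exact: oL|by []|by []|].
    apply/seteqP; split=> // -[r r'] [[_ Or] [_ Or']].
    by have : (O `&` O') r' by []; rewrite E.
  have [_ _ _ /(_ p q pq1)[ O [ O' [ oO oO' Op Oq E]]]] := mX.
  exists [set z | O z.1 /\ setT z.2], [set z | O' z.1 /\ setT z.2].
  split; [exact: oL|exact: oL|by []|by []|].
  apply/seteqP; split=> // -[r r'] [[Or _] [Or' _]].
  by have : (O `&` O') r by []; rewrite E.
Qed.

Lemma smooth_at_fst X Y (p : prodm X Y) : is_mfd X -> is_mfd Y ->
  smooth_at (fst : prodm X Y -> X) p.
Proof.
move=> mX mY; have mP := prodm_mfd mX mY; have [[i j] ijp] := chart_cover p mP.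
apply: (@smooth_at_chartI R (prodm X Y) X fst p (i, j) i setT lsubmx mP mX ijp
  openT I).
  by move=> q [iq jq] _; rewrite row_mxKl.
exact: Coo_lsubmx openT.
Qed.

Lemma smooth_at_snd X Y (p : prodm X Y) : is_mfd X -> is_mfd Y ->
  smooth_at (snd : prodm X Y -> Y) p.
Proof.
move=> mX mY; have mP := prodm_mfd mX mY; have [[i j] ijp] := chart_cover p mP.
apply: (@smooth_at_chartI R (prodm X Y) Y snd p (i, j) j setT rsubmx mP mY ijp
  openT I).
  by move=> q [iq jq] _; rewrite row_mxKr.
exact: Coo_rsubmx openT.
Qed.

Lemma smooth_at_pair X Y Z (f : X -> Y) (g : X -> Z) p :
  is_mfd X -> is_mfd Y -> is_mfd Z -> smooth_at f p -> smooth_at g p ->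
  smooth_at ((fun x => (f x, g x)) : X -> prodm Y Z) p.
Proof.
move=> mX mY mZ sf sg; have mP := prodm_mfd mY mZ.
have [i ip] := chart_cover p mX; have [j jp] := chart_cover (f p) mY.
have [k kp] := chart_cover (g p) mZ.
have [U [oU Up HU CU]] := smooth_at_chart mX sf ip jp.
have [V [oV Vp HV CV]] := smooth_at_chart mX sg ip kp.
have oW := openI oU oV.
apply: (smooth_at_chartI (j := (j, k) : idx (prodm Y Z))
  (phi := fun x => row_mx (rep f i j x) (rep g i k x)) mX mP ip oW).
- by split.
- move=> q iq [/HU[q' [iq' qq' jq']] /HV[r [ir rq kr]]].
  rewrite (chart_inj mX iq' iq qq') in jq'.
  by rewrite (chart_inj mX ir iq rq) in kr; rewrite /= !repE.
- by apply: Coo_row_mx => //; [apply: Coo_sub CU|apply: Coo_sub CV] => x [].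
Qed.

Lemma smooth_at_eucl n m (f : 'rV[R]_n -> 'rV[R]_m) (U : set 'rV[R]_n) x :
  open U -> U x -> Coo U f -> smooth_at (f : eucl R n -> eucl R m) x.
Proof.
move=> oU Ux Cf.
exact: (smooth_at_chartI (X := eucl R n) (Y := eucl R m) (i := tt) (j := tt)
  (phi := f) (eucl_mfd _) (eucl_mfd _) I oU Ux).
Qed.

Lemma smooth_at_eucl2 n m k (f : 'rV[R]_n -> 'rV[R]_m -> 'rV[R]_k)
    (U : set 'rV[R]_(n + m)) x y :
  open U -> U (row_mx x y) -> Coo U (fun z => f (lsubmx z) (rsubmx z)) ->
  smooth_at ((fun z => f z.1 z.2) : prodm (eucl R n) (eucl R m) -> eucl R k)
    (x, y).
Proof.
move=> oU Ux Cf; have mP := prodm_mfd (eucl_mfd n) (eucl_mfd m).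
pose F (z : prodm (eucl R n) (eucl R m)) : eucl R k := f z.1 z.2.
pose p : prodm (eucl R n) (eucl R m) := (x, y).
pose c : idx (prodm (eucl R n) (eucl R m)) := (tt, tt).
have cp : cdom c p by [].
have H q : cdom c q -> U (chart c q) -> cdom (tt : idx (eucl R k)) (F q) /\
    chart (tt : idx (eucl R k)) (F q) =
    (fun z => f (lsubmx z) (rsubmx z)) (chart c q).
  by case: q => q1 q2 _ _ /=; rewrite row_mxKl row_mxKr.
exact: (smooth_at_chartI mP (eucl_mfd k) cp oU Ux H Cf).
Qed.

End Products.

(** * Tangent vectors as velocities *)

Section Tangents.
Context {R : realType}.
Implicit Types X Y Z W : mfd R.

(** Differentiability is asked at time 0 only, which is all that the curves of [curve_lifting]
    provide. *)
Definition velocity {X} (gamma : R -> X) (v : tanm X) : Prop :=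
  gamma 0 = foot v /\
  forall i, cdom i (foot v) -> (\forall t \near (0 : R), cdom i (gamma t)) /\
    is_diff (0 : R) (fun t : R => chart i (gamma t)) (fun h : R => h *: comps v i).

Lemma near0W (P : R -> Prop) : (forall t, P t) -> \forall t \near (0 : R), P t.
Proof. by move=> HP; near=> t; apply: HP. Unshelve. all: by end_near. Qed.

Lemma is_diff_uniq (V : normedModType R) (c : R -> V) (t : R) d d' :
  is_diff t c d -> is_diff t c d' -> d = d'.
Proof. by move=> [_ <-] [_ <-]. Qed.

Lemma is_diff_scaleE (V : normedModType R) (c : R -> V) (t : R) d :
  is_diff t c d -> is_diff t c (fun h => h *: d 1).
Proof.
move=> dc; apply: is_diff_eq; apply/funext => h.
by have [_ <-] := dc; rewrite -linearZ /= [h *: _]mulr1.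
Qed.

Lemma tvec_ext {X} (v w : tvec X) : foot v = foot w -> comps v = comps w ->
  v = w.
Proof.
case: v w => [[p a] pa] [[q b] qb]; rewrite /foot /comps /= => E1 E2.
by move: pa qb; rewrite E1 E2 => pa qb; congr exist; apply: Prop_irrelevance.
Qed.

Lemma tvec_eq {X} i (v w : tvec X) : cdom i (foot v) ->
  foot v = foot w -> comps v i = comps w i -> v = w.
Proof.
move=> iv E1 E2; apply: tvec_ext => //; apply/funext => j.
case: (svalP v) (svalP w); rewrite -/(foot v) -/(foot w) -/(comps v) -/(comps w).
move=> V1 V2 [W1 W2]; have [jv|jv] := pselect (cdom j (foot v)).
  by rewrite (V2 i j)// (W2 i j) -?E1 ?E2.
by rewrite V1// W1// -E1.
Qed.

Lemma curve_chart_map {X Y} (f : X -> Y) i j (gamma : R -> X) d :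
  is_mfd X -> smooth_at f (gamma 0) -> cdom i (gamma 0) ->
  cdom j (f (gamma 0)) -> (\forall t \near (0 : R), cdom i (gamma t)) ->
  is_diff (0 : R) (fun t : R => chart i (gamma t)) d ->
  (\forall t \near (0 : R), cdom j (f (gamma t))) /\
  is_diff (0 : R) (fun t : R => chart j (f (gamma t)))
    (fun h => 'd (rep f i j) (chart i (gamma 0)) (d h)).
Proof.
move=> mX sf i0 j0 ni Di.
have [U [oU Up HU CU]] := smooth_at_chart mX sf i0 j0.
have nU : \forall t \near (0 : R), U (chart i (gamma t)).
  have [dD _] := Di; apply: (differentiable_continuous dD).
  exact: open_nbhs_nbhs.
split.
  apply: filterS2 ni nU => t it /HU[q [iq E jq]].
  by rewrite -(chart_inj mX iq it E).
have D2 := is_diff_comp Di (Coo_is_diff CU Up).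
have E : \forall t \near (0 : R),
    (rep f i j \o (fun t => chart i (gamma t))) t = chart j (f (gamma t)).
  by apply: filterS ni => t it; rewrite /= repE.
exact: is_diff_germ E D2.
Qed.

(** One chart suffices: [curve_chart_map] transports differentiability to all others, and the
    transformation law of the components is the chain rule for the transition maps combined with
    uniqueness of derivatives. *)
Lemma velocity_ex {X} i (gamma : R -> X) d : is_mfd X -> cdom i (gamma 0) ->
  (\forall t \near (0 : R), cdom i (gamma t)) ->
  is_diff (0 : R) (fun t : R => chart i (gamma t)) d ->
  exists2 v, velocity gamma v & comps v i = d 1.
Proof.
move=> mX i0 ni Di.
have [a [aE an]] : exists a : idx X -> 'rV[R]_(mdim X),
    (forall j, cdom j (gamma 0) ->
      a j = 'd (fun t : R => chart j (gamma t)) (0 : R) (1 : R)) /\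
    (forall j, ~ cdom j (gamma 0) -> a j = 0).
  exists (fun j => if pselect (cdom j (gamma 0)) then
    'd (fun t : R => chart j (gamma t)) (0 : R) (1 : R) else 0).
  by split=> j; case: pselect.
have T j : cdom j (gamma 0) -> (\forall t \near (0 : R), cdom j (gamma t)) /\
    is_diff (0 : R) (fun t : R => chart j (gamma t)) (fun h => h *: a j).
  move=> j0.
  have [H1 H2] := curve_chart_map mX (smooth_at_id (gamma 0) mX) i0 j0 ni Di.
  split=> //; rewrite aE//.
  by have [H3 ->] := H2; exact: is_diff_scaleE H2.
have ta : @is_tan R X (gamma 0) a.
  split=> [j jn|j k j0 k0]; first exact: an.
  have [nj Dj] := T j j0.
  have [_] := curve_chart_map mX (smooth_at_id (gamma 0) mX) j0 k0 nj Dj.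
  move=> H; have := is_diff_uniq H (T k k0).2 => /(congr1 (@^~ 1)) /=.
  by rewrite !scale1r => E; exact: esym E.
exists (exist _ (gamma 0, a) ta); first by split.
rewrite /comps /=; have := is_diff_uniq (T i i0).2 Di => /(congr1 (@^~ 1)) /=.
by rewrite scale1r.
Qed.

Lemma velocity_uniq {X} (gamma : R -> X) v w : is_mfd X ->
  velocity gamma v -> velocity gamma w -> v = w.
Proof.
move=> mX [v0 Hv] [w0 Hw]; have [i iv] := chart_cover (foot v) mX.
have vw : foot v = foot w by rewrite -v0.
apply: (tvec_eq iv vw); have [_ D1] := Hv i iv.
have [|_ D2] := Hw i; first by rewrite -vw.
by have := is_diff_uniq D1 D2 => /(congr1 (@^~ 1)) /=; rewrite !scale1r.
Qed.

Lemma is_diff_line n (x y : 'rV[R]_n) (t : R) :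
  is_diff t (fun t : R => x + t *: y) (fun h => h *: y).
Proof.
apply: is_diff_eq (is_diffD (is_diff_cst x t) (is_diff_scalel t y)) _.
by apply/funext => h; exact: add0r.
Qed.

Lemma curve_of_chart {X} i (p : X) (c : R -> 'rV[R]_(mdim X)) d : is_mfd X ->
  cdom i p -> c 0 = chart i p -> is_diff (0 : R) c d ->
  exists gamma : R -> X, [/\ gamma 0 = p,
    \forall t \near (0 : R), cdom i (gamma t) /\ chart i (gamma t) = c t &
    is_diff (0 : R) (fun t : R => chart i (gamma t)) d].
Proof.
move=> mX ip c0 Dc.
have /choice[gamma Hg] : forall t : R, exists q : X,
    (exists2 q, cdom i q & chart i q = c t) -> cdom i q /\ chart i q = c t.
  move=> t; have [[q ? ?]|n] := pselect (exists2 q, cdom i q & chart i q = c t).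
    by exists q.
  by exists p => /n.
have nc : \forall t \near (0 : R), cdom i (gamma t) /\ chart i (gamma t) = c t.
  have [dc _] := Dc; have := differentiable_continuous dc.
  have oU := open_chart_image (i := i) mX.
  move=> /(_ (chart i @` cdom i)) H.
  have : nbhs (c 0) (chart i @` cdom i).
    by apply: open_nbhs_nbhs; split=> //; exists p.
  move=> /H N0; have {}N0 : \forall t \near (0 : R), (chart i @` cdom i) (c t).
    exact: N0.
  by apply: filterS N0 => t [q iq E]; apply: Hg; exists q.
exists gamma; split=> //.
  have [i0 E0] := nbhs_singleton nc.
  by apply: (chart_inj mX i0 ip); rewrite E0.
have E : \forall t \near (0 : R), c t = chart i (gamma t).
  by apply: filterS nc => t [].
exact: is_diff_germ E Dc.
Qed.

Lemma tangent_ex {X} i (p : X) y : is_mfd X -> cdom i p ->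
  exists2 v : tanm X, foot v = p & comps v i = y.
Proof.
move=> mX ip; have c0 : chart i p + (0 : R) *: y = chart i p.
  by rewrite scale0r addr0.
have [g [g0 ng Dg]] := curve_of_chart mX ip c0 (is_diff_line (chart i p) y 0).
have i0 : cdom i (g 0) by rewrite g0.
have ng' : \forall t \near (0 : R), cdom i (g t) by apply: filterS ng => t [].
have [v [v0 _] vy] := velocity_ex mX i0 ng' Dg.
by exists v; rewrite -?v0// vy scale1r.
Qed.

Lemma velocity_curve {X} (v : tanm X) : is_mfd X ->
  exists gamma, velocity gamma v.
Proof.
move=> mX; have [i ip] := chart_cover (foot v) mX.
set p := foot v in ip; set y := comps v i.
have c0 : chart i p + (0 : R) *: y = chart i p by rewrite scale0r addr0.
have [g [g0 ng Dg]] := curve_of_chart mX ip c0 (is_diff_line (chart i p) y 0).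
have i0 : cdom i (g 0) by rewrite g0.
have ng' : \forall t \near (0 : R), cdom i (g t) by apply: filterS ng => t [].
have [w vw wy] := velocity_ex mX i0 ng' Dg.
exists g; rewrite (_ : v = w)//; apply: (tvec_eq ip).
  by rewrite -(vw.1) g0.
by rewrite wy scale1r.
Qed.

Lemma velocity_near {X} (gamma : R -> X) v P : is_mfd X ->
  velocity gamma v -> mnbhs (foot v) P -> \forall t \near (0 : R), P (gamma t).
Proof.
move=> mX [g0 Hg] nP; have [i ip] := chart_cover (foot v) mX.
have [ni Di] := Hg i ip; have [U [oU Up HU]] := mnbhs_chart mX nP ip.
have nU : \forall t \near (0 : R), U (chart i (gamma t)).
  have [dD _] := Di; apply: (differentiable_continuous dD).
  by apply: open_nbhs_nbhs; rewrite g0.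
apply: filterS2 ni nU => t it /HU[q [iq E Pq]].
by rewrite -(chart_inj mX iq it E).
Qed.

Lemma velocity_germ {X} (gamma delta : R -> X) v :
  (\forall t \near (0 : R), gamma t = delta t) -> velocity gamma v ->
  velocity delta v.
Proof.
move=> E [g0 Hg]; split; first by rewrite -(nbhs_singleton E).
move=> i ip; have [ni Di] := Hg i ip; split.
  by apply: filterS2 ni E => t it <-.
have E' : \forall t \near (0 : R), chart i (gamma t) = chart i (delta t).
  by apply: filterS E => t ->.
exact: is_diff_germ E' Di.
Qed.

Lemma the_or {A : Type} (d : A) (P : set A) : P (the d P) \/ the d P = d.
Proof.
have [H|H] := pselect (exists x, P x); first by left; apply: theP.
by right; apply: (@xgetPN {classic A}) => x Px; apply: H; exists x.
Qed.

Lemma foot_tmap {X Y} (f : X -> Y) v : foot (tmap f v) = f (foot v).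
Proof.
rewrite /tmap; set P := [set w | _].
by have [[]|->] := the_or (tzero (f (foot v)) : tanm Y) P.
Qed.

(** The chosen vector [tmap f v] is shown to meet its specification: the velocity of the image curve
    meets it in all charts by the chain rule, and one chart determines a tangent vector. Later
    properties of [tmap] rest on this description by curves. *)
Lemma velocity_tmap {X Y} (f : X -> Y) gamma v : is_mfd X -> is_mfd Y ->
  smooth_at f (foot v) -> velocity gamma v ->
  velocity (fun t => f (gamma t)) (tmap f v).
Proof.
move=> mX mY sf [g0 Hg].
have [i ip] := chart_cover (foot v) mX.
have [j jp] := chart_cover (f (foot v)) mY.
have [ni Di] := Hg i ip.
rewrite -g0 in sf ip jp.
have [H1 H2] := curve_chart_map mX sf ip jp ni Di.
have [w vw _] := velocity_ex (gamma := fun t => f (gamma t)) mY jp H1 H2.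
suff -> : tmap f v = w by [].
apply: the_uniq.
  split; first by rewrite -vw.1 g0.
  move=> i' j' ip' jp'; have [ni' Di'] := Hg i' ip'.
  rewrite -g0 in ip' jp' *.
  have [_ H3] := curve_chart_map mX sf ip' jp' ni' Di'.
  have [|_ H4] := vw.2 j'; first by rewrite -vw.1.
  have := is_diff_uniq H4 H3 => /(congr1 (@^~ 1)) /=.
  by rewrite !scale1r.
move=> u [u0 Hu]; have jp' : cdom j (foot u) by rewrite u0 -g0.
apply: (tvec_eq jp'); first by rewrite u0 -vw.1 g0.
have [|_ H4] := vw.2 j; first by rewrite -vw.1.
rewrite (Hu i j) -?g0//.
by have := is_diff_uniq H4 H2 => /(congr1 (@^~ 1)) /=; rewrite !scale1r.
Qed.

Lemma tmap_comps {X Y} (f : X -> Y) v i j : is_mfd X -> is_mfd Y ->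
  smooth_at f (foot v) -> cdom i (foot v) -> cdom j (f (foot v)) ->
  comps (tmap f v) j = 'd (rep f i j) (chart i (foot v)) (comps v i).
Proof.
move=> mX mY sf ip jp; have [g vg] := velocity_curve v mX.
have vf := velocity_tmap mX mY sf vg.
have [g0 Hg] := vg; have [ni Di] := Hg i ip.
rewrite -g0 in sf ip jp *.
have [_ H2] := curve_chart_map mX sf ip jp ni Di.
have [|_ H3] := vf.2 j; first by rewrite foot_tmap -g0.
by have := is_diff_uniq H3 H2 => /(congr1 (@^~ 1)) /=; rewrite !scale1r.
Qed.

Lemma tmap_comp {X Y Z} (f : X -> Y) (g : Y -> Z) (v : tanm X) :
  is_mfd X -> is_mfd Y -> is_mfd Z ->
  smooth_at f (foot v) -> smooth_at g (f (foot v)) ->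
  tmap (fun x => g (f x)) v = tmap g (tmap f v).
Proof.
move=> mX mY mZ sf sg; have [c vc] := velocity_curve v mX.
apply: (velocity_uniq (gamma := fun t => g (f (c t)))) => //.
  by apply: velocity_tmap => //; apply: smooth_at_comp.
apply: (velocity_tmap mY mZ); first by rewrite foot_tmap.
exact: velocity_tmap.
Qed.

Lemma tmap_germ {X Y} (f g : X -> Y) (v : tanm X) : is_mfd X -> is_mfd Y ->
  mnbhs (foot v) (fun q => f q = g q) -> smooth_at f (foot v) ->
  tmap f v = tmap g v.
Proof.
move=> mX mY E sf; have [c vc] := velocity_curve v mX.
apply: (velocity_uniq (gamma := fun t => f (c t))) => //.
  exact: velocity_tmap.
apply: (velocity_germ (gamma := fun t => g (c t))).
  by have := velocity_near mX vc E; apply: filterS => t ->.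
by apply: velocity_tmap => //; apply: smooth_at_germ E sf.
Qed.

Lemma tmap_id {X} (v : tanm X) : is_mfd X -> tmap (fun x : X => x) v = v.
Proof.
move=> mX; have [c vc] := velocity_curve v mX.
apply: (velocity_uniq (gamma := c)) => //.
by apply: (velocity_tmap (f := fun x => x)) => //; apply: smooth_at_id.
Qed.

(** The transition maps are [(x, v) |-> (tau x, d tau_x v)], smooth by [Coo_tangent]. Vectors with
    the same foot share a chart, so only vectors with distinct feet have to be separated, which is
    done on the base. *)
Lemma tanm_mfd X : is_mfd X -> is_mfd (tanm X).
Proof.
move=> mX.
have oF (O : set X) : mopen O -> mopen ([set v | O (foot v)] : set (tanm X)).
  move=> oO i; have := @open_lsubmx R (mdim X) (mdim X) _ (oO i); congr open.
  apply/seteqP; split=> [z [p [ Op ip] pz] |_ [v [ Ov iv] <-] ].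
    have [v vp vz] := tangent_ex (rsubmx z) mX ip.
    by exists v; rewrite /= vp// vz pz hsubmxK.
  by rewrite /= row_mxKl; exists (foot v).
apply: mfdI.
- move=> i v w iv iw /eq_row_mx[E1 E2].
  exact: (tvec_eq iv (chart_inj mX iv iw E1) E2).
- have [_ [D [cD HD]] _ _] := mX; exists D; split=> // v.
  by have [i Di iv] := HD (foot v); exists i.
- move=> i j; have [_ _ sX _] := mX; have [oD CD] := sX i j.
  set D := (X in open X) in oD; have oU := @open_lsubmx R (mdim X) (mdim X) _ oD.
  exists [set z | D (lsubmx z)], (fun z => row_mx (rep (id : X -> X) i j (lsubmx z))
    ('d (rep (id : X -> X) i j) (lsubmx z) (rsubmx z))); split=> //.
  + apply: Coo_row_mx => //; last exact: Coo_tangent.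
    apply: (Coo_comp (U' := D) (g := rep (id : X -> X) i j)) => //.
    exact: Coo_lsubmx.
  + move=> z [p [[_ ip] jp] pz]; have [v vp vz] := tangent_ex (rsubmx z) mX ip.
    by exists v; rewrite /= vp// vz pz hsubmxK.
  + move=> v /= iv; rewrite row_mxKl; split=> [[q [[_ iq] jq] E]|jv].
      by rewrite -(chart_inj mX iq iv E).
    by exists (foot v).
  + move=> v /= iv jv; rewrite row_mxKl row_mxKr repE//; congr row_mx.
    by have [_ V2] := svalP v; exact: V2.
- move=> v w vw; have [E|E] := pselect (foot v = foot w).
    have [i iv] := chart_cover (foot v) mX; left; exists i => //=.
    by rewrite -E.
  have [_ _ _ /(_ _ _ E)[ O [ O' [ oO oO' Op Oq OO]]]] := mX.
  right; exists [set v | O (foot v)], [set v | O' (foot v)].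
  split; [exact: oF|exact: oF|by []|by []|].
  apply/seteqP; split=> // u [Or Or'].
  by have : (O `&` O') (foot u) by []; rewrite OO.
Qed.

Lemma smooth_at_foot X (v : tanm X) : is_mfd X ->
  smooth_at (@foot R X : tanm X -> X) v.
Proof.
move=> mX; have mT := tanm_mfd mX; have [i iv] := chart_cover v mT.
apply: (@smooth_at_chartI R (tanm X) X _ v i i setT lsubmx mT mX iv openT I).
  by move=> q /= iq _; rewrite row_mxKl.
exact: Coo_lsubmx openT.
Qed.

Lemma smooth_at_tmap X Y (f : X -> Y) (v : tanm X) : is_mfd X -> is_mfd Y ->
  smooth_at f (foot v) -> smooth_at (tmap f) v.
Proof.
move=> mX mY sf; have mTX := tanm_mfd mX; have mTY := tanm_mfd mY.
have [i ip] := chart_cover (foot v) mX.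
have [j jp] := chart_cover (f (foot v)) mY.
have [U [oU Up HU CU]] := smooth_at_chart mX sf ip jp.
have [V [oV Vp HV]] := mnbhs_chart mX (smooth_at_nbhs mY sf) ip.
have oW := @open_lsubmx R (mdim X) (mdim X) _ (openI oU oV).
apply: (@smooth_at_chartI R (tanm X) (tanm Y) _ v i j
  [set z | (U `&` V) (lsubmx z)] (fun z => row_mx (rep f i j (lsubmx z))
    ('d (rep f i j) (lsubmx z) (rsubmx z))) mTX mTY ip oW).
- by rewrite /= row_mxKl.
- move=> w /= iw; rewrite row_mxKl row_mxKr => -[/HU[q [iq E jq]] /HV[r [ir E' sr]]].
  rewrite (chart_inj mX iq iw E) in jq; rewrite (chart_inj mX ir iw E') in sr.
  split; first by rewrite foot_tmap.
  by rewrite foot_tmap repE// (tmap_comps (i := i)).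
- apply: Coo_row_mx => //.
    apply: (Coo_comp (U' := U) (g := rep f i j)) => //; first by move=> z [].
    exact: Coo_lsubmx.
  by apply: Coo_sub (Coo_tangent oU CU) => z [].
Qed.

Lemma tmap_tzero X Y (f : X -> Y) p : is_mfd X -> is_mfd Y ->
  smooth_at f p -> tmap f (tzero p : tanm X) = tzero (f p).
Proof.
move=> mX mY sf; have [i ip] := chart_cover p mX.
have [j jp] := chart_cover (f p) mY.
have jp' : cdom j (foot (tmap f (tzero p : tanm X))) by rewrite foot_tmap.
apply: (tvec_eq jp'); first by rewrite foot_tmap.
by rewrite (tmap_comps (i := i))// linear0.
Qed.

Lemma tadd_spec X (v w : tvec X) : foot v = foot w ->
  foot (tadd v w) = foot v /\
  forall i, comps (tadd v w) i = comps v i + comps w i.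
Proof.
move=> E; apply: (@theP _ v [set u | foot u = foot v /\ forall i, _]).
have ta : @is_tan R X (foot v) (fun i => comps v i + comps w i).
  have [V1 V2] := svalP v; have := svalP w.
  rewrite -/(foot w) -E => -[W1 W2]; split=> [i ni|i j iv jv].
    by rewrite [comps v i]V1// [comps w i]W1// addr0.
  by rewrite [comps v j](V2 i j)// [comps w j](W2 i j)// linearD.
by exists (exist _ (foot v, fun i => comps v i + comps w i) ta).
Qed.

Lemma tscale_spec X a (v : tvec X) :
  foot (tscale a v) = foot v /\
  forall i, comps (tscale a v) i = a *: comps v i.
Proof.
apply: (@theP _ v [set u | foot u = foot v /\ forall i, _]).
have ta : @is_tan R X (foot v) (fun i => a *: comps v i).
  have [V1 V2] := svalP v; split=> [i ni|i j iv jv].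
    by rewrite [comps v i]V1// scaler0.
  by rewrite [comps v j](V2 i j)// linearZ.
by exists (exist _ (foot v, fun i => a *: comps v i) ta).
Qed.

Lemma tmap_add X Y (f : X -> Y) (v w : tanm X) : is_mfd X -> is_mfd Y ->
  smooth_at f (foot v) -> foot v = foot w ->
  tmap f (tadd v w) = tadd (tmap f v) (tmap f w).
Proof.
move=> mX mY sf E; have [F A] := tadd_spec E.
have [|F' A'] := @tadd_spec _ (tmap f v) (tmap f w); first by rewrite !foot_tmap E.
have [i ip] := chart_cover (foot v) mX.
have [j jp] := chart_cover (f (foot v)) mY.
have jp' : cdom j (foot (tmap f (tadd v w))) by rewrite foot_tmap F.
apply: (tvec_eq jp'); first by rewrite foot_tmap F F' foot_tmap.
rewrite A' !(tmap_comps (i := i))// -?E ?F//.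
by rewrite A linearD.
Qed.

Lemma tmap_scale X Y (f : X -> Y) a (v : tanm X) : is_mfd X -> is_mfd Y ->
  smooth_at f (foot v) -> tmap f (tscale a v) = tscale a (tmap f v).
Proof.
move=> mX mY sf; have [F A] := tscale_spec a v.
have [F' A'] := tscale_spec a (tmap f v).
have [i ip] := chart_cover (foot v) mX.
have [j jp] := chart_cover (f (foot v)) mY.
have jp' : cdom j (foot (tmap f (tscale a v))) by rewrite foot_tmap F.
apply: (tvec_eq jp'); first by rewrite foot_tmap F F' foot_tmap.
rewrite A' !(tmap_comps (i := i))// ?F//.
by rewrite A linearZ.
Qed.

(** The two conclusions are proved together because both follow from identifying the chosen vector
    [tpair v w] with the velocity of the pair of curves, whose components can be read in product
    charts. *)
Lemma velocity_pair_comps X Y (g : R -> X) (h : R -> Y) v w :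
  is_mfd X -> is_mfd Y -> velocity g v -> velocity h w ->
  velocity ((fun t => (g t, h t)) : R -> prodm X Y) (tpair v w) /\
  forall i j, cdom i (foot v) -> cdom j (foot w) ->
    comps (tpair v w) (i, j) = row_mx (comps v i) (comps w j).
Proof.
move=> mX mY vg vh; have mP := prodm_mfd mX mY.
have key (g' : R -> X) (h' : R -> Y) : velocity g' v -> velocity h' w ->
    exists2 u : tanm (prodm X Y), velocity ((fun t => (g' t, h' t)) : R -> prodm X Y) u &
      forall i j, cdom i (foot v) -> cdom j (foot w) ->
        comps u (i, j) = row_mx (comps v i) (comps w j).
  move=> [g0 Hg] [h0 Hh].
  have D i j : cdom i (foot v) -> cdom j (foot w) ->
      is_diff (0 : R) (fun t : R => row_mx (chart i (g' t)) (chart j (h' t)))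
        (fun t => t *: row_mx (comps v i) (comps w j)).
    move=> iv jw; have [_ D1] := Hg i iv; have [_ D2] := Hh j jw.
    apply/is_diff_rV => k; rewrite -(splitK k).
    case: (fintype.split k) => l /=.
      have -> : (fun t : R => row_mx (chart i (g' t)) (chart j (h' t)) 0
          (lshift (mdim Y) l)) = (fun t => chart i (g' t) 0 l).
        by apply/funext => t; rewrite row_mxEl.
      have := (is_diff_rV _ _ _).2 D1 l => H; apply: is_diff_eq.
      by apply/funext => t; rewrite mxE [RHS]mxE row_mxEl.
    have -> : (fun t : R => row_mx (chart i (g' t)) (chart j (h' t)) 0
        (rshift (mdim X) l)) = (fun t => chart j (h' t) 0 l).
      by apply/funext => t; rewrite row_mxEr.
    have := (is_diff_rV _ _ _).2 D2 l => H; apply: is_diff_eq.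
    by apply/funext => t; rewrite mxE [RHS]mxE row_mxEr.
  have [i iv] := chart_cover (foot v) mX; have [j jw] := chart_cover (foot w) mY.
  have ij0 : cdom ((i, j) : idx (prodm X Y)) (g' 0, h' 0) by rewrite /= g0 h0.
  have nij : \forall t \near (0 : R), cdom ((i, j) : idx (prodm X Y)) (g' t, h' t).
    by have [n1 _] := Hg i iv; have [n2 _] := Hh j jw; apply: filterS2 n1 n2.
  have [u vu uE] := velocity_ex (gamma := (fun t => (g' t, h' t)) : R -> prodm X Y)
    mP ij0 nij (D i j iv jw).
  exists u => // i' j' iv' jw'.
  have [u0 Hu] := vu; have [|_ Du] := Hu (i', j').
    by rewrite -u0 /= g0 h0.
  have := is_diff_uniq Du (D i' j' iv' jw') => /(congr1 (@^~ 1)) /=.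
  by rewrite !scale1r.
have [u vu uE] := key _ _ vg vh.
suff -> : tpair v w = u by [].
have [g0 Hg] := vg; have [h0 Hh] := vh.
have u0 : foot u = (foot v, foot w) by rewrite -vu.1 g0 h0.
apply: the_uniq.
  split.
    apply: (velocity_uniq (gamma := g)) => //.
    exact: (velocity_tmap mP mX (smooth_at_fst _ mX mY) vu).
  apply: (velocity_uniq (gamma := h)) => //.
  exact: (velocity_tmap mP mY (smooth_at_snd _ mX mY) vu).
(* Any competitor is the velocity of a curve whose projections have velocities [v] and [w], so [key]
   gives it the same components. *)
move=> u' [E1 E2]; have [c vc] := velocity_curve u' mP.
have := velocity_tmap mP mX (smooth_at_fst _ mX mY) vc; rewrite E1 => vc1.
have := velocity_tmap mP mY (smooth_at_snd _ mX mY) vc; rewrite E2 => vc2.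
have [u2 vu2 u2E] := key _ _ vc1 vc2.
have <- : u2 = u'.
  apply: (velocity_uniq mP vu2).
  by apply: velocity_germ vc; apply: near0W => t; case: (c t).
have [i iv] := chart_cover (foot v) mX; have [j jw] := chart_cover (foot w) mY.
have u20 : foot u2 = (foot v, foot w) by rewrite -vu2.1 vc1.1 vc2.1.
have iju : cdom ((i, j) : idx (prodm X Y)) (foot u2) by rewrite u20.
by apply: (tvec_eq iju); rewrite ?u20 ?u0// u2E// uE.
Qed.

Lemma velocity_pair X Y (g : R -> X) (h : R -> Y) v w : is_mfd X -> is_mfd Y ->
  velocity g v -> velocity h w ->
  velocity ((fun t => (g t, h t)) : R -> prodm X Y) (tpair v w).
Proof. by move=> mX mY vg vh; have [] := velocity_pair_comps mX mY vg vh. Qed.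

Lemma tpair_fst X Y (v : tanm X) (w : tanm Y) : is_mfd X -> is_mfd Y ->
  tmap (fst : prodm X Y -> X) (tpair v w) = v.
Proof.
move=> mX mY; have mP := prodm_mfd mX mY.
have [c vc] := velocity_curve v mX; have [d vd] := velocity_curve w mY.
have vp := velocity_pair mX mY vc vd.
apply: (velocity_uniq (gamma := c)) => //.
exact: (velocity_tmap mP mX (smooth_at_fst _ mX mY) vp).
Qed.

Lemma tpair_snd X Y (v : tanm X) (w : tanm Y) : is_mfd X -> is_mfd Y ->
  tmap (snd : prodm X Y -> Y) (tpair v w) = w.
Proof.
move=> mX mY; have mP := prodm_mfd mX mY.
have [c vc] := velocity_curve v mX; have [d vd] := velocity_curve w mY.
have vp := velocity_pair mX mY vc vd.
apply: (velocity_uniq (gamma := d)) => //.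
exact: (velocity_tmap mP mY (smooth_at_snd _ mX mY) vp).
Qed.

Lemma foot_tpair X Y (v : tanm X) (w : tanm Y) : is_mfd X -> is_mfd Y ->
  foot (tpair v w) = (foot v, foot w).
Proof.
move=> mX mY; move: (congr1 (@foot _ _) (tpair_fst v w mX mY)).
move: (congr1 (@foot _ _) (tpair_snd v w mX mY)); rewrite !foot_tmap.
by case: (foot (tpair v w)) => a b /= -> ->.
Qed.

Lemma tpair_eta X Y (u : tanm (prodm X Y)) : is_mfd X -> is_mfd Y ->
  tpair (tmap (fst : prodm X Y -> X) u) (tmap (snd : prodm X Y -> Y) u) = u.
Proof.
move=> mX mY; have mP := prodm_mfd mX mY; have [c vc] := velocity_curve u mP.
apply: (velocity_uniq (gamma := c)) => //.
have E : \forall t \near (0 : R), ((c t).1, (c t).2) = c t.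
  by apply: near0W => t; case: (c t).
have vp := velocity_pair mX mY (velocity_tmap mP mX (smooth_at_fst _ mX mY) vc)
  (velocity_tmap mP mY (smooth_at_snd _ mX mY) vc).
exact: (@velocity_germ (prodm X Y) (fun t => ((c t).1, (c t).2)) c _ E vp).
Qed.

Lemma tpair_comps X Y (v : tanm X) (w : tanm Y) i j : is_mfd X -> is_mfd Y ->
  cdom i (foot v) -> cdom j (foot w) ->
  comps (tpair v w) (i, j) = row_mx (comps v i) (comps w j).
Proof.
move=> mX mY iv jw; have [c vc] := velocity_curve v mX.
have [d vd] := velocity_curve w mY.
by have [_ ->] := velocity_pair_comps mX mY vc vd.
Qed.

(** The coordinate change between [TX x TY] and [T(X x Y)]: the two middle blocks, the fibre
    coordinates of the first factor and the base coordinates of the second, are exchanged. *)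
Lemma Coo_interchange n m k l :
  Coo [set: 'rV[R]_((n + m) + (k + l))] (fun x =>
    row_mx (row_mx (lsubmx (lsubmx x)) (lsubmx (rsubmx x)))
      (row_mx (rsubmx (lsubmx x)) (rsubmx (rsubmx x)))).
Proof.
have C a b c (f : 'rV[R]_a -> 'rV[R]_b) (g : 'rV[R]_b -> 'rV[R]_c) :
    Coo setT f -> Coo setT g -> Coo setT (fun x => g (f x)).
  by move=> Cf Cg; apply: (Coo_comp (U' := setT)) => //; exact: openT.
have CL a b : Coo setT (fun x : 'rV[R]_(a + b) => lsubmx x).
  exact: Coo_lsubmx openT.
have CR a b : Coo setT (fun x : 'rV[R]_(a + b) => rsubmx x).
  exact: Coo_rsubmx openT.
apply: Coo_row_mx; [exact: openT|apply: Coo_row_mx; [exact: openT| |]..].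
- exact: (C _ _ _ _ _ (CL _ _) (CL _ _)).
- exact: (C _ _ _ _ _ (CR _ _) (CL _ _)).
- exact: (C _ _ _ _ _ (CL _ _) (CR _ _)).
- exact: (C _ _ _ _ _ (CR _ _) (CR _ _)).
Qed.

Lemma smooth_at_tpair X Y (z : prodm (tanm X) (tanm Y)) :
  is_mfd X -> is_mfd Y ->
  smooth_at ((fun z => tpair z.1 z.2) :
    prodm (tanm X) (tanm Y) -> tanm (prodm X Y)) z.
Proof.
move=> mX mY; have mTX := tanm_mfd mX; have mTY := tanm_mfd mY.
have mP := prodm_mfd mTX mTY; have mT := tanm_mfd (prodm_mfd mX mY).
have [[i j] ijz] := chart_cover z mP.
pose phi (x : 'rV[R]_((mdim X + mdim X) + (mdim Y + mdim Y))) :=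
  row_mx (row_mx (lsubmx (lsubmx x)) (lsubmx (rsubmx x)))
    (row_mx (rsubmx (lsubmx x)) (rsubmx (rsubmx x))).
apply: (@smooth_at_chartI R (prodm (tanm X) (tanm Y)) (tanm (prodm X Y)) _ z
  (i, j) (i, j) setT phi mP mT ijz openT I).
- move=> [v w] [/= iv jw] _; rewrite foot_tpair//; split=> //.
  by rewrite tpair_comps// /phi /= !(row_mxKl, row_mxKr).
- exact: (Coo_interchange (mdim X) (mdim X) (mdim Y) (mdim Y)).
Qed.

End Tangents.

(** * Curves inside fibre products, and tangent maps of maps defined on subsets *)

Section Lifting.
Context {R : realType}.
Implicit Types X Y Z W : mfd R.

Lemma velocity_of_chart {X} i (v : tanm X) (c : R -> 'rV[R]_(mdim X)) :
  is_mfd X -> cdom i (foot v) -> c 0 = chart i (foot v) ->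
  is_diff (0 : R) c (fun h => h *: comps v i) ->
  exists2 gamma : R -> X, velocity gamma v &
    \forall t \near (0 : R), cdom i (gamma t) /\ chart i (gamma t) = c t.
Proof.
move=> mX ip c0 Dc; have [g [g0 ng Dg]] := curve_of_chart mX ip c0 Dc.
have i0 : cdom i (g 0) by rewrite g0.
have ng' : \forall t \near (0 : R), cdom i (g t) by apply: filterS ng => t [].
have [w vw wy] := velocity_ex mX i0 ng' Dg.
exists g => //; rewrite (_ : v = w)//; apply: (tvec_eq ip).
  by rewrite -(vw.1) g0.
by rewrite wy scale1r.
Qed.

Lemma velocity_lift {X Y} (f : X -> Y) (v : tanm X) (c : R -> Y) :
  is_mfd X -> is_mfd Y -> smooth_at f (foot v) ->
  (forall w : tanm Y, foot w = f (foot v) ->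
     exists2 v' : tanm X, foot v' = foot v & tmap f v' = w) ->
  velocity c (tmap f v) ->
  exists2 gamma : R -> X, velocity gamma v &
    \forall t \near (0 : R), f (gamma t) = c t.
Proof.
move=> mX mY sf surj vc.
have [i ip] := chart_cover (foot v) mX.
have [j jp] := chart_cover (f (foot v)) mY.
have [U [oU Up HU CU]] := smooth_at_chart mX sf ip jp.
have [c0 Hc] := vc; rewrite foot_tmap in c0 Hc; have [nc Dc] := Hc j jp.
have Sj w : exists v', 'd (rep f i j) (chart i (foot v)) v' = w.
  have [w' w'p <-] := tangent_ex w mY jp.
  have [v' v'p <-] := surj w' w'p; exists (comps v' i).
  have E := @tmap_comps R X Y f v' i j mX mY; rewrite v'p in E.
  exact: esym (E sf ip jp).
have E0 : chart j (c 0) = rep f i j (chart i (foot v)) by rewrite c0 repE.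
have E1 : 1 *: comps (tmap f v) j = 'd (rep f i j) (chart i (foot v)) (comps v i).
  by rewrite scale1r (tmap_comps (i := i)).
have C1 w : {for chart i (foot v), continuous (fun x => 'd (rep f i j) x w)}.
  exact: Coo_continuous (Coo_d w CU) Up.
have [g [g0 Dg Eg]] := curve_lifting oU Up
  (fun x => Coo_is_diff (x := x) CU) C1 Sj Dc E0 E1.
have [gamma vg ng] := velocity_of_chart mX ip g0 Dg.
exists gamma => //.
have nU : \forall t \near (0 : R), mnbhs (foot v) (fun q => cdom j (f q)).
  apply: near0W => _; apply: (mnbhs_preim mX mY sf).
  by apply: mnbhs_open => //; apply: mopen_cdom.
have nf := velocity_near mX vg (nbhs_singleton nU).
apply: filterS2 (filterI ng nf) (filterI nc Eg) => t [[it Et] ft] [ct Et'].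
by apply: (chart_inj mY ft ct); rewrite -Et' -Et repE.
Qed.

(** [curve_lifting] for the difference of [P] and [Q] in the chart [j], along the constant curve 0.
    The surjectivity hypothesis is transversality; it is stated in coordinates because the
    difference of the two maps makes sense only there. *)
Lemma velocity_equalizer {X Y} (P Q : X -> Y) (v : tanm X) j :
  is_mfd X -> is_mfd Y -> smooth_at P (foot v) -> smooth_at Q (foot v) ->
  P (foot v) = Q (foot v) -> cdom j (P (foot v)) ->
  (forall a, exists2 v' : tanm X, foot v' = foot v &
     comps (tmap P v') j - comps (tmap Q v') j = a) ->
  tmap P v = tmap Q v ->
  exists2 gamma : R -> X, velocity gamma v &
    \forall t \near (0 : R), P (gamma t) = Q (gamma t).
Proof.
move=> mX mY sP sQ PQ jp surj dPQ.
have [i ip] := chart_cover (foot v) mX.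
have jq : cdom j (Q (foot v)) by rewrite -PQ.
have [U [oU Up HU CU]] := smooth_at_chart mX sP ip jp.
have [V [oV Vp HV CV]] := smooth_at_chart mX sQ ip jq.
pose p := chart i (foot v).
pose Phi x := rep P i j x - rep Q i j x.
have oW := openI oU oV; have Wp : (U `&` V) p by [].
have CUW : Coo (U `&` V) (rep P i j) by apply: Coo_sub CU => x [].
have CVW : Coo (U `&` V) (rep Q i j) by apply: Coo_sub CV => x [].
have CPhi : Coo (U `&` V) Phi.
  have -> : Phi = fun x => rep P i j x + (-1) *: rep Q i j x.
    by apply/funext => x; rewrite scaleN1r.
  by apply: Coo_add => //; apply: Coo_scale => //; apply: Coo_cst.
have dPhi w : 'd Phi p w = 'd (rep P i j) p w - 'd (rep Q i j) p w.
  have D1 := Coo_is_diff CUW Wp; have D2 := Coo_is_diff CVW Wp.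
  have [_ E] := is_diffB D1 D2.
  exact: (congr1 (fun h : 'rV[R]_(mdim X) -> 'rV[R]_(mdim Y) => h w) E).
have Sj w : exists v', 'd Phi p v' = w.
  have [v' v'p <-] := surj w; exists (comps v' i).
  by rewrite dPhi !(tmap_comps (i := i)) ?v'p.
have C1 w : {for p, continuous (fun x => 'd Phi x w)}.
  exact: Coo_continuous (Coo_d w CPhi) Wp.
have E0 : (0 : 'rV[R]_(mdim Y)) = Phi p by rewrite /Phi !repE// PQ subrr.
have E1 : (0 : 'rV[R]_(mdim Y)) = 'd Phi p (comps v i).
  have P1 := tmap_comps mX mY sP ip jp; have Q1 := tmap_comps mX mY sQ ip jq.
  apply/esym; apply: etrans (dPhi _) _.
  apply: etrans (congr2 (fun a b => a - b) (esym P1) (esym Q1)) _.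
  by rewrite dPQ subrr.
have [g [g0 Dg Eg]] := curve_lifting (c := fun=> 0) (dc := fun=> 0) oW Wp
  (fun x => Coo_is_diff (x := x) CPhi) C1 Sj (is_diff_cst _ _) E0 E1.
have [gamma vg ng] := velocity_of_chart mX ip g0 Dg.
exists gamma => //.
have nP : mnbhs (foot v) (fun q => cdom j (P q)).
  by apply: (mnbhs_preim mX mY sP); apply: mnbhs_open => //; apply: mopen_cdom.
have nQ : mnbhs (foot v) (fun q => cdom j (Q q)).
  by apply: (mnbhs_preim mX mY sQ); apply: mnbhs_open => //; apply: mopen_cdom.
have nP' := velocity_near mX vg nP; have nQ' := velocity_near mX vg nQ.
apply: filterS2 (filterI ng nP') (filterI nQ' Eg) => t [[it Et] Pt] [Qt].
rewrite -Et /Phi !repE// => E2; apply: (chart_inj mY Pt Qt).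
exact/subr0_eq.
Qed.

Definition tangent_to {X} (A : set X) (u : tanm X) : Prop :=
  exists2 gamma : R -> X, velocity gamma u & \forall t \near (0 : R), A (gamma t).

Lemma local_extP {X Y} (A : set X) (f : X -> Y) p e : is_mfd X -> is_mfd Y ->
  local_ext A f p e <-> smooth_at e p /\ mnbhs p (fun q => A q -> e q = f q).
Proof.
move=> mX mY; split=> [[ O [ Op se E]]|[se nE]].
  have oO := smooth_on_open mY se; split; first by exists O.
  by exists O.
have [ O [ oO Op H]] := mnbhsI mX (smooth_at_nbhs mY se) nE.
exists O; split=> //; last by move=> q /H[].
by apply: smooth_onI => // q /H[].
Qed.

Lemma smooth_subP {X Y} (A : set X) (f : X -> Y) : is_mfd X -> is_mfd Y ->
  smooth_sub A f <-> forall p, A p -> exists2 e, smooth_at e p &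
    mnbhs p (fun q => A q -> e q = f q).
Proof.
move=> mX mY; split=> H p Ap.
  by have [e /(local_extP _ _ _ _ mX mY)[? ?]] := H p Ap; exists e.
have [e se nE] := H p Ap; exists e; exact/local_extP.
Qed.

(** Two local extensions agree with [f], hence with each other, along a curve inside [A], so they
    send its velocity to the same vector. The choice made by [tmap_sub] is thus harmless on vectors
    tangent to [A]. *)
Lemma tmap_subE {X Y} (A : set X) (f : X -> Y) (u : tanm X) e :
  is_mfd X -> is_mfd Y -> tangent_to A u -> local_ext A f (foot u) e ->
  tmap_sub A f u = tmap e u.
Proof.
move=> mX mY [c vc Ac] He.
have key e' : local_ext A f (foot u) e' -> velocity (fun t => f (c t)) (tmap e' u).
  move=> /(local_extP _ _ _ _ mX mY)[se nE].
  have E : \forall t \near (0 : R), e' (c t) = f (c t).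
    by have := velocity_near mX vc nE; apply: filterS2 Ac => t At; apply.
  exact: velocity_germ E (velocity_tmap mX mY se vc).
apply: the_uniq; first by exists e.
by move=> _ [e' He' ->]; apply: (velocity_uniq mY (key _ He') (key _ He)).
Qed.

Lemma velocity_tmap_sub {X Y} (A : set X) (f : X -> Y) c (u : tanm X) :
  is_mfd X -> is_mfd Y -> smooth_sub A f -> velocity c u ->
  (\forall t \near (0 : R), A (c t)) ->
  velocity (fun t => f (c t)) (tmap_sub A f u).
Proof.
move=> mX mY sf vc Ac.
have Au : A (foot u) by rewrite -vc.1; exact: nbhs_singleton Ac.
have [e He] := sf _ Au; rewrite (tmap_subE mX mY _ He); last by exists c.
have [se nE] := (local_extP _ _ _ _ mX mY).1 He.
have E : \forall t \near (0 : R), e (c t) = f (c t).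
  by have := velocity_near mX vc nE; apply: filterS2 Ac => t At; apply.
exact: velocity_germ E (velocity_tmap mX mY se vc).
Qed.

Lemma tpair_add X Y (v w : tanm X) (v' w' : tanm Y) : is_mfd X -> is_mfd Y ->
  foot v = foot w -> foot v' = foot w' ->
  tpair (tadd v w) (tadd v' w') = tadd (tpair v v') (tpair w w').
Proof.
move=> mX mY E E'; have mP := prodm_mfd mX mY.
have F : foot (tpair v v') = foot (tpair w w') by rewrite !foot_tpair// E E'.
rewrite -[RHS]tpair_eta//; congr tpair.
  by rewrite (tmap_add mP mX (smooth_at_fst _ mX mY) F) !tpair_fst.
by rewrite (tmap_add mP mY (smooth_at_snd _ mX mY) F) !tpair_snd.
Qed.

Lemma tpair_scale X Y a (v : tanm X) (v' : tanm Y) : is_mfd X -> is_mfd Y ->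
  tpair (tscale a v) (tscale a v') = tscale a (tpair v v').
Proof.
move=> mX mY; have mP := prodm_mfd mX mY.
rewrite -[RHS]tpair_eta//; congr tpair.
  by rewrite (tmap_scale _ mP mX (smooth_at_fst _ mX mY)) tpair_fst.
by rewrite (tmap_scale _ mP mY (smooth_at_snd _ mX mY)) tpair_snd.
Qed.

End Lifting.

(** * Tangent groupoids *)

Section TangentGroupoid.
Context {R : realType} (G : gpd R).
Hypothesis lieG : is_liegpd G.

Let mG : is_mfd (arr G). Proof. by case: lieG => -[]. Qed.
Let mM : is_mfd (obj G). Proof. by case: lieG => -[]. Qed.

Lemma gsrc_smooth_at (g : arr G) : smooth_at (@gsrc R G) g.
Proof. by case: lieG => _ [[+ _] _] _ _ _ => /smoothP; apply. Qed.
Lemma gtgt_smooth_at (g : arr G) : smooth_at (@gtgt R G) g.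
Proof. by case: lieG => _ [_ [+ _]] _ _ _ => /smoothP; apply. Qed.
Lemma ginv_smooth_at (g : arr G) : smooth_at (@ginv R G) g.
Proof. by case: lieG => _ _ [_ + _] _ _ => /smoothP; apply. Qed.
Lemma gunt_smooth_at (x : obj G) : smooth_at (@gunt R G) x.
Proof. by case: lieG => _ _ [_ _ +] _ _ => /smoothP; apply. Qed.
Lemma gmul_smooth_sub : smooth_sub (composable G)
  ((fun p => gmul p.1 p.2) : prodm (arr G) (arr G) -> arr G).
Proof. by case: lieG => _ _ [+ _ _] _ _. Qed.

Lemma gsrc_gmul (g h : arr G) : gsrc g = gtgt h -> gsrc (gmul g h) = gsrc h.
Proof. by case: lieG => _ _ _ [+ _ _] _ => H /H[]. Qed.
Lemma gtgt_gmul (g h : arr G) : gsrc g = gtgt h -> gtgt (gmul g h) = gtgt g.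
Proof. by case: lieG => _ _ _ [+ _ _] _ => H /H[]. Qed.
Lemma gsrc_ginv (g : arr G) : gsrc (ginv g) = gtgt g.
Proof. by case: lieG => _ _ _ [_ + _] _ => /(_ g)[]. Qed.
Lemma gtgt_ginv (g : arr G) : gtgt (ginv g) = gsrc g.
Proof. by case: lieG => _ _ _ [_ + _] _ => /(_ g)[]. Qed.
Lemma gsrc_gunt (x : obj G) : gsrc (gunt x) = x.
Proof. by case: lieG => _ _ _ [_ _ +] _ => /(_ x)[]. Qed.
Lemma gtgt_gunt (x : obj G) : gtgt (gunt x) = x.
Proof. by case: lieG => _ _ _ [_ _ +] _ => /(_ x)[]. Qed.
Lemma gmulA (g h k : arr G) : gsrc g = gtgt h -> gsrc h = gtgt k ->
  gmul g (gmul h k) = gmul (gmul g h) k.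
Proof. by case: lieG => _ _ _ _ [+ _ _]; apply. Qed.
Lemma gmul1g (g : arr G) : gmul (gunt (gtgt g)) g = g.
Proof. by case: lieG => _ _ _ _ [_ + _] => /(_ g)[]. Qed.
Lemma gmulg1 (g : arr G) : gmul g (gunt (gsrc g)) = g.
Proof. by case: lieG => _ _ _ _ [_ + _] => /(_ g)[]. Qed.
Lemma gmulgV (g : arr G) : gmul g (ginv g) = gunt (gtgt g).
Proof. by case: lieG => _ _ _ _ [_ _ +] => /(_ g)[]. Qed.
Lemma gmulVg (g : arr G) : gmul (ginv g) g = gunt (gsrc g).
Proof. by case: lieG => _ _ _ _ [_ _ +] => /(_ g)[]. Qed.

Lemma gsrc_surj (g : arr G) (w : tanm (obj G)) : foot w = gsrc g ->
  exists2 v : tanm (arr G), foot v = g & tmap (@gsrc R G) v = w.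
Proof. by case: lieG => _ [[_ +] _] _ _ _; apply. Qed.
Lemma gtgt_surj (g : arr G) (w : tanm (obj G)) : foot w = gtgt g ->
  exists2 v : tanm (arr G), foot v = g & tmap (@gtgt R G) v = w.
Proof. by case: lieG => _ [_ [_ +]] _ _ _; apply. Qed.

Lemma velocity_src (c : R -> arr G) (v : tanm (arr G)) : velocity c v ->
  velocity (fun t => gsrc (c t)) (tmap (@gsrc R G) v).
Proof. exact: velocity_tmap mG mM (gsrc_smooth_at _). Qed.
Lemma velocity_tgt (c : R -> arr G) (v : tanm (arr G)) : velocity c v ->
  velocity (fun t => gtgt (c t)) (tmap (@gtgt R G) v).
Proof. exact: velocity_tmap mG mM (gtgt_smooth_at _). Qed.
Lemma velocity_inv (c : R -> arr G) (v : tanm (arr G)) : velocity c v ->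
  velocity (fun t => ginv (c t)) (tmap (@ginv R G) v).
Proof. exact: velocity_tmap mG mG (ginv_smooth_at _). Qed.
Lemma velocity_unt (c : R -> obj G) (v : tanm (obj G)) : velocity c v ->
  velocity (fun t => gunt (c t)) (tmap (@gunt R G) v).
Proof. exact: velocity_tmap mM mG (gunt_smooth_at _). Qed.

(** As [gsrc] is a submersion, the left factor can follow any prescribed curve of right factors.
    Identities between several factors therefore start from a curve for the rightmost one and lift
    leftwards. *)
Lemma composable_lift (v v' : tanm (arr G)) c :
  tmap (@gsrc R G) v = tmap (@gtgt R G) v' -> velocity c v' ->
  exists2 b, velocity b v & \forall t \near (0 : R), gsrc (b t) = gtgt (c t).
Proof.
move=> E /velocity_tgt; rewrite -E => vc.
apply: (velocity_lift mG mM (gsrc_smooth_at _) _ vc).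
exact: gsrc_surj.
Qed.

Lemma tangent_composable (v v' : tanm (arr G)) :
  tmap (@gsrc R G) v = tmap (@gtgt R G) v' ->
  tangent_to (composable G) (tpair v v').
Proof.
move=> E; have [c vc] := velocity_curve v' mG.
have [b vb bc] := composable_lift E vc.
by exists (fun t => (b t, c t)); first exact: velocity_pair.
Qed.

Let tmul (v v' : tanm (arr G)) : tanm (arr G) := @gmul R (tgpd G) v v'.

Lemma velocity_gmul (v v' : tanm (arr G)) b c : velocity b v -> velocity c v' ->
  (\forall t \near (0 : R), gsrc (b t) = gtgt (c t)) ->
  velocity (fun t => gmul (b t) (c t)) (tmul v v').
Proof.
move=> vb vc bc; have mP := prodm_mfd mG mG.
have vp := velocity_pair mG mG vb vc.
exact: (velocity_tmap_sub mP mG gmul_smooth_sub vp bc).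
Qed.

Lemma foot_tmul (v v' : tanm (arr G)) :
  tmap (@gsrc R G) v = tmap (@gtgt R G) v' ->
  foot (tmul v v') = gmul (foot v) (foot v').
Proof.
move=> E; have [c vc] := velocity_curve v' mG.
have [b vb bc] := composable_lift E vc.
by rewrite -(velocity_gmul vb vc bc).1 vb.1 vc.1.
Qed.

Lemma tsrc_tmul (v v' : tanm (arr G)) :
  tmap (@gsrc R G) v = tmap (@gtgt R G) v' ->
  tmap (@gsrc R G) (tmul v v') = tmap (@gsrc R G) v'.
Proof.
move=> E; have [c vc] := velocity_curve v' mG.
have [b vb bc] := composable_lift E vc.
apply: (velocity_uniq mM (velocity_src (velocity_gmul vb vc bc))).
apply: velocity_germ (velocity_src vc).
by apply: filterS bc => t bct; rewrite gsrc_gmul.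
Qed.

Lemma ttgt_tmul (v v' : tanm (arr G)) :
  tmap (@gsrc R G) v = tmap (@gtgt R G) v' ->
  tmap (@gtgt R G) (tmul v v') = tmap (@gtgt R G) v.
Proof.
move=> E; have [c vc] := velocity_curve v' mG.
have [b vb bc] := composable_lift E vc.
apply: (velocity_uniq mM (velocity_tgt (velocity_gmul vb vc bc))).
apply: velocity_germ (velocity_tgt vb).
by apply: filterS bc => t bct; rewrite gtgt_gmul.
Qed.

Lemma tsrc_tinv (v : tanm (arr G)) :
  tmap (@gsrc R G) (tmap (@ginv R G) v) = tmap (@gtgt R G) v.
Proof.
have [c vc] := velocity_curve v mG.
apply: (velocity_uniq mM (velocity_src (velocity_inv vc))).
by apply: velocity_germ (velocity_tgt vc); apply: near0W => t; rewrite gsrc_ginv.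
Qed.

Lemma ttgt_tinv (v : tanm (arr G)) :
  tmap (@gtgt R G) (tmap (@ginv R G) v) = tmap (@gsrc R G) v.
Proof.
have [c vc] := velocity_curve v mG.
apply: (velocity_uniq mM (velocity_tgt (velocity_inv vc))).
by apply: velocity_germ (velocity_src vc); apply: near0W => t; rewrite gtgt_ginv.
Qed.

Lemma tsrc_tunt (v : tanm (obj G)) :
  tmap (@gsrc R G) (tmap (@gunt R G) v) = v.
Proof.
have [c vc] := velocity_curve v mM.
apply: (velocity_uniq mM (velocity_src (velocity_unt vc))).
by apply: velocity_germ vc; apply: near0W => t; rewrite gsrc_gunt.
Qed.

Lemma ttgt_tunt (v : tanm (obj G)) :
  tmap (@gtgt R G) (tmap (@gunt R G) v) = v.
Proof.
have [c vc] := velocity_curve v mM.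
apply: (velocity_uniq mM (velocity_tgt (velocity_unt vc))).
by apply: velocity_germ vc; apply: near0W => t; rewrite gtgt_gunt.
Qed.

Lemma tmulA (u v w : tanm (arr G)) :
  tmap (@gsrc R G) u = tmap (@gtgt R G) v ->
  tmap (@gsrc R G) v = tmap (@gtgt R G) w ->
  tmul u (tmul v w) = tmul (tmul u v) w.
Proof.
move=> E F; have [c vc] := velocity_curve w mG.
have [b vb bc] := composable_lift F vc; have [a va ab] := composable_lift E vb.
have vbc := velocity_gmul vb vc bc; have vab := velocity_gmul va vb ab.
have H1 : \forall t \near (0 : R), gsrc (a t) = gtgt (gmul (b t) (c t)).
  by apply: filterS2 ab bc => t -> bct; rewrite gtgt_gmul.
have H2 : \forall t \near (0 : R), gsrc (gmul (a t) (b t)) = gtgt (c t).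
  by apply: filterS2 ab bc => t abt <-; rewrite gsrc_gmul.
apply: (velocity_uniq mG (velocity_gmul va vbc H1)).
apply: velocity_germ (velocity_gmul vab vc H2).
by apply: filterS2 ab bc => t abt bct; rewrite gmulA.
Qed.

Lemma tmul1v (v : tanm (arr G)) :
  tmul (tmap (@gunt R G) (tmap (@gtgt R G) v)) v = v.
Proof.
have [c vc] := velocity_curve v mG.
have H : \forall t \near (0 : R), gsrc (gunt (gtgt (c t)) : arr G) = gtgt (c t).
  by apply: near0W => t; rewrite gsrc_gunt.
apply: (velocity_uniq mG (velocity_gmul (velocity_unt (velocity_tgt vc)) vc H)).
by apply: velocity_germ vc; apply: near0W => t; rewrite gmul1g.
Qed.

Lemma tmulv1 (v : tanm (arr G)) :
  tmul v (tmap (@gunt R G) (tmap (@gsrc R G) v)) = v.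
Proof.
have [c vc] := velocity_curve v mG.
have H : \forall t \near (0 : R), gsrc (c t) = gtgt (gunt (gsrc (c t)) : arr G).
  by apply: near0W => t; rewrite gtgt_gunt.
apply: (velocity_uniq mG (velocity_gmul vc (velocity_unt (velocity_src vc)) H)).
by apply: velocity_germ vc; apply: near0W => t; rewrite gmulg1.
Qed.

Lemma tmulvV (v : tanm (arr G)) :
  tmul v (tmap (@ginv R G) v) = tmap (@gunt R G) (tmap (@gtgt R G) v).
Proof.
have [c vc] := velocity_curve v mG.
have H : \forall t \near (0 : R), gsrc (c t) = gtgt (ginv (c t)).
  by apply: near0W => t; rewrite gtgt_ginv.
apply: (velocity_uniq mG (velocity_gmul vc (velocity_inv vc) H)).
apply: velocity_germ (velocity_unt (velocity_tgt vc)).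
by apply: near0W => t; rewrite gmulgV.
Qed.

Lemma tmulVv (v : tanm (arr G)) :
  tmul (tmap (@ginv R G) v) v = tmap (@gunt R G) (tmap (@gsrc R G) v).
Proof.
have [c vc] := velocity_curve v mG.
have H : \forall t \near (0 : R), gsrc (ginv (c t)) = gtgt (c t).
  by apply: near0W => t; rewrite gsrc_ginv.
apply: (velocity_uniq mG (velocity_gmul (velocity_inv vc) vc H)).
apply: velocity_germ (velocity_unt (velocity_src vc)).
by apply: near0W => t; rewrite gmulVg.
Qed.

(** Sums of tangent vectors are not visible on curves. For linearity the multiplication is replaced
    by one local extension [e], whose tangent map is linear at each point near which [e] is
    smooth. *)
Lemma tmul_ext (v v' : tanm (arr G)) e :
  tmap (@gsrc R G) v = tmap (@gtgt R G) v' ->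
  local_ext (composable G)
    ((fun p => gmul p.1 p.2) : prodm (arr G) (arr G) -> arr G)
    (foot v, foot v') e ->
  tmul v v' = tmap e (tpair v v').
Proof.
move=> E He; apply: tmap_subE; [exact: prodm_mfd|exact: mG|..].
  exact: tangent_composable.
by rewrite foot_tpair.
Qed.

Lemma foot_composable (v v' : tanm (arr G)) :
  tmap (@gsrc R G) v = tmap (@gtgt R G) v' -> gsrc (foot v) = gtgt (foot v').
Proof. by move=> /(congr1 (@foot _ _)); rewrite !foot_tmap. Qed.

Lemma tmul_add (v w v' w' : tanm (arr G)) :
  tmap (@gsrc R G) v = tmap (@gtgt R G) v' ->
  tmap (@gsrc R G) w = tmap (@gtgt R G) w' ->
  foot v = foot w -> foot v' = foot w' ->
  tmul (tadd v w) (tadd v' w') = tadd (tmul v v') (tmul w w').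
Proof.
move=> E F vw vw'; have mP := prodm_mfd mG mG.
have [e He] := gmul_smooth_sub (foot_composable E : composable G (foot v, foot v')).
have [se _] := (local_extP _ _ _ _ mP mG).1 He.
have [Fv _] := tadd_spec vw; have [Fv' _] := tadd_spec vw'.
have EF : tmap (@gsrc R G) (tadd v w) = tmap (@gtgt R G) (tadd v' w').
  rewrite (tmap_add mG mM (gsrc_smooth_at _) vw).
  by rewrite (tmap_add mG mM (gtgt_smooth_at _) vw') E F.
rewrite (tmul_ext E He) (@tmul_ext w w' e F) -?vw -?vw'//.
rewrite (@tmul_ext _ _ e EF) ?Fv ?Fv'//.
by rewrite tpair_add// (tmap_add mP mG)// !foot_tpair// vw vw'.
Qed.

Lemma tmul_scale a (v v' : tanm (arr G)) :
  tmap (@gsrc R G) v = tmap (@gtgt R G) v' ->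
  tmul (tscale a v) (tscale a v') = tscale a (tmul v v').
Proof.
move=> E; have mP := prodm_mfd mG mG.
have [e He] := gmul_smooth_sub (foot_composable E : composable G (foot v, foot v')).
have [se _] := (local_extP _ _ _ _ mP mG).1 He.
have [Fv _] := tscale_spec a v; have [Fv' _] := tscale_spec a v'.
have EF : tmap (@gsrc R G) (tscale a v) = tmap (@gtgt R G) (tscale a v').
  rewrite (tmap_scale a mG mM (gsrc_smooth_at _)).
  by rewrite (tmap_scale a mG mM (gtgt_smooth_at _)) E.
rewrite (tmul_ext E He) (@tmul_ext _ _ e EF) ?Fv ?Fv'//.
by rewrite tpair_scale// (tmap_scale a mP mG)// foot_tpair.
Qed.

End TangentGroupoid.

(** * Vector bundles *)

Section EuclideanValued.
Context {R : realType}.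
Implicit Types X Y Z : mfd R.

Lemma smooth_at_eucl_comp Z n m (h : 'rV[R]_n -> 'rV[R]_m) (f : Z -> 'rV[R]_n)
    (U : set 'rV[R]_n) z : is_mfd Z -> smooth_at (f : Z -> eucl R n) z ->
  open U -> U (f z) -> Coo U h -> smooth_at ((fun z => h (f z)) : Z -> eucl R m) z.
Proof.
move=> mZ sf oU Uf Ch.
apply: (@smooth_at_comp R Z (eucl R n) (eucl R m) f h z mZ (eucl_mfd n)
  (eucl_mfd m) sf).
exact: smooth_at_eucl oU Uf Ch.
Qed.

Lemma smooth_at_eucl_comp2 Z n m k (h : 'rV[R]_n -> 'rV[R]_m -> 'rV[R]_k)
    (f : Z -> 'rV[R]_n) (g : Z -> 'rV[R]_m) (U : set 'rV[R]_(n + m)) z :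
  is_mfd Z -> smooth_at (f : Z -> eucl R n) z ->
  smooth_at (g : Z -> eucl R m) z -> open U -> U (row_mx (f z) (g z)) ->
  Coo U (fun x => h (lsubmx x) (rsubmx x)) ->
  smooth_at ((fun z => h (f z) (g z)) : Z -> eucl R k) z.
Proof.
move=> mZ sf sg oU Uf Ch; have mP := prodm_mfd (eucl_mfd (R := R) n) (eucl_mfd m).
have sp := smooth_at_pair mZ (eucl_mfd n) (eucl_mfd m) sf sg.
have sh := smooth_at_eucl2 oU Uf Ch.
exact: (@smooth_at_comp R Z (prodm (eucl R n) (eucl R m)) (eucl R k)
  (fun z => (f z, g z)) (fun x => h x.1 x.2) z mZ mP (eucl_mfd k) sp sh).
Qed.

Lemma smooth_at_row_mx Z n m (f : Z -> 'rV[R]_n) (g : Z -> 'rV[R]_m) z :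
  is_mfd Z -> smooth_at (f : Z -> eucl R n) z ->
  smooth_at (g : Z -> eucl R m) z ->
  smooth_at ((fun z => row_mx (f z) (g z)) : Z -> eucl R (n + m)) z.
Proof.
move=> mZ sf sg; apply: (smooth_at_eucl_comp2 (U := setT)
  (h := fun x y => row_mx x y) mZ sf sg openT) => //.
have : Coo [set: 'rV[R]_(n + m)] (fun x => x) by apply: Coo_id; exact: openT.
by apply: Coo_ext; [exact: openT|move=> x _; rewrite hsubmxK].
Qed.

Lemma smooth_at_addv Z n (f g : Z -> 'rV[R]_n) z :
  is_mfd Z -> smooth_at (f : Z -> eucl R n) z ->
  smooth_at (g : Z -> eucl R n) z ->
  smooth_at ((fun z => f z + g z) : Z -> eucl R n) z.
Proof.
move=> mZ sf sg; apply: (smooth_at_eucl_comp2 (U := setT)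
  (h := fun x y => x + y) mZ sf sg openT) => //.
by apply: Coo_add; [exact: openT|apply: Coo_lsubmx openT|apply: Coo_rsubmx openT].
Qed.

Lemma smooth_at_lsubmx Z n m (f : Z -> 'rV[R]_(n + m)) z :
  is_mfd Z -> smooth_at (f : Z -> eucl R (n + m)) z ->
  smooth_at ((fun z => lsubmx (f z)) : Z -> eucl R n) z.
Proof.
move=> mZ sf; apply: (smooth_at_eucl_comp (U := setT) mZ sf openT I).
exact: Coo_lsubmx openT.
Qed.

Lemma smooth_at_rsubmx Z n m (f : Z -> 'rV[R]_(n + m)) z :
  is_mfd Z -> smooth_at (f : Z -> eucl R (n + m)) z ->
  smooth_at ((fun z => rsubmx (f z)) : Z -> eucl R m) z.
Proof.
move=> mZ sf; apply: (smooth_at_eucl_comp (U := setT) mZ sf openT I).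
exact: Coo_rsubmx openT.
Qed.

End EuclideanValued.

(** * Local trivializations and fibre operations *)

Section Trivializations.
Context {R : realType}.
Implicit Types X Y Z : mfd R.

(** A curried and pointwise form of [is_triv], in which the inverse [psi] is a function of the base
    point and the fibre coordinate. *)
Record trivialization {E X : mfd R} (V : vb E X) (U : set X)
    (phi : E -> 'rV[R]_(vrank V)) (psi : X -> 'rV[R]_(vrank V) -> E) : Prop :=
  Trivialization {
    triv_open : mopen U;
    triv_phi_smooth : forall e, U (vproj V e) ->
      smooth_at (phi : E -> eucl R (vrank V)) e;
    triv_psi_smooth : forall x y, U x ->
      smooth_at ((fun z => psi z.1 z.2) : prodm X (eucl R (vrank V)) -> E) (x, y);
    triv_proj : forall x y, U x -> vproj V (psi x y) = x;
    triv_phiK : forall x y, U x -> phi (psi x y) = y;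
    triv_psiK : forall e, U (vproj V e) -> psi (vproj V e) (phi e) = e;
    triv0 : forall x, U x -> phi (vzero V x) = 0;
    trivD : forall e e', U (vproj V e) -> vproj V e = vproj V e' ->
      phi (vadd V e e') = phi e + phi e';
    trivZ : forall a e, U (vproj V e) -> phi (vscale V a e) = a *: phi e }.

Lemma is_triv_trivialization {E X} (V : vb E X) U phi :
  is_triv (V := V) U phi -> exists psi, trivialization (V := V) U phi psi.
Proof.
case=> oU sphi [psi [spsi psiK phiK]] z [aD aZ].
exists (fun x y => psi (x, y)); split=> //.
- by move=> e Ue; exact: smooth_on_at sphi _.
- move=> x y Ux; have [ O Op so] := smooth_on_at spsi (Ux : U (x, y).1).
  by exists O => //; have <- : psi = (fun z => psi (z.1, z.2)) by
    apply/funext => -[].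
- by move=> x y /psiK-/(_ y)[].
- by move=> x y /psiK-/(_ y)[].
Qed.

Lemma trivialization_is_triv {E X} (V : vb E X) U phi psi : is_mfd E ->
  is_mfd X -> mopen (vproj V @^-1` U) -> trivialization (V := V) U phi psi ->
  is_triv (V := V) U phi.
Proof.
move=> mE mX oVU T; split.
- exact: triv_open T.
- by apply: smooth_onI => // e Ue; apply: triv_phi_smooth T _ Ue.
- exists (fun z => psi z.1 z.2); split.
  + have mP := prodm_mfd mX (eucl_mfd (R := R) (vrank V)).
    apply: smooth_onI => //; last by move=> [x y]; apply: triv_psi_smooth T _ _.
    apply: mopen_bigcup => p Up; have sf := smooth_at_fst p mX (eucl_mfd _).
    have := mnbhs_preim mP mX sf (mnbhs_open (triv_open T) Up).
    by move=> [ O [? ? ?]]; exists O.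
  + by move=> x y Ux; rewrite (triv_proj T)// (triv_phiK T).
  + by move=> e Ue; exact: triv_psiK T e Ue.
- exact: triv0 T.
- by split; [exact: trivD T|exact: trivZ T].
Qed.

Context {E X : mfd R} (V : vb E X).
Hypothesis vV : is_vb V.

Lemma vb_total_mfd : is_mfd E. Proof. by case: vV. Qed.
Lemma vb_base_mfd : is_mfd X. Proof. by case: vV. Qed.

Lemma vproj_smooth_at e : smooth_at (vproj V) e.
Proof. by case: vV => mE _ sp _ _; exact: (smoothP _ mE).1 sp e. Qed.

Lemma vproj_add e e' : vproj V e = vproj V e' -> vproj V (vadd V e e') = vproj V e.
Proof. by case: vV => _ _ _ [+ _] _; apply. Qed.

Lemma vproj_scale a e : vproj V (vscale V a e) = vproj V e.
Proof. by case: vV => _ _ _ [_ +] _; apply. Qed.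

Lemma triv_ex x : exists U phi psi, U x /\ @trivialization E X V U phi psi.
Proof.
case: vV => _ _ _ _ /(_ x)[U [phi [Ux /is_triv_trivialization[psi T]]]].
by exists U, phi, psi.
Qed.

(** [vb] lists no vector space axioms for its fibres. Identities between fibre elements are checked
    after applying [phi], where they hold for row vectors, and are brought back by this lemma. *)
Lemma triv_inj U phi psi e e' : @trivialization E X V U phi psi ->
  U (vproj V e) -> vproj V e = vproj V e' -> phi e = phi e' -> e = e'.
Proof.
move=> T Ue ee' pp'; rewrite -(triv_psiK T Ue) pp' ee'.
by rewrite (triv_psiK T)// -ee'.
Qed.

Lemma vzero_scale e : vscale V 0 e = vzero V (vproj V e).
Proof.
have [U [phi [psi [Ue T]]]] := triv_ex (vproj V e).
apply: (triv_inj T); rewrite ?vproj_scale ?vzeroK//.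
by rewrite (trivZ T)// (triv0 T)// scale0r.
Qed.

Lemma vaddC e e' : vproj V e = vproj V e' -> vadd V e e' = vadd V e' e.
Proof.
move=> E1; have [U [phi [psi [Ue T]]]] := triv_ex (vproj V e).
apply: (triv_inj T); rewrite ?vproj_add//.
by rewrite !(trivD T)// -?E1// addrC.
Qed.

Lemma vaddA e1 e2 e3 : vproj V e1 = vproj V e2 -> vproj V e1 = vproj V e3 ->
  vadd V e1 (vadd V e2 e3) = vadd V (vadd V e1 e2) e3.
Proof.
move=> E2 E3; have [U [phi [psi [Ue T]]]] := triv_ex (vproj V e1).
have E23 : vproj V e2 = vproj V e3 by rewrite -E2.
apply: (triv_inj T); rewrite ?vproj_add// ?vproj_add//.
by rewrite !(trivD T)// ?vproj_add// -?E2// addrA.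
Qed.

Lemma vadd0r e x : x = vproj V e -> vadd V (vzero V x) e = e.
Proof.
move=> ->; have [U [phi [psi [Ue T]]]] := triv_ex (vproj V e).
apply: (triv_inj T); rewrite ?vproj_add ?vzeroK//.
by rewrite (trivD T)// ?vzeroK// (triv0 T)// add0r.
Qed.

Lemma vaddr0 e x : x = vproj V e -> vadd V e (vzero V x) = e.
Proof. by move=> xe; rewrite vaddC ?vzeroK// vadd0r. Qed.

Lemma vaddI e e1 e2 : vproj V e = vproj V e1 -> vproj V e = vproj V e2 ->
  vadd V e e1 = vadd V e e2 -> e1 = e2.
Proof.
move=> E1 E2 H; have [U [phi [psi [Ue T]]]] := triv_ex (vproj V e).
apply: (triv_inj T); rewrite -?E1 -?E2//.
by apply: (addrI (phi e)); rewrite -!(trivD T)// H.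
Qed.

Lemma vaddN e : vadd V e (vscale V (-1) e) = vzero V (vproj V e).
Proof.
have [U [phi [psi [Ue T]]]] := triv_ex (vproj V e).
apply: (triv_inj T); rewrite ?vproj_add ?vzeroK ?vproj_scale//.
by rewrite (trivD T) ?vproj_scale// (trivZ T)// (triv0 T)// scaleN1r subrr.
Qed.

(** The alternating sum occurring in [is_multiplicative], solved for its middle term. *)
Lemma alt_eq0 x y z : vproj V x = vproj V y -> vproj V x = vproj V z ->
  vadd V (vadd V x (vscale V (-1) y)) z = vzero V (vproj V x) <->
  y = vadd V x z.
Proof.
move=> E1 E2; have [U [phi [psi [Ue T]]]] := triv_ex (vproj V x).
have P1 : vproj V (vadd V x (vscale V (-1) y)) = vproj V x.
  by rewrite vproj_add// vproj_scale.
have P2 : vproj V (vadd V (vadd V x (vscale V (-1) y)) z) = vproj V x.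
  by rewrite vproj_add P1.
have L : phi (vadd V (vadd V x (vscale V (-1) y)) z) = phi x - phi y + phi z.
  rewrite (trivD T) ?P1// (trivD T) ?vproj_scale// (trivZ T) -?E1//.
  by rewrite scaleN1r.
split=> [H|yE].
  apply: (triv_inj T); rewrite -?E1 ?vproj_add//.
  move: L; rewrite H (triv0 T)// (trivD T)// => /esym/eqP.
  by rewrite addrAC subr_eq0 => /eqP.
apply: (triv_inj T); rewrite ?P2 ?vzeroK//.
by rewrite L (triv0 T)// yE (trivD T)// opprD addrA subrr sub0r addNr.
Qed.

Lemma smooth_at_vzero x : smooth_at (vzero V) x.
Proof.
have mE := vb_total_mfd; have mX := vb_base_mfd.
have [U [phi [psi [Ux T]]]] := triv_ex x.
apply: (smooth_at_germ (f := fun x => psi x 0) mX mE).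
  exists U; split=> //; first exact: triv_open T.
  move=> y Uy; apply: (triv_inj T); rewrite ?(triv_proj T)// ?vzeroK//.
  by rewrite (triv_phiK T)// (triv0 T).
have mP := prodm_mfd mX (eucl_mfd (R := R) (vrank V)).
apply: (@smooth_at_comp R X (prodm X (eucl R (vrank V))) E
  (fun x => (x, 0)) (fun z => psi z.1 z.2) x mX mP mE).
  apply: (@smooth_at_pair R X X (eucl R (vrank V)) (fun x => x) (fun=> 0) x mX mX
    (eucl_mfd _)).
    exact: smooth_at_id.
  by apply: smooth_at_cst => //; exact: eucl_mfd.
exact: triv_psi_smooth T _ _ Ux.
Qed.

Lemma smooth_at_psi Z (f : Z -> X) (g : Z -> 'rV[R]_(vrank V)) z U phi psi :
  is_mfd Z -> @trivialization E X V U phi psi -> U (f z) -> smooth_at f z ->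
  smooth_at (g : Z -> eucl R (vrank V)) z ->
  smooth_at (fun z => psi (f z) (g z)) z.
Proof.
move=> mZ T Uf sf sg; have mE := vb_total_mfd; have mX := vb_base_mfd.
have mP := prodm_mfd mX (eucl_mfd (R := R) (vrank V)).
apply: (@smooth_at_comp R Z (prodm X (eucl R (vrank V))) E
  (fun z => (f z, g z)) (fun z => psi z.1 z.2) z mZ mP mE).
  by apply: smooth_at_pair => //; exact: eucl_mfd.
exact: triv_psi_smooth T _ _ Uf.
Qed.

Lemma smooth_at_phi Z (f : Z -> E) z U phi psi :
  is_mfd Z -> @trivialization E X V U phi psi -> U (vproj V (f z)) ->
  smooth_at f z -> smooth_at ((fun z => phi (f z)) : Z -> eucl R (vrank V)) z.
Proof.
move=> mZ T Uf sf; have mE := vb_total_mfd.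
apply: (@smooth_at_comp R Z E (eucl R (vrank V)) f phi z mZ mE (eucl_mfd _) sf).
exact: triv_phi_smooth T _ Uf.
Qed.

Lemma smooth_at_proj Z (f : Z -> E) z : is_mfd Z -> smooth_at f z ->
  smooth_at (fun z => vproj V (f z)) z.
Proof.
move=> mZ sf; apply: (smooth_at_comp mZ vb_total_mfd vb_base_mfd sf).
exact: vproj_smooth_at.
Qed.

Lemma smooth_at_vadd Z (f g : Z -> E) z : is_mfd Z ->
  smooth_at f z -> smooth_at g z ->
  mnbhs z (fun z => vproj V (f z) = vproj V (g z)) ->
  smooth_at (fun z => vadd V (f z) (g z)) z.
Proof.
move=> mZ sf sg nfg; have mE := vb_total_mfd; have mX := vb_base_mfd.
have [U [phi [psi [Ux T]]]] := triv_ex (vproj V (f z)).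
have sp := smooth_at_proj mZ sf.
apply: (smooth_at_germ (f := fun z => psi (vproj V (f z)) (phi (f z) + phi (g z)))
  mZ mE).
  have nU := mnbhs_preim mZ mX sp (mnbhs_open (triv_open T) Ux).
  apply: mnbhsS (mnbhsI mZ nfg nU) => y [Ey Uy].
  apply: (triv_inj T); rewrite ?(triv_proj T)// ?vproj_add//.
  by rewrite (triv_phiK T)// (trivD T).
apply: (smooth_at_psi mZ T Ux sp); apply: smooth_at_addv => //.
  exact: smooth_at_phi T Ux sf.
have Ug : U (vproj V (g z)).
  by have E1 := mnbhs_singleton nfg; rewrite /= in E1; rewrite -E1.
exact: smooth_at_phi T Ug sg.
Qed.

End Trivializations.

Section VbMaps.
Context {R : realType} {E X E' X' : mfd R} (V : vb E X) (V' : vb E' X').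
Hypotheses (vV : is_vb V) (vV' : is_vb V').
Context (F : E -> E') (f : X -> X').
Hypothesis Ff : vb_map V V' F f.

Lemma vb_map_proj e : vproj V' (F e) = f (vproj V e).
Proof. by case: Ff. Qed.
Lemma vb_mapD e1 e2 : vproj V e1 = vproj V e2 ->
  F (vadd V e1 e2) = vadd V' (F e1) (F e2).
Proof. by case: Ff => _ _ _ + _; apply. Qed.
Lemma vb_mapZ a e : F (vscale V a e) = vscale V' a (F e).
Proof. by case: Ff. Qed.
Lemma vb_map0 x : F (vzero V x) = vzero V' (f x).
Proof.
have H : vscale V 0 (vzero V x) = vzero V x by rewrite (vzero_scale vV) vzeroK.
by rewrite -H vb_mapZ (vzero_scale vV') vb_map_proj vzeroK.
Qed.
Lemma vb_map_smooth_at e : smooth_at F e.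
Proof. by case: Ff => /(smoothP _ (vb_total_mfd vV)). Qed.
Lemma vb_map_base_smooth_at x : smooth_at f x.
Proof. by case: Ff => _ /(smoothP _ (vb_base_mfd vV)). Qed.

End VbMaps.

Section TangentBundle.
Context {R : realType}.
Implicit Types X Y : mfd R.

Lemma tvb_trivialization X (i : idx X) : is_mfd X -> exists psi,
  @trivialization R (tanm X) X (tvb X) (cdom i) (fun v => comps v i) psi.
Proof.
move=> mX; have mT := tanm_mfd mX.
(* [psi] is chosen pointwise: vectors with prescribed components in the chart [i], and zero vectors
   outside its domain. *)
have H (x : X) : exists g : 'rV[R]_(mdim X) -> tanm X, cdom i x ->
    forall y, foot (g y) = x /\ comps (g y) i = y.
  have [ix|nix] := pselect (cdom i x); last by exists (fun=> tzero x).
  have /choice[g Hg] : forall y, exists v : tanm X, foot v = x /\ comps v i = y.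
    by move=> y; have [v ? ?] := tangent_ex y mX ix; exists v.
  by exists g.
have [psi Hpsi] := choice H; exists psi; split.
- exact: mopen_cdom.
- move=> v iv; apply: (@smooth_at_chartI R (tanm X) (eucl R (mdim X)) _ v i tt
    setT rsubmx mT (eucl_mfd _) iv openT I).
    by move=> w /= iw _; rewrite row_mxKr.
  exact: Coo_rsubmx openT.
- move=> x y ix; have mP := prodm_mfd mX (eucl_mfd (R := R) (mdim X)).
  apply: (@smooth_at_chartI R (prodm X (eucl R (mdim X))) (tanm X) _ (x, y)
    (i, tt) i setT id mP mT _ openT I) => //.
    move=> [x' y'] [/= ix' _] _; have [-> ->] := Hpsi x' ix' y'.
    by split.
  by apply: Coo_id; exact: openT.
- by move=> x y ix; have [] := Hpsi x ix y.
- by move=> x y ix; have [] := Hpsi x ix y.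
- move=> v iv; have [F C] := Hpsi (foot v) iv (comps v i).
  by apply: (@tvec_eq R X i); rewrite ?F.
- by [].
- by move=> v w iv vw; have [_ ->] := tadd_spec vw.
- by move=> a v iv; have [_ ->] := tscale_spec a v.
Qed.

Lemma tvb_is_vb X : is_mfd X -> is_vb (tvb X).
Proof.
move=> mX; have mT := tanm_mfd mX; split=> //.
- by apply/smoothP => // v; apply: smooth_at_foot.
- by split=> [v w vw|a v]; [have [] := tadd_spec vw|have [] := tscale_spec a v].
- move=> x; have [i ix] := chart_cover x mX; have [psi T] := tvb_trivialization i mX.
  exists (cdom i), (fun v => comps v i); split=> //.
  apply: trivialization_is_triv T => //.
  by apply: (mopen_cdom (i := i : idx (tanm X)) mT).
Qed.

End TangentBundle.

(** * Countable covers of manifolds *)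

Section SecondCountable.
Context {R : realType}.

(** The radius [1 / (m + 1)] is taken below [e / 2] and the rational centre within half the radius
    of [x], so that the triangle inequality keeps the ball inside [O]. Such balls form a countable
    family. *)
Lemma rational_ball n (O : set 'rV[R]_n) x : open O -> O x ->
  exists (q : 'rV[rat]_n) (m : nat),
    let B := [set y | `|y - map_mx (ratr : rat -> R) q| < m.+1%:R^-1] in
    B x /\ B `<=` O.
Proof.
move=> oO Ox; have : nbhs x O by apply: open_nbhs_nbhs.
move=> /nbhs_ballP[e /= e0 eO].
have [m me] : exists m : nat, (m.+1%:R^-1 : R) < e / 2.
  have e20 : 0 < e / 2 by rewrite divr_gt0.
  have [N _ HN] := near_infty_natSinv_lt (PosNum e20).
  by exists N; apply: HN => /=.
have m0 : 0 < (m.+1%:R^-1 : R) by rewrite invr_gt0.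
have [q Hq] : exists q : 'I_n -> rat, forall i,
    `|x 0 i - ratr (q i)| < (m.+1%:R^-1 : R) / 2.
  have Hc (i : 'I_n) : exists q : rat, `|x 0 i - ratr q| < (m.+1%:R^-1 : R) / 2.
   have [] := @rat_in_itvoo R (x 0 i - (m.+1%:R^-1 : R) / 2)
    (x 0 i + (m.+1%:R^-1 : R) / 2).
     by rewrite ltrD2l gtrN// divr_gt0.
   move=> q; rewrite in_itv /= => /andP[q1 q2]; exists q.
   by rewrite ltr_distlC q1 q2.
  by have [q Hq] := choice Hc; exists q.
exists (\row_i q i), m; split => [|y] /=.
  apply: (@le_lt_trans _ _ ((m.+1%:R^-1 : R) / 2)).
    apply: normr_rV_le => [|i]; first by rewrite divr_ge0// ltW.
    by rewrite !mxE ltW.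
  by rewrite ltr_pdivrMr// ltr_pMr// ltr1n.
move=> yq; apply: eO; rewrite -ball_normE /=.
have xq : `|x - map_mx (ratr : rat -> R) (\row_i q i)| < (m.+1%:R^-1 : R).
  apply: (@le_lt_trans _ _ ((m.+1%:R^-1 : R) / 2)).
    apply: normr_rV_le => [|i]; first by rewrite divr_ge0// ltW.
    by rewrite !mxE ltW.
  by rewrite ltr_pdivrMr// ltr_pMr// ltr1n.
apply: (le_lt_trans (ler_distD (map_mx (ratr : rat -> R) (\row_i q i)) x y)).
rewrite [ltRHS]splitr ltrD//; first exact: lt_trans me.
by rewrite distrC; exact: lt_trans me.
Qed.

(* Lindelof: pick one [k] for each rational ball in a chart domain on which
   some [k] works. *)
Lemma countable_cover (X : mfd R) (K : Type) (C : K -> set X) : is_mfd X ->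
  (forall x, exists2 k, C k x & mopen (C k)) ->
  exists D : set K, countable D /\ forall x, exists2 k, D k & C k x.
Proof.
move=> mX cov; have [_ [D [cD HD]] _ _] := mX.
(* The empty manifold is treated apart because [k0], the default value of the choice function [g],
   is obtained from a point. *)
have [[x0]|no] := pselect (exists x : X, True); last first.
  exists set0; split; first exact: countable0.
  by move=> x; case: no; exists x.
have [k0 _ _] := cov x0.
pose B (a : idx X * ('rV[rat]_(mdim X) * nat)) : set X :=
  [set x | cdom a.1 x /\
    `|chart a.1 x - map_mx (ratr : rat -> R) a.2.1| < a.2.2.+1%:R^-1].
have [g Hg] : exists g : idx X * ('rV[rat]_(mdim X) * nat) -> K,
    forall a, (exists k, B a `<=` C k) -> B a `<=` C (g a).
  have Hc a : exists k, (exists k, B a `<=` C k) -> B a `<=` C k.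
    by have [[k Hk]|n] := pselect (exists k, B a `<=` C k); [exists k|exists k0].
  by have [g Hg] := choice Hc; exists g.
exists (g @` (D `*` setT)); split.
  apply: (@sub_countable _ _ _ (D `*` [set: 'rV[rat]_(mdim X) * nat])).
    exact: card_image_le.
  by apply: countableX => //; exact: countableP.
move=> x; have [i Di ix] := HD x; have [k Ckx oC] := cov x.
have [q [m [xB BO]]] := rational_ball (oC i)
  (ex_intro2 _ _ x (conj Ckx ix) erefl : (chart i @` (C k `&` cdom i)) (chart i x)).
exists (g (i, (q, m))); first by exists (i, (q, m)).
apply: Hg; last by [].
exists k => y [/= iy yB]; have [z [Cz iz] zy] := BO _ yB.
by rewrite -(chart_inj mX iz iy zy).
Qed.

End SecondCountable.

(** * Whitney sums *)

Section Whitney.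
Context {R : realType} {E E' X : mfd R} (V : vb E X) (V' : vb E' X).
Hypotheses (vV : is_vb V) (vV' : is_vb V').

Lemma wpairP e e' : vproj V e = vproj V' e' -> sval (wpair V V' e e') = (e, e').
Proof.
move=> E1; apply: (@theP _ _ [set w : wpt V V' | sval w = (e, e')]).
by exists (exist _ (e, e') E1).
Qed.

Lemma wpt_eq (w w' : wpt V V') : (sval w).1 = (sval w').1 ->
  (sval w).2 = (sval w').2 -> w = w'.
Proof.
case: w w' => [[a b] p] [[c d] q] /= E1 E2; move: p q; rewrite E1 E2 => p q.
by congr exist; apply: Prop_irrelevance.
Qed.

Lemma wpt_proj (w : wpt V V') : vproj V (sval w).1 = vproj V' (sval w).2.
Proof. exact: (svalP w). Qed.

Lemma wpair_eta (w : wpt V V') : wpair V V' (sval w).1 (sval w).2 = w.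
Proof. by apply: wpt_eq; rewrite wpairP ?wpt_proj. Qed.

Lemma wproj_wpair e e' : vproj V e = vproj V' e' ->
  wproj (wpair V V' e e') = vproj V e.
Proof. by move=> H; rewrite /wproj wpairP. Qed.

Lemma triv_spec (t : triv V) : exists psi,
  @trivialization R E X V (sval t).1 (sval t).2 psi.
Proof. exact: is_triv_trivialization (svalP t). Qed.

End Whitney.

Section Transition.
Context {R : realType} {E X : mfd R} (V : vb E X).
Hypothesis vV : is_vb V.

Let mX : is_mfd X := vb_base_mfd vV.

Lemma transition_smooth U phi psi U' phi' psi' :
  @trivialization R E X V U phi psi -> @trivialization R E X V U' phi' psi' ->
  smooth_on [set z : prodm X (eucl R (vrank V)) | U z.1 /\ U' z.1]
    ((fun z => phi' (psi z.1 z.2)) :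
       prodm X (eucl R (vrank V)) -> eucl R (vrank V)).
Proof.
move=> T T'; have mP := prodm_mfd mX (eucl_mfd (R := R) (vrank V)).
apply: smooth_onI => // [|z [Uz U'z]].
  apply: mopen_bigcup => p [Up U'p]; have sf := smooth_at_fst p mX (eucl_mfd _).
  have := mnbhs_preim mP mX sf (mnbhsI mX (mnbhs_open (triv_open T) Up)
    (mnbhs_open (triv_open T') U'p)).
  by move=> [ O [? ? ?]]; exists O.
have sz := smooth_at_id z mP.
apply: (smooth_at_phi (V := V) vV mP T').
  by rewrite (triv_proj T).
apply: (smooth_at_psi vV mP T Uz).
  exact: (smooth_at_fst z mX (eucl_mfd _)).
exact: (smooth_at_snd z mX (eucl_mfd _)).
Qed.

End Transition.

Section WhitneyManifold.
Context {R : realType} {E E' X : mfd R} (V : vb E X) (V' : vb E' X).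
Hypotheses (vV : is_vb V) (vV' : is_vb V').

Lemma triv_cover x : exists t : triv V, (sval t).1 x.
Proof.
by case: vV => _ _ _ _ /(_ x)[U [phi [Ux T]]]; exists (exist _ (U, phi) T).
Qed.

Lemma wpt_ex x i (t : triv V) (t' : triv V') y y' : cdom i x -> (sval t).1 x ->
  (sval t').1 x ->
  exists w : whitney V V', [/\ wproj w = x, (sval t).2 (sval w).1 = y &
    (sval t').2 (sval w).2 = y'].
Proof.
move=> ix tx tx'; have [psi T] := triv_spec t; have [psi' T'] := triv_spec t'.
have H : vproj V (psi x y) = vproj V' (psi' x y').
  by rewrite (triv_proj T)// (triv_proj T').
exists (wpair V V' (psi x y) (psi' x y')).
by rewrite wproj_wpair// wpairP//= (triv_proj T)// (triv_phiK T)// (triv_phiK T').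
Qed.

End WhitneyManifold.

Section WhitneyBundle.
Context {R : realType} {E E' X : mfd R} (V : vb E X) (V' : vb E' X).
Hypotheses (vV : is_vb V) (vV' : is_vb V').

Let mE : is_mfd E := vb_total_mfd vV.
Let mE' : is_mfd E' := vb_total_mfd vV'.
Let mX : is_mfd X := vb_base_mfd vV.
Let r := vrank V.
Let r' := vrank V'.

Lemma mopen_wproj (O : set X) : mopen O ->
  mopen ([set w | O (wproj w)] : set (whitney V V')).
Proof.
move=> oO [i [t t']].
have [psi T] := triv_spec t; have [psi' T'] := triv_spec t'.
have oW := mopenI mX (mopenI mX oO (triv_open T)) (triv_open T').
have := @open_lsubmx R (mdim X) (r + r') _ (oW i); congr open.
apply/seteqP; split=> [z [p [[[ Op tp] tp'] ip] pz] |_ [w [ Ow [/= iw tw tw']] <-] ].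
  have [w [wp wy wy']] := wpt_ex (lsubmx (rsubmx z)) (rsubmx (rsubmx z)) ip tp tp'.
  exists w; first by rewrite /= wp.
  by rewrite /= wp wy wy' pz !hsubmxK.
by rewrite /= row_mxKl; exists (wproj w).
Qed.

Lemma whitney_mfd : is_mfd (whitney V V').
Proof.
apply: mfdI.
- move=> [i [t t']] w w' [/= iw tw tw'] [/= iw' sw sw'] /eq_row_mx[E1 /eq_row_mx[E2 E3]].
  have [psi T] := triv_spec t; have [psi' T'] := triv_spec t'.
  have ww := chart_inj mX iw iw' E1.
  apply: wpt_eq; first exact: (triv_inj T).
  by apply: (triv_inj T'); rewrite -?wpt_proj.
(* The charts are indexed by all local trivializations, of which there are in general uncountably
   many; [countable_cover] on the base selects countably many that suffice. *)
- have H x : exists2 k : idx (whitney V V'),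
      [set x | [/\ cdom k.1 x, (sval k.2.1).1 x & (sval k.2.2).1 x]] x &
      mopen [set x | [/\ cdom k.1 x, (sval k.2.1).1 x & (sval k.2.2).1 x]].
    have [i ix] := chart_cover x mX; have [t tx] := triv_cover vV x.
    have [t' tx'] := triv_cover vV' x; exists (i, (t, t')) => //=.
    have [psi T] := triv_spec t; have [psi' T'] := triv_spec t'.
    have oi : mopen (cdom i) by apply: mopen_cdom.
    have := mopenI mX (mopenI mX oi (triv_open T)) (triv_open T').
    congr mopen; apply/seteqP; split=> y /=; first by case=> -[].
    by case.
  have [D [cD HD]] := countable_cover mX H; exists D; split=> // w.
  by have [k Dk kw] := HD (wproj w); exists k.
- move=> [i [t t']] [j [s s']].
  have [psi T] := triv_spec t; have [psi' T'] := triv_spec t'.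
  have [rho S] := triv_spec s; have [rho' S'] := triv_spec s'.
  have [_ _ sX _] := mX; have [oD CD] := sX i j.
  set D := (X in open X) in oD.
  have [oA CA] := transition_smooth vV T S (i, tt) tt.
  set A := (X in open X) in oA.
  have [oA' CA'] := transition_smooth vV' T' S' (i, tt) tt.
  set A' := (X in open X) in oA'.
  (* In coordinates [(x, y, y')] the maps [p1] and [p2] keep the base point together with one fibre
     coordinate, which are the arguments of the two transition functions. *)
  pose p1 (z : 'rV[R]_(mdim X + (r + r'))) := row_mx (lsubmx z) (lsubmx (rsubmx z)).
  pose p2 (z : 'rV[R]_(mdim X + (r + r'))) := row_mx (lsubmx z) (rsubmx (rsubmx z)).
  have Cc a b c (f : 'rV[R]_a -> 'rV[R]_b) (g : 'rV[R]_b -> 'rV[R]_c) :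
      Coo setT f -> Coo setT g -> Coo setT (fun x => g (f x)).
    by move=> Cf Cg; apply: (Coo_comp (U' := setT)) => //; exact: openT.
  have CL a b : Coo setT (fun x : 'rV[R]_(a + b) => lsubmx x).
    exact: Coo_lsubmx openT.
  have CR a b : Coo setT (fun x : 'rV[R]_(a + b) => rsubmx x).
    exact: Coo_rsubmx openT.
  have C1 : Coo setT p1.
    by apply: Coo_row_mx; [exact: openT|exact: CL|apply: Cc; [exact: CR|exact: CL]].
  have C2 : Coo setT p2.
    by apply: Coo_row_mx; [exact: openT|exact: CL|apply: Cc; [exact: CR|exact: CR]].
  have o1 := Coo_open_preim openT C1 oA; have o2 := Coo_open_preim openT C2 oA'.
  have oL := @open_lsubmx R (mdim X) (r + r') _ oD.
  pose U := [set z : 'rV[R]_(mdim X + (r + r')) | D (lsubmx z)] `&`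
    ([set z | setT z /\ A (p1 z)] `&` [set z | setT z /\ A' (p2 z)]).
  have oU : open U by apply: openI => //; apply: openI.
  pose th : prodm X (eucl R r) -> eucl R r := fun z => (sval s).2 (psi z.1 z.2).
  pose th' : prodm X (eucl R r') -> eucl R r' := fun z => (sval s').2 (psi' z.1 z.2).
  exists U, (fun z => row_mx (rep (id : X -> X) i j (lsubmx z))
    (row_mx (rep th (i, tt) tt (p1 z)) (rep th' (i, tt) tt (p2 z)))).
  (* Overlaps of trivializations consist of whole fibres, so membership in the domains [A] and [A']
     depends on the base point alone. *)
  have AE x y : cdom i x -> (sval t).1 x -> A (row_mx (chart i x) y) <-> (sval s).1 x.
    move=> ix tx; split=> [[[x' y'] [[[/= tx' sx'] [ix' _]] _] /eq_row_mx[E1 _]]|sx].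
      by rewrite -(chart_inj mX ix' ix E1).
    by exists (x, y).
  have AE' x y : cdom i x -> (sval t').1 x -> A' (row_mx (chart i x) y) <-> (sval s').1 x.
    move=> ix tx; split=> [[[x' y'] [[[/= tx' sx'] [ix' _]] _] /eq_row_mx[E1 _]]|sx].
      by rewrite -(chart_inj mX ix' ix E1).
    by exists (x, y).
  split=> //.
  + apply: Coo_row_mx => //.
      apply: (Coo_comp (U' := D) (g := rep (id : X -> X) i j)) => //.
        by move=> z [].
      exact: Coo_lsubmx.
    apply: Coo_row_mx => //.
      apply: (Coo_comp (U' := A) (f := p1) (g := rep th (i, tt) tt)) => //.
        by move=> z [_ [[]]].
      by apply: Coo_sub C1.
    apply: (Coo_comp (U' := A') (f := p2) (g := rep th' (i, tt) tt)) => //.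
      by move=> z [_ [_ []]].
    by apply: Coo_sub C2.
  + move=> z [[x [[_ ix] jx] xz] [[_ Az] [_ Az']]].
    have tx : (sval t).1 x.
      have [[x' y'] [[[/= tx' sx'] [ix' _]] _] /eq_row_mx[E1 _]] := Az.
      by rewrite -(chart_inj mX ix' ix) // E1 xz.
    have tx' : (sval t').1 x.
      have [[x' y'] [[[/= tx' sx'] [ix' _]] _] /eq_row_mx[E1 _]] := Az'.
      by rewrite -(chart_inj mX ix' ix) // E1 xz.
    have [w [wp wy wy']] := wpt_ex (lsubmx (rsubmx z)) (rsubmx (rsubmx z)) ix tx tx'.
    exists w; first by rewrite /= wp.
    by rewrite /= wp wy wy' xz !hsubmxK.
  + move=> w [/= iw tw tw']; rewrite /U /p1 /p2 /= !(row_mxKl, row_mxKr).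
    split=> [[[x [[_ ix] jx] xw] [[_ Aw] [_ Aw']]]|[jw sw sw']].
      split; [by rewrite -(chart_inj mX ix iw xw)|exact: (AE _ _ iw tw).1 Aw|].
      exact: (AE' _ _ iw tw').1 Aw'.
    split; first by exists (wproj w).
    by split; split=> //; [exact: (AE _ _ iw tw).2 sw|exact: (AE' _ _ iw tw').2 sw'].
  + move=> w [/= iw tw tw'] [/= jw sw sw'].
    rewrite /p1 /p2 !(row_mxKl, row_mxKr) repE//; congr row_mx.
    have mP := prodm_mfd mX (eucl_mfd (R := R) r).
    have mP' := prodm_mfd mX (eucl_mfd (R := R) r').
    have R1 := @repE R (prodm X (eucl R r)) (eucl R r) th (i, tt) tt
      (wproj w, (sval t).2 (sval w).1) mP.
    have R2 := @repE R (prodm X (eucl R r')) (eucl R r') th' (i, tt) tt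
      (wproj w, (sval t').2 (sval w).2) mP'.
    rewrite R1// R2// /th /th' /=; congr row_mx.
      by rewrite (triv_psiK T).
    by have E1 := wpt_proj w; rewrite /wproj E1 (triv_psiK T')// -E1.
- move=> w w' ww'; have [E1|E1] := pselect (wproj w = wproj w').
    have [i iv] := chart_cover (wproj w) mX; have [t tw] := triv_cover vV (wproj w).
    have [t' tw'] := triv_cover vV' (wproj w); left; exists (i, (t, t')) => //=.
    by rewrite -E1.
  have [_ _ _ /(_ _ _ E1)[ O [ O' [ oO oO' Op Oq OO]]]] := mX.
  right; exists [set v | O (wproj v)], [set v | O' (wproj v)].
  split; [exact: mopen_wproj|exact: mopen_wproj|by []|by []|].
  apply/seteqP; split=> // u [Or Or'].
  by have : (O `&` O') (wproj u) by []; rewrite OO.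
Qed.

Let mW : is_mfd (whitney V V') := whitney_mfd.

Lemma smooth_at_wproj (w : whitney V V') :
  smooth_at (@wproj R E E' X V V' : whitney V V' -> X) w.
Proof.
have [k kw] := chart_cover w mW.
apply: (@smooth_at_chartI R (whitney V V') X _ w k k.1 setT lsubmx mW mX kw openT I).
  by move=> q [/= iq _ _] _; rewrite row_mxKl.
exact: Coo_lsubmx openT.
Qed.

Lemma smooth_at_wfst (w : whitney V V') :
  smooth_at ((fun w => (sval w).1) : whitney V V' -> E) w.
Proof.
have [[i [t t']] kw] := chart_cover w mW; have [/= iw tw tw'] := kw.
have [psi T] := triv_spec t.
apply: (smooth_at_germ (f := fun w : whitney V V' =>
    psi (wproj w) ((sval t).2 (sval w).1)) mW mE).
  exists [set w | (sval t).1 (wproj w)]; split=> //.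
    exact: mopen_wproj (triv_open T).
  by move=> v tv /=; rewrite (triv_psiK T).
apply: (smooth_at_psi vV mW T tw); first exact: smooth_at_wproj.
apply: (@smooth_at_chartI R (whitney V V') (eucl R r) _ w (i, (t, t')) tt setT
  (fun z => lsubmx (rsubmx z)) mW (eucl_mfd _) kw openT I).
  by move=> q [/= iq _ _] _; rewrite row_mxKr row_mxKl.
apply: (Coo_comp (U' := setT) openT (fun _ _ => I)).
  exact: Coo_rsubmx openT.
exact: Coo_lsubmx openT.
Qed.

Lemma smooth_at_wsnd (w : whitney V V') :
  smooth_at ((fun w => (sval w).2) : whitney V V' -> E') w.
Proof.
have [[i [t t']] kw] := chart_cover w mW; have [/= iw tw tw'] := kw.
have [psi T] := triv_spec t'.
apply: (smooth_at_germ (f := fun w : whitney V V' =>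
    psi (wproj w) ((sval t').2 (sval w).2)) mW mE').
  exists [set w | (sval t').1 (wproj w)]; split=> //.
    exact: mopen_wproj (triv_open T).
  by move=> v tv /=; rewrite /wproj wpt_proj (triv_psiK T)// -wpt_proj.
apply: (smooth_at_psi vV' mW T tw'); first exact: smooth_at_wproj.
apply: (@smooth_at_chartI R (whitney V V') (eucl R r') _ w (i, (t, t')) tt setT
  (fun z => rsubmx (rsubmx z)) mW (eucl_mfd _) kw openT I).
  by move=> q [/= iq _ _] _; rewrite !row_mxKr.
apply: (Coo_comp (U' := setT) openT (fun _ _ => I)).
  exact: Coo_rsubmx openT.
exact: Coo_rsubmx openT.
Qed.

Lemma smooth_at_wpair (Z : mfd R) (f : Z -> E) (g : Z -> E') z : is_mfd Z ->
  smooth_at f z -> smooth_at g z ->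
  mnbhs z (fun z => vproj V (f z) = vproj V' (g z)) ->
  smooth_at ((fun z => wpair V V' (f z) (g z)) : Z -> whitney V V') z.
Proof.
move=> mZ sf sg nfg; have E0 := mnbhs_singleton nfg; rewrite /= in E0.
pose x := vproj V (f z).
have [i ix] := chart_cover x mX; have [t tx] := triv_cover vV x.
have [t' tx'] := triv_cover vV' x.
have [psi T] := triv_spec t; have [psi' T'] := triv_spec t'.
have tx2 : (sval t').1 (vproj V' (g z)) by rewrite -E0.
have sp := smooth_at_proj vV mZ sf.
have s1 := smooth_at_phi vV mZ T tx sf; have s2 := smooth_at_phi vV' mZ T' tx2 sg.
have [k kz] := chart_cover z mZ.
have [U [oU Uz HU CU]] := smooth_at_chart mZ sp kz ix.
have [U1 [oU1 U1z HU1 CU1]] := smooth_at_chart (j := tt : idx (eucl R r)) mZ s1 kz I.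
have [U2 [oU2 U2z HU2 CU2]] := smooth_at_chart (j := tt : idx (eucl R r')) mZ s2 kz I.
have nt := mnbhs_preim mZ mX sp (mnbhsI mX (mnbhs_open (triv_open T) tx)
   (mnbhs_open (triv_open T') tx')).
have [W [oW Wz HW]] := mnbhs_chart mZ (mnbhsI mZ nfg nt) kz.
pose U' := (U `&` U1) `&` (U2 `&` W).
have oU' : open U' by apply: openI; apply: openI.
apply: (@smooth_at_chartI R Z (whitney V V') _ z k (i, (t, t')) U'
  (fun y => row_mx (rep (fun z => vproj V (f z)) k i y)
    (row_mx (rep ((fun z => (sval t).2 (f z)) : Z -> eucl R r) k tt y)
       (rep ((fun z => (sval t').2 (g z)) : Z -> eucl R r') k tt y))) mZ mW kz oU').
- by split; split.
- move=> y ky [[/HU[y1 [ky1 yy1 iy1]] _] [_ /HW[y2 [ky2 yy2 [Ey [/= ty ty']]]]]].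
  rewrite (chart_inj mZ ky1 ky yy1) in iy1.
  rewrite (chart_inj mZ ky2 ky yy2) in Ey ty ty'.
  by rewrite /= wproj_wpair// wpairP//= !repE.
- apply: Coo_row_mx => //; first by apply: Coo_sub CU => y [[]].
  apply: Coo_row_mx => //; first by apply: Coo_sub CU1 => y [[]].
  by apply: Coo_sub CU2 => y [_ []].
Qed.

Lemma whitney_trivialization U phi psi U' phi' psi' :
  @trivialization R E X V U phi psi -> @trivialization R E' X V' U' phi' psi' ->
  @trivialization R (whitney V V') X (wvb V V') (U `&` U')
    (fun w => row_mx (phi (sval w).1) (phi' (sval w).2))
    (fun x y => wpair V V' (psi x (lsubmx y)) (psi' x (rsubmx y))).
Proof.
move=> T T'.
have H x y y' : (U `&` U') x -> vproj V (psi x y) = vproj V' (psi' x y').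
  by move=> [Ux U'x]; rewrite (triv_proj T)// (triv_proj T').
split.
- by apply: mopenI => //; [exact: triv_open T|exact: triv_open T'].
- move=> w [/= Uw U'w]; apply: smooth_at_row_mx => //.
    by apply: (smooth_at_phi vV mW T Uw); exact: smooth_at_wfst.
  apply: (smooth_at_phi vV' mW T'); first by rewrite -wpt_proj.
  exact: smooth_at_wsnd.
- move=> x y Ux; have mP := prodm_mfd mX (eucl_mfd (R := R) (r + r')).
  have mR := eucl_mfd (R := R) (r + r').
  have s1 := @smooth_at_fst R X (eucl R (r + r')) (x, y) mX mR.
  have s2 := @smooth_at_snd R X (eucl R (r + r')) (x, y) mX mR.
  apply: smooth_at_wpair => //.
  + by apply: (smooth_at_psi vV mP T Ux.1 s1); apply: smooth_at_lsubmx.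
  + by apply: (smooth_at_psi vV' mP T' Ux.2 s1); apply: smooth_at_rsubmx.
  + have := mnbhs_preim mP mX s1 (mnbhs_open (mopenI mX (triv_open T) (triv_open T')) Ux).
    by apply: mnbhsS => z /= Uz; apply: H.
- move=> x y Ux; rewrite /= wproj_wpair; last exact: H.
  by rewrite (triv_proj T)//; exact: Ux.1.
- move=> x y Ux; rewrite wpairP; last exact: H.
  case: Ux => Ux U'x; rewrite /=.
  by rewrite (triv_phiK T)// (triv_phiK T')// hsubmxK.
- move=> w [/= Uw U'w]; rewrite row_mxKl row_mxKr.
  rewrite /wproj (triv_psiK T)// wpt_proj (triv_psiK T') -?wpt_proj//.
  exact: wpair_eta.
- by move=> x [Ux U'x] /=; rewrite (triv0 T)// (triv0 T')// row_mx0.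
- move=> w w' [/= Uw U'w] ww'.
  have ww2 : vproj V' (sval w).2 = vproj V' (sval w').2 by rewrite -!wpt_proj.
  rewrite wpairP; last by rewrite (vproj_add vV)// (vproj_add vV')// wpt_proj.
  rewrite /= (trivD T)// (trivD T')//; last by rewrite -wpt_proj.
  by rewrite add_row_mx.
- move=> a w [/= Uw U'w].
  rewrite wpairP; last by rewrite (vproj_scale vV) (vproj_scale vV') wpt_proj.
  rewrite /= (trivZ T)// (trivZ T')//; last by rewrite -wpt_proj.
  by rewrite scale_row_mx.
Qed.

Lemma whitney_is_vb : is_vb (wvb V V').
Proof.
split=> //.
- by apply/smoothP => // w; apply: smooth_at_wproj.
- split=> [w w' ww'|a w].
    have ww2 : vproj V' (sval w).2 = vproj V' (sval w').2 by rewrite -!wpt_proj.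
    by rewrite /= wproj_wpair ?(vproj_add vV)// (vproj_add vV')// wpt_proj.
  by rewrite /= wproj_wpair ?(vproj_scale vV)// (vproj_scale vV') wpt_proj.
- move=> x; have [U [phi [psi [Ux T]]]] := triv_ex vV x.
  have [U' [phi' [psi' [Ux' T']]]] := triv_ex vV' x.
  have TT := whitney_trivialization T T'; have oW := mopen_wproj (triv_open TT).
  exists (U `&` U'), (fun w => row_mx (phi (sval w).1) (phi' (sval w).2)).
  by split=> //; apply: trivialization_is_triv TT.
Qed.

End WhitneyBundle.

Section EuclideanCurves.
Context {R : realType}.

Lemma velocity_eucl n (c : R -> eucl R n) v : velocity c v ->
  is_diff (0 : R) (c : R -> 'rV[R]_n) (fun h : R => h *: (comps v tt : 'rV[R]_n)).
Proof. by move=> [_ /(_ tt I)[_]]. Qed.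

Lemma velocity_euclI n (c : R -> 'rV[R]_n) d : is_diff (0 : R) c d ->
  exists2 v : tanm (eucl R n), velocity (c : R -> eucl R n) v & comps v tt = d 1.
Proof.
move=> Dc; apply: (@velocity_ex R (eucl R n) tt c d (eucl_mfd n)) => //.
exact: near0W.
Qed.

End EuclideanCurves.

(** * Vertical tangent vectors *)

Section Vertical.
Context {R : realType} {E X : mfd R} (V : vb E X).
Hypothesis vV : is_vb V.

Let mE : is_mfd E := vb_total_mfd vV.
Let mX : is_mfd X := vb_base_mfd vV.
Let r := vrank V.

(* [w'] is [w] plus the vertical tangent vector given by [xi]. *)
Definition vshift (w : tanm E) (xi : E) (w' : tanm E) : Prop :=
  exists c z v, [/\ velocity c w, velocity z v, z 0 = xi,
    \forall t \near (0 : R), vproj V (c t) = vproj V (z t) &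
    velocity (fun t => vadd V (c t) (vscale V t (z t))) w'].

Lemma near_triv c (w : tanm E) (U : set X) : velocity c w -> mopen U ->
  U (vproj V (foot w)) -> \forall t \near (0 : R), U (vproj V (c t)).
Proof.
move=> vc oU Uw; have nP : mnbhs (foot w) (fun e => U (vproj V e)).
  exact: mnbhs_preim mE mX (vproj_smooth_at vV _) (mnbhs_open oU Uw).
exact: velocity_near mE vc nP.
Qed.

(** Near the foot a curve is recovered from its projection and its fibre coordinate through [psi],
    so its velocity is the image of those two velocities under the tangent map of [psi]. *)
Lemma tmap_triv_uniq U phi psi (w1 w2 : tanm E) :
  @trivialization R E X V U phi psi -> U (vproj V (foot w1)) ->
  tmap (vproj V) w1 = tmap (vproj V) w2 ->
  tmap (phi : E -> eucl R r) w1 = tmap (phi : E -> eucl R r) w2 -> w1 = w2.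
Proof.
move=> T Uw E1 E2; have mR := eucl_mfd (R := R) r; have mP := prodm_mfd mX mR.
have key (w : tanm E) : U (vproj V (foot w)) ->
    w = tmap ((fun z => psi z.1 z.2) : prodm X (eucl R r) -> E)
      (tpair (tmap (vproj V) w) (tmap (phi : E -> eucl R r) w)).
  move=> Uf; have [c vc] := velocity_curve w mE.
  have v1 := velocity_tmap mE mX (vproj_smooth_at vV (foot w)) vc.
  have v2 := velocity_tmap mE mR (triv_phi_smooth T Uf) vc.
  have vp := velocity_pair mX mR v1 v2.
  apply: (velocity_uniq mE vc).
  have sp : smooth_at ((fun z => psi z.1 z.2) : prodm X (eucl R r) -> E)
      (foot (tpair (tmap (vproj V) w) (tmap (phi : E -> eucl R r) w))).
    by rewrite foot_tpair// !foot_tmap; exact: triv_psi_smooth T _ _ Uf.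
  have := velocity_tmap mP mE sp vp; apply: velocity_germ.
  have := near_triv vc (triv_open T) Uf; apply: filterS => t Ut /=.
  exact: triv_psiK T _ Ut.
have Uw2 : U (vproj V (foot w2)).
  by have := congr1 (@foot _ _) E1; rewrite !foot_tmap => <-.
by rewrite (key w1 Uw) (key w2 Uw2) E1 E2.
Qed.

Lemma vshift_foot w xi w' : vshift w xi w' ->
  vproj V xi = vproj V (foot w) /\ foot w' = foot w.
Proof.
move=> [c [z [v [vc vz z0 cz vcz]]]]; have H := nbhs_singleton cz.
rewrite z0 vc.1 in H; split; first exact: esym H.
rewrite -vcz.1 z0 vc.1 (vzero_scale vV) -H.
by rewrite (vaddr0 vV).
Qed.

Lemma vshift_proj w xi w' : vshift w xi w' ->
  tmap (vproj V) w' = tmap (vproj V) w.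
Proof.
move=> H; have [c [z [v [vc vz z0 cz vcz]]]] := H.
apply: (velocity_uniq mX (velocity_tmap mE mX (vproj_smooth_at vV _) vcz)).
apply: velocity_germ (velocity_tmap mE mX (vproj_smooth_at vV _) vc).
apply: filterS cz => t czt; rewrite (vproj_add vV)//.
by rewrite (vproj_scale vV).
Qed.

Lemma vshift_phi U phi psi w xi w' : @trivialization R E X V U phi psi ->
  U (vproj V (foot w)) -> vshift w xi w' ->
  comps (tmap (phi : E -> eucl R r) w') tt =
  comps (tmap (phi : E -> eucl R r) w) tt + phi xi :> 'rV[R]_r.
Proof.
move=> T Uw H; have [xw w'w] := vshift_foot H.
have mR := eucl_mfd (R := R) r.
have [c [z [v [vc vz z0 cz vcz]]]] := H.
have Uw' : U (vproj V (foot w')) by rewrite w'w.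
have Uz : U (vproj V (foot v)) by rewrite -vz.1 z0 xw.
have D1 := velocity_eucl (velocity_tmap mE mR (triv_phi_smooth T Uw) vc).
have D2 := velocity_eucl (velocity_tmap mE mR (triv_phi_smooth T Uz) vz).
have D3 := velocity_eucl (velocity_tmap mE mR (triv_phi_smooth T Uw') vcz).
have D4 := is_diffD D1 (is_diffZZ (is_diff_id (0 : R)) D2).
have E1 : \forall t \near (0 : R),
    ((fun t => phi (c t)) + (fun t => t *: phi (z t))) t =
    phi (vadd V (c t) (vscale V t (z t))).
  have nU := near_triv vc (triv_open T) Uw.
  apply: filterS2 cz nU => t czt Ut.
  rewrite (trivD T)//; last by rewrite (vproj_scale vV).
  by rewrite (trivZ T) -?czt.
have D5 := is_diff_germ E1 D4.
have := is_diff_uniq D3 D5 => /(congr1 (fun h : R -> 'rV[R]_r => h 1)) E2.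
(* In the product rule for [t *: phi (z t)] at [t = 0] the derivative of [z] is multiplied by 0 and
   only [phi xi] remains. *)
have {}E2 : 1 *: comps (tmap (phi : E -> eucl R r) w') tt =
    1 *: comps (tmap (phi : E -> eucl R r) w) tt +
    (0 *: (1 *: comps (tmap (phi : E -> eucl R r) v) tt) + 1 *: phi (z 0)).
  exact: E2.
move: E2; rewrite z0.
move: (comps (tmap (phi : E -> eucl R r) w') tt)
  (comps (tmap (phi : E -> eucl R r) w) tt)
  (comps (tmap (phi : E -> eucl R r) v) tt) (phi xi) => A B C D.
by rewrite scale0r add0r !scale1r.
Qed.

Lemma tmap_phi_eq U phi psi (w1 w2 : tanm E) :
  @trivialization R E X V U phi psi -> U (vproj V (foot w1)) ->
  foot w1 = foot w2 -> tmap (vproj V) w1 = tmap (vproj V) w2 ->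
  comps (tmap (phi : E -> eucl R r) w1) tt =
    comps (tmap (phi : E -> eucl R r) w2) tt -> w1 = w2.
Proof.
move=> T Uw F E1 E2; apply: (tmap_triv_uniq T Uw E1).
by apply: (@tvec_eq R (eucl R r) tt) => //; rewrite !foot_tmap F.
Qed.

(** The curve through [xi] has the constant fibre coordinate [phi xi] over the projection of [c].
    Adding [t] times this curve adds [t *: phi xi] to the fibre coordinate; this operation is smooth
    on [E x R^r], so the sum has a velocity. *)
Lemma vshift_ex w xi : vproj V xi = vproj V (foot w) ->
  exists w', vshift w xi w'.
Proof.
move=> xw; have [U [phi [psi [Uw T]]]] := triv_ex vV (vproj V (foot w)).
have mR := eucl_mfd (R := R) r; have mP := prodm_mfd mE mR.
have [c vc] := velocity_curve w mE.
pose f e := psi (vproj V e) (phi xi).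
have sf : smooth_at f (foot w).
  apply: (smooth_at_psi vV mE T Uw); first exact: vproj_smooth_at.
  exact: smooth_at_cst.
have vz := velocity_tmap mE mE sf vc.
have [l vl _] := velocity_euclI (is_diff_scalel (0 : R) (phi xi)).
pose g (z : prodm E (eucl R r)) := psi (vproj V z.1) (phi z.1 + z.2).
have vp := velocity_pair mE mR vc vl.
have sg : smooth_at g (foot (tpair w l)).
  rewrite foot_tpair//.
  have s1 := @smooth_at_fst R E (eucl R r) (foot w, foot l) mE mR.
  have s2 := @smooth_at_snd R E (eucl R r) (foot w, foot l) mE mR.
  apply: (smooth_at_psi vV mP T Uw); first exact: smooth_at_proj.
  by apply: smooth_at_addv => //; apply: (smooth_at_phi vV mP T Uw s1).
have nU := near_triv vc (triv_open T) Uw.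
exists (tmap g (tpair w l)), c, (fun t => f (c t)), (tmap f w); split=> //.
- by rewrite /f vc.1 -xw (triv_psiK T) // xw.
- by apply: filterS nU => t Ut; rewrite /f (triv_proj T).
- have := velocity_tmap mP mE sg vp; apply: velocity_germ.
  apply: filterS nU => t Ut; rewrite /g /f /=.
  have P1 : vproj V (vscale V t (psi (vproj V (c t)) (phi xi))) = vproj V (c t).
    by rewrite (vproj_scale vV) (triv_proj T).
  apply: (triv_inj T); rewrite ?(triv_proj T)//; first by rewrite (vproj_add vV).
  have U1 : U (vproj V (psi (vproj V (c t)) (phi xi))) by rewrite (triv_proj T).
  rewrite (triv_phiK T)// (trivD T Ut) ?P1//.
  by rewrite (trivZ T)// (triv_phiK T).
Qed.

Lemma vshift_uniq w xi w1 w2 : vshift w xi w1 -> vshift w xi w2 -> w1 = w2.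
Proof.
move=> H1 H2; have [U [phi [psi [Uw T]]]] := triv_ex vV (vproj V (foot w)).
have [_ F1] := vshift_foot H1; have [_ F2] := vshift_foot H2.
apply: (tmap_phi_eq T); rewrite ?F1 ?F2//.
  by rewrite (vshift_proj H1) (vshift_proj H2).
by rewrite (vshift_phi T Uw H1) (vshift_phi T Uw H2).
Qed.

Lemma vshift_inj w xi1 xi2 w' : vshift w xi1 w' -> vshift w xi2 w' -> xi1 = xi2.
Proof.
move=> H1 H2; have [U [phi [psi [Uw T]]]] := triv_ex vV (vproj V (foot w)).
have [P1 _] := vshift_foot H1; have [P2 _] := vshift_foot H2.
apply: (triv_inj T); rewrite ?P1 ?P2//.
have := vshift_phi T Uw H1; rewrite (vshift_phi T Uw H2).
by move=> /addrI.
Qed.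

Lemma vshift_of_proj w1 w2 : foot w1 = foot w2 ->
  tmap (vproj V) w1 = tmap (vproj V) w2 -> exists xi, vshift w1 xi w2.
Proof.
move=> F E1; have [U [phi [psi [Uw T]]]] := triv_ex vV (vproj V (foot w1)).
pose y : 'rV[R]_r := comps (tmap (phi : E -> eucl R r) w2) tt -
  comps (tmap (phi : E -> eucl R r) w1) tt.
have P : vproj V (psi (vproj V (foot w1)) y) = vproj V (foot w1).
  by rewrite (triv_proj T).
have [w' Hw] := vshift_ex P; exists (psi (vproj V (foot w1)) y).
have [_ F'] := vshift_foot Hw.
suff <- : w' = w2 by [].
apply: (tmap_phi_eq T); rewrite ?F'//; first by rewrite (vshift_proj Hw).
rewrite (vshift_phi T Uw Hw) (triv_phiK T)// /y.
by rewrite addrC subrK.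
Qed.

Lemma vshiftD w xi w1 xi' w2 : vshift w xi w1 -> vshift w1 xi' w2 ->
  vshift w (vadd V xi xi') w2.
Proof.
move=> H1 H2; have [U [phi [psi [Uw T]]]] := triv_ex vV (vproj V (foot w)).
have [P1 F1] := vshift_foot H1; have [P2 F2] := vshift_foot H2.
have P12 : vproj V xi = vproj V xi' by rewrite P1 P2 F1.
have P : vproj V (vadd V xi xi') = vproj V (foot w) by rewrite (vproj_add vV).
have [w' Hw] := vshift_ex P; have [_ F'] := vshift_foot Hw.
suff <- : w' = w2 by [].
apply: (tmap_phi_eq T); rewrite ?F' ?F2 ?F1//.
  by rewrite (vshift_proj Hw) (vshift_proj H2) (vshift_proj H1).
have Uw1 : U (vproj V (foot w1)) by rewrite F1.
rewrite (vshift_phi T Uw Hw) (vshift_phi T Uw1 H2) (vshift_phi T Uw H1).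
have Uxi : U (vproj V xi) by rewrite P1.
by rewrite (trivD T Uxi P12) addrA.
Qed.

Lemma tmap_vproj_surj e (u : tanm X) : foot u = vproj V e ->
  exists2 w : tanm E, foot w = e & tmap (vproj V) w = u.
Proof.
move=> ue; have [U [phi [psi [Ue T]]]] := triv_ex vV (vproj V e).
have sf : smooth_at (fun x => psi x (phi e)) (foot u).
  apply: (smooth_at_psi vV mX T); rewrite ?ue//; first exact: smooth_at_id.
  by apply: smooth_at_cst => //; exact: eucl_mfd.
exists (tmap (fun x => psi x (phi e)) u).
  by rewrite foot_tmap ue (triv_psiK T).
rewrite -(tmap_comp (g := vproj V) mX mE mX)//; last exact: vproj_smooth_at.
rewrite -[RHS](tmap_id u mX); apply/esym/tmap_germ => //; last exact: smooth_at_id.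
exists U; split; [exact: triv_open T|by rewrite ue|].
by move=> x Ux /=; rewrite (triv_proj T).
Qed.

End Vertical.

Section VerticalMaps.
Context {R : realType} {E X E' X' : mfd R} (V : vb E X) (V' : vb E' X').
Hypotheses (vV : is_vb V) (vV' : is_vb V').
Context (F : E -> E') (f : X -> X').
Hypothesis Ff : vb_map V V' F f.

Let mE : is_mfd E := vb_total_mfd vV.
Let mX : is_mfd X := vb_base_mfd vV.
Let mE' : is_mfd E' := vb_total_mfd vV'.
Let mX' : is_mfd X' := vb_base_mfd vV'.

(** Fibrewise linearity turns the curve [c + t z] defining the shift into [F c + t F z]. *)
Lemma vshift_map w xi w' : vshift V w xi w' ->
  vshift V' (tmap F w) (F xi) (tmap F w').
Proof.
move=> [c [z [v [vc vz z0 cz vcz]]]].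
have sF e : smooth_at F e by exact: (vb_map_smooth_at vV Ff).
exists (fun t => F (c t)), (fun t => F (z t)), (tmap F v); split.
- exact: velocity_tmap mE mE' (sF _) vc.
- exact: velocity_tmap mE mE' (sF _) vz.
- by rewrite z0.
- by apply: filterS cz => t czt; rewrite !(vb_map_proj Ff) czt.
- have := velocity_tmap mE mE' (sF _) vcz; apply: velocity_germ.
  apply: filterS cz => t czt; rewrite (vb_mapD Ff) ?(vb_mapZ Ff)//.
  by rewrite (vproj_scale vV).
Qed.

Lemma tmap_vb_map_proj (w : tanm E) :
  tmap (vproj V') (tmap F w) = tmap f (tmap (vproj V) w).
Proof.
have sF := vb_map_smooth_at vV Ff (foot w).
have sf := vb_map_base_smooth_at vV Ff (vproj V (foot w)).
rewrite -(tmap_comp (g := vproj V') mE mE' mX')//; last exact: vproj_smooth_at.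
rewrite -(tmap_comp (g := f) mE mX mX')//; last exact: vproj_smooth_at.
by congr tmap; apply/funext => e; rewrite (vb_map_proj Ff).
Qed.

Lemma vb_map_submersion :
  (forall (x : X) (w : tanm X'), foot w = f x ->
     exists2 v : tanm X, foot v = x & tmap f v = w) ->
  (forall x e', vproj V' e' = f x -> exists2 e, vproj V e = x & F e = e') ->
  submersion F.
Proof.
move=> sf sF; split; first by case: Ff.
move=> e w we.
have [|a ae aw] := sf (vproj V e) (tmap (vproj V') w).
  by rewrite foot_tmap we (vb_map_proj Ff).
have [v0 v0e v0a] := tmap_vproj_surj vV ae.
have [||xi' Hxi'] := @vshift_of_proj _ _ _ _ vV' (tmap F v0) w.
- by rewrite foot_tmap v0e.
- by rewrite tmap_vb_map_proj v0a.
have [xi'p _] := vshift_foot vV' Hxi'.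
have [|xi xie xiF] := sF (vproj V e) xi'.
  by rewrite xi'p foot_tmap v0e (vb_map_proj Ff).
have [|v Hv] := @vshift_ex _ _ _ _ vV v0 xi; first by rewrite xie v0e.
exists v; first by rewrite (vshift_foot vV Hv).2.
by have := vshift_map Hv; rewrite xiF => /(vshift_uniq vV'); apply.
Qed.

End VerticalMaps.

(** * Submersions from fibre products of vector bundles *)

Section FibreProductSubmersion.
Context {R : realType} {E X E' X' B Y : mfd R}.
Context (V : vb E X) (V' : vb E' X') (W : vb B Y).
Hypotheses (vV : is_vb V) (vV' : is_vb V') (vW : is_vb W).
Context (S T : E -> B) (s t : X -> Y) (P : E' -> B) (p : X' -> Y).
Hypotheses (Ss : vb_map V W S s) (Tt : vb_map V W T t) (Pp : vb_map V' W P p).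

(** Lifting a solution on the base gives vectors [v0] and [v0'] that miss the two equations by
    vertical vectors: [b1] for the matching of [S] and [P], and [b2] for the value of [T]. The
    second hypothesis removes both errors at once through vertical shifts [xi] and [xi']. *)
Lemma vb_fibre_product_submersion e e' (w : tanm B) :
  (forall u : tanm Y, foot u = t (vproj V e) ->
    exists (a : tanm X) (b : tanm X'), [/\ foot a = vproj V e,
      foot b = vproj V' e', tmap s a = tmap p b & tmap t a = u]) ->
  (forall b1 b2, vproj W b1 = s (vproj V e) -> vproj W b2 = t (vproj V e) ->
    exists xi xi', [/\ vproj V xi = vproj V e, vproj V' xi' = vproj V' e',
      S xi = vadd W b1 (P xi') & T xi = b2]) ->
  S e = P e' -> foot w = T e ->
  exists (v : tanm E) (v' : tanm E'), [/\ foot v = e, foot v' = e',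
    tmap S v = tmap P v' & tmap T v = w].
Proof.
move=> base fib SP we.
have [|a [b [ae be ab aw]]] := base (tmap (vproj W) w).
  by rewrite foot_tmap we (vb_map_proj Tt).
have [v0 v0e v0a] := tmap_vproj_surj vV ae.
have [v0' v0e' v0b] := tmap_vproj_surj vV' be.
have [||b1 H1] := @vshift_of_proj _ _ _ _ vW (tmap S v0) (tmap P v0').
- by rewrite !foot_tmap v0e v0e'.
- by rewrite (tmap_vb_map_proj vV vW Ss) (tmap_vb_map_proj vV' vW Pp) v0a v0b.
have [||b2 H2] := @vshift_of_proj _ _ _ _ vW (tmap T v0) w.
- by rewrite !foot_tmap v0e.
- by rewrite (tmap_vb_map_proj vV vW Tt) v0a.
have [P1 _] := vshift_foot vW H1; have [P2 _] := vshift_foot vW H2.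
have [||xi [xi' [xie xie' Sxi Txi]]] := fib b1 b2.
- by rewrite P1 foot_tmap v0e (vb_map_proj Ss).
- by rewrite P2 foot_tmap v0e (vb_map_proj Tt).
have [|v Hv] := @vshift_ex _ _ _ _ vV v0 xi; first by rewrite xie v0e.
have [|v' Hv'] := @vshift_ex _ _ _ _ vV' v0' xi'; first by rewrite xie' v0e'.
exists v, v'; split.
- by rewrite (vshift_foot vV Hv).2.
- by rewrite (vshift_foot vV' Hv').2.
- have H3 := vshiftD vW H1 (vshift_map vV' vW Pp Hv').
  by have := vshift_map vV vW Ss Hv; rewrite Sxi => /(vshift_uniq vW); apply.
- by have := vshift_map vV vW Tt Hv; rewrite Txi => /(vshift_uniq vW); apply.
Qed.

End FibreProductSubmersion.

(** * Line bundles *)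

Section LineBundles.
Context {R : realType} {E X E' X' : mfd R} (V : vb E X) (V' : vb E' X').
Hypotheses (vV : is_vb V) (vV' : is_vb V').
Hypotheses (rV : vrank V = 1%N) (rV' : vrank V' = 1%N).
Context (F : E -> E') (f : X -> X').
Hypothesis Ff : vb_map V V' F f.

Let mE : is_mfd E := vb_total_mfd vV.
Let mX : is_mfd X := vb_base_mfd vV.
Let mE' : is_mfd E' := vb_total_mfd vV'.
Let mX' : is_mfd X' := vb_base_mfd vV'.

(** The rank equals 1 only propositionally. The sum of the entries serves as the single coordinate
    and [one] as the basis vector, which avoids casts between types of row vectors. *)
Let tot n (v : 'rV[R]_n) : R := \sum_i v 0 i.
Let one n : 'rV[R]_n := const_mx 1.

Let totE n (v : 'rV[R]_n) : n = 1%N -> v = tot v *: one n.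
Proof.
move=> n1; subst n; apply/rowP => i.
by rewrite /tot big_ord1 !mxE mulr1 (ord1 i).
Qed.

Let totZ n c (v : 'rV[R]_n) : tot (c *: v) = c * tot v.
Proof. by rewrite /tot mulr_sumr; apply: eq_bigr => i _; rewrite mxE. Qed.

Let tot_one n : n = 1%N -> tot (one n) = 1.
Proof. by move=> n1; subst n; rewrite /tot big_ord1 mxE. Qed.

Let scale_tot n (a b : 'rV[R]_n) : n = 1%N -> tot a != 0 ->
  (tot b / tot a) *: a = b.
Proof.
move=> n1 a0; rewrite {2}(totE a n1) scalerA divfK//.
by rewrite -totE.
Qed.

Let one_neq0 n : n = 1%N -> one n != 0.
Proof.
move=> n1; subst n; apply/eqP => /rowP/(_ 0); rewrite !mxE => /eqP.
by rewrite oner_eq0.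
Qed.

Let F_triv U phi psi U' phi' psi' x y :
  @trivialization R E X V U phi psi -> @trivialization R E' X' V' U' phi' psi' ->
  U x -> U' (f x) ->
  phi' (F (psi x y)) = tot y *: phi' (F (psi x (one _))).
Proof.
move=> T T' Ux U'x.
have -> : psi x y = vscale V (tot y) (psi x (one _)).
  apply: (triv_inj T); rewrite ?(vproj_scale vV) ?(triv_proj T)//.
  by rewrite (triv_phiK T)// (trivZ T) ?(triv_proj T)// (triv_phiK T)// -totE.
by rewrite (vb_mapZ Ff) (trivZ T')// (vb_map_proj Ff) (triv_proj T).
Qed.

(** In trivializations [F] sends [y] to [tot y] times the image of the basis vector, and this image
    is nonzero as soon as some nonzero vector is attained. *)
Lemma line_surj_inj x :
  (forall e', vproj V' e' = f x -> exists2 e, vproj V e = x & F e = e') ->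
  forall e1 e2, vproj V e1 = x -> vproj V e2 = x -> F e1 = F e2 -> e1 = e2.
Proof.
move=> surj e1 e2 E1 E2 H.
have [U [phi [psi [Ux T]]]] := triv_ex vV x.
have [U' [phi' [psi' [Ux' T']]]] := triv_ex vV' (f x).
have [|e ex eF] := surj (psi' (f x) (one _)); first by rewrite (triv_proj T').
have A0 : phi' (F (psi x (one _))) != 0.
  apply/eqP => A0; have := one_neq0 rV'; rewrite -(triv_phiK T' (one _) Ux').
  rewrite -eF -(triv_psiK T (e := e)) ?ex//.
  by rewrite (F_triv _ T T')// A0 scaler0 eqxx.
have := congr1 phi' H.
rewrite -(triv_psiK T (e := e1)) ?E1// -(triv_psiK T (e := e2)) ?E2//.
rewrite (F_triv (phi e1) T T')// (F_triv (phi e2) T T')// => /eqP.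
rewrite -subr_eq0 -scalerBl scaler_eq0 (negPf A0) orbF subr_eq0 => /eqP E3.
by rewrite (totE (phi e1) rV) (totE (phi e2) rV) E3.
Qed.

(** Injectivity makes the image of the basis vector nonzero; dividing by its coordinate gives the
    preimage. *)
Lemma line_inj_surj x :
  (forall e1 e2, vproj V e1 = x -> vproj V e2 = x -> F e1 = F e2 -> e1 = e2) ->
  forall e', vproj V' e' = f x -> exists2 e, vproj V e = x & F e = e'.
Proof.
move=> inj e' e'x.
have [U [phi [psi [Ux T]]]] := triv_ex vV x.
have [U' [phi' [psi' [Ux' T']]]] := triv_ex vV' (f x).
have A0 : tot (phi' (F (psi x (one _)))) != 0.
  apply/eqP => A0; have := one_neq0 rV.
  suff : psi x (one _) = vzero V x.
    by move=> /(congr1 phi); rewrite (triv_phiK T)// (triv0 T)// => ->; rewrite eqxx.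
  apply: inj; rewrite ?(triv_proj T) ?vzeroK// (vb_map0 vV vV' Ff).
  apply: (triv_inj T'); rewrite ?(vb_map_proj Ff) ?(triv_proj T) ?vzeroK//.
  by rewrite (triv0 T')// (totE (phi' _) rV') A0 scale0r.
exists (psi x ((tot (phi' e') / tot (phi' (F (psi x (one _))))) *: one _)).
  by rewrite (triv_proj T).
have P : vproj V' (F (psi x ((tot (phi' e') /
    tot (phi' (F (psi x (one _))))) *: one _))) = f x.
  by rewrite (vb_map_proj Ff) (triv_proj T).
apply: (triv_inj T'); rewrite ?P//.
by rewrite (F_triv _ T T')// totZ tot_one// mulr1 scale_tot.
Qed.

Hypothesis Finj : forall e1 e2, vproj V e1 = vproj V e2 -> F e1 = F e2 -> e1 = e2.

Lemma line_surj e' x : vproj V' e' = f x -> exists2 e, vproj V e = x & F e = e'.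
Proof.
by apply: line_inj_surj => e1 e2 E1 E2; apply: Finj; rewrite E1 E2.
Qed.

Lemma fibinvP x y : vproj V' y = f x ->
  vproj V (fibinv V F x y) = x /\ F (fibinv V F x y) = y.
Proof.
move=> /line_surj[e ex ey].
by apply: (@theP _ _ [set e | vproj V e = x /\ F e = y]); exists e.
Qed.

Lemma fibinv_uniq x y e : vproj V e = x -> F e = y -> fibinv V F x y = e.
Proof.
move=> ex ey; apply: the_uniq; first by split.
by move=> e' [e'x e'y]; apply: Finj; rewrite ?e'x ?ex// e'y ey.
Qed.

(** [fibinv] is meaningful on pairs with [vproj V' y = f x], a condition that is not open in
    general. The quotient of the coordinates of [y] and of the image of the basis vector makes sense
    for all nearby pairs and agrees with [fibinv] on the meaningful ones. Such an extension serves
    maps for which the condition holds only on a fibre product. *)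
Lemma fibinv_local_ext x0 y0 : vproj V' y0 = f x0 ->
  exists2 J : prodm X E' -> E, smooth_at J (x0, y0) &
    mnbhs ((x0, y0) : prodm X E') (fun z => vproj V (J z) = z.1 /\
      (vproj V' z.2 = f z.1 -> F (J z) = z.2)).
Proof.
move=> yx; have mP := prodm_mfd mX mE'.
have [U [phi [psi [Ux T]]]] := triv_ex vV x0.
have [U' [phi' [psi' [Ux' T']]]] := triv_ex vV' (f x0).
pose a x := phi' (F (psi x (one _))).
have A0 x : U x -> U' (f x) -> tot (a x) != 0.
  move=> Uxx U'x; apply/eqP => A0; have := one_neq0 rV.
  suff : psi x (one _) = vzero V x.
    by move=> /(congr1 phi); rewrite (triv_phiK T)// (triv0 T)// => ->; rewrite eqxx.
  apply: Finj; rewrite ?(triv_proj T) ?vzeroK// (vb_map0 vV vV' Ff).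
  apply: (triv_inj T'); rewrite ?(vb_map_proj Ff) ?(triv_proj T) ?vzeroK//.
  by rewrite (triv0 T')// (totE (phi' _) rV') A0 scale0r.
pose h (u v : 'rV[R]_(vrank V')) : 'rV[R]_(vrank V) := (tot v / tot u) *: one _.
exists (fun z => psi z.1 (h (a z.1) (phi' z.2))).
  have s1 := @smooth_at_fst R X E' (x0, y0) mX mE'.
  have s2 := @smooth_at_snd R X E' (x0, y0) mX mE'.
  apply: (smooth_at_psi vV mP T Ux s1).
  have sa : smooth_at ((fun z : prodm X E' => a z.1)
      : prodm X E' -> eucl R (vrank V')) (x0, y0).
    apply: (smooth_at_phi vV' mP T').
      by rewrite (vb_map_proj Ff) (triv_proj T).
    apply: (@smooth_at_comp R (prodm X E') E E' (fun z => psi z.1 (one _)) F _ mP mE mE').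
      apply: (smooth_at_psi vV mP T Ux s1).
      by apply: smooth_at_cst => //; exact: eucl_mfd.
    exact: (vb_map_smooth_at vV Ff).
  have sp : smooth_at ((fun z : prodm X E' => phi' z.2)
      : prodm X E' -> eucl R (vrank V')) (x0, y0).
    by apply: (smooth_at_phi vV' mP T' _ s2); rewrite /= yx.
  have Ctot n (U0 : set 'rV[R]_n) : open U0 -> Coo U0 (@tot n).
    by move=> oU0; apply: Coo_sum => // i; apply: Coo_coord.
  have CtotL n m (U0 : set 'rV[R]_(n + m)) : open U0 -> Coo U0 (fun x => tot (lsubmx x)).
    move=> oU0; apply: (Coo_comp (U' := setT) oU0 (fun _ _ => I)).
      exact: Coo_lsubmx.
    exact: Ctot openT.
  have CtotR n m (U0 : set 'rV[R]_(n + m)) : open U0 -> Coo U0 (fun x => tot (rsubmx x)).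
    move=> oU0; apply: (Coo_comp (U' := setT) oU0 (fun _ _ => I)).
      exact: Coo_rsubmx.
    exact: Ctot openT.
  have on0 : open [set c : R | c != 0].
    exact: open_neq.
  have oU := Coo_open_preim openT (CtotL (vrank V') (vrank V') _ openT) on0.
  apply: (smooth_at_eucl_comp2 (h := h) mP sa sp oU).
    by split=> //=; rewrite row_mxKl; apply: A0.
  rewrite /h; apply: Coo_scale => //; last exact: Coo_cst.
  apply: Coo_scale => //; first exact: CtotR.
  by apply: Coo_inv => //; [move=> x []|exact: CtotL].
have sf := vb_map_base_smooth_at vV Ff x0.
have n1 := mnbhs_preim mX mX' sf (mnbhs_open (triv_open T') Ux').
have n2 := mnbhsI mX (mnbhs_open (triv_open T) Ux) n1.
have := mnbhs_preim mP mX (@smooth_at_fst R X E' (x0, y0) mX mE') n2.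
apply: mnbhsS => -[x y] [/= Uxx U'x]; split; first by rewrite (triv_proj T).
move=> yx'; apply: (triv_inj T').
- by rewrite (vb_map_proj Ff) (triv_proj T).
- by rewrite (vb_map_proj Ff) (triv_proj T).
by rewrite (F_triv _ T T')// /h totZ tot_one// mulr1 scale_tot// A0.
Qed.

Lemma smooth_at_fibinv (Z : mfd R) (g : Z -> X) (k : Z -> E') z : is_mfd Z ->
  smooth_at g z -> smooth_at k z -> mnbhs z (fun z => vproj V' (k z) = f (g z)) ->
  smooth_at (fun z => fibinv V F (g z) (k z)) z.
Proof.
move=> mZ sg sk nk; have mP := prodm_mfd mX mE'.
have [J sJ nJ] := fibinv_local_ext (mnbhs_singleton nk).
have sp := smooth_at_pair mZ mX mE' sg sk.
apply: (smooth_at_germ (f := fun z => J (g z, k z)) mZ mE).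
  have := mnbhsI mZ nk (mnbhs_preim mZ mP sp nJ).
  by apply: mnbhsS => y [ky [/= J1 J2]]; apply/esym/fibinv_uniq => //; apply: J2.
exact: (@smooth_at_comp R Z (prodm X E') E (fun z => (g z, k z)) J z mZ mP mE).
Qed.

End LineBundles.

Lemma mnbhsW {R : realType} (X : mfd R) (p : X) (P : set X) : is_mfd X ->
  (forall q, P q) -> mnbhs p P.
Proof. by move=> mX HP; apply: mnbhsS (mnbhsT p mX) => q _; apply: HP. Qed.

(** * Surjectivity on fibres deduced along the zero section *)

Section FibreSurjectivity.
Context {R : realType} {E X E' X' : mfd R} (V : vb E X) (V' : vb E' X').
Hypotheses (vV : is_vb V) (vV' : is_vb V').
Context (F : E -> E') (f : X -> X').
Hypothesis Ff : vb_map V V' F f.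

Let mE : is_mfd E := vb_total_mfd vV.
Let mX : is_mfd X := vb_base_mfd vV.
Let mE' : is_mfd E' := vb_total_mfd vV'.
Let mX' : is_mfd X' := vb_base_mfd vV'.

Lemma tmap_vproj_vzero (a : tanm X) : tmap (vproj V) (tmap (vzero V) a) = a.
Proof.
rewrite -(tmap_comp (g := vproj V) mX mE mX); [|exact: smooth_at_vzero|exact: vproj_smooth_at].
rewrite -[RHS](tmap_id a mX); congr tmap; apply/funext => x; exact: vzeroK.
Qed.

Lemma tmap_map_vzero (a : tanm X) :
  tmap F (tmap (vzero V) a) = tmap (vzero V') (tmap f a).
Proof.
have sF := vb_map_smooth_at vV Ff; have sf := vb_map_base_smooth_at vV Ff.
rewrite -(tmap_comp (g := F) mX mE mE')//; last exact: smooth_at_vzero.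
rewrite -(tmap_comp (g := vzero V') mX mX' mE')//; last exact: smooth_at_vzero.
by congr tmap; apply/funext => x; rewrite (vb_map0 vV vV' Ff).
Qed.

Lemma vshift_vzero x (v : tanm E) : foot v = vzero V x ->
  exists xi, vshift V (tmap (vzero V) (tmap (vproj V) v)) xi v.
Proof.
move=> vx; apply: (vshift_of_proj vV); first by rewrite !foot_tmap vx vzeroK.
by rewrite tmap_vproj_vzero.
Qed.

(** A preimage [v] of the vertical vector given by [e'] need not be vertical. At a zero vector it
    splits into a vector tangent to the zero section and a vertical one given by [xi]. The tangent
    map of [F] respects this splitting and kills the first part, since the projection of the given
    vector is zero; comparing vertical parts gives [F xi = e']. *)
Lemma submersion_fibre_surj x e' : submersion F -> vproj V' e' = f x ->
  exists2 e, vproj V e = x & F e = e'.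
Proof.
move=> [_ subF] e'x.
have [|w' Hw'] := @vshift_ex _ _ _ _ vV' (tzero (vzero V' (f x)) : tanm E') e'.
  by rewrite e'x vzeroK.
have [_ Fw'] := vshift_foot vV' Hw'.
have [|v vx vw'] := subF (vzero V x) w'; first by rewrite Fw' (vb_map0 vV vV' Ff).
have [xi Hxi] := vshift_vzero vx.
have [xip _] := vshift_foot vV Hxi.
exists xi; first by rewrite xip !foot_tmap vx !vzeroK.
have := vshift_map vV vV' Ff Hxi; rewrite vw' tmap_map_vzero.
rewrite -(tmap_vb_map_proj vV vV' Ff) vw' (vshift_proj vV' Hw').
rewrite (tmap_tzero mE' mX' (vproj_smooth_at vV' _)) vzeroK.
rewrite (tmap_tzero mX' mE' (smooth_at_vzero vV' _)) => H.
exact: (vshift_inj vV' H Hw').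
Qed.

End FibreSurjectivity.

Section FibreProductFibre.
Context {R : realType} {E X E' X' B Y : mfd R}.
Context (V : vb E X) (V' : vb E' X') (W : vb B Y).
Hypotheses (vV : is_vb V) (vV' : is_vb V') (vW : is_vb W).
Context (S T : E -> B) (s t : X -> Y) (P : E' -> B) (p : X' -> Y).
Hypotheses (Ss : vb_map V W S s) (Tt : vb_map V W T t) (Pp : vb_map V' W P p).

(** The same splitting along the zero sections, now for a pair of vectors: the vertical parts of the
    two equations between tangent vectors are the two equations between fibre elements. *)
Lemma vb_fibre_product_fibre_surj x x' b :
  (forall w : tanm B, foot w = T (vzero V x) ->
    exists (v : tanm E) (v' : tanm E'), [/\ foot v = vzero V x,
      foot v' = vzero V' x', tmap S v = tmap P v' & tmap T v = w]) ->
  vproj W b = t x ->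
  exists xi xi', [/\ vproj V xi = x, vproj V' xi' = x', S xi = P xi' & T xi = b].
Proof.
move=> H bx; have mB := vb_total_mfd vW; have mY := vb_base_mfd vW.
have [|w' Hw'] := @vshift_ex _ _ _ _ vW (tzero (vzero W (t x)) : tanm B) b.
  by rewrite bx vzeroK.
have [_ Fw'] := vshift_foot vW Hw'.
have [|v [v' [vx vx' Sv Tv]]] := H w'; first by rewrite Fw' (vb_map0 vV vW Tt).
have [xi Hxi] := vshift_vzero vV vx; have [xi' Hxi'] := vshift_vzero vV' vx'.
have [xip _] := vshift_foot vV Hxi; have [xip' _] := vshift_foot vV' Hxi'.
exists xi, xi'; split.
- by rewrite xip !foot_tmap vx !vzeroK.
- by rewrite xip' !foot_tmap vx' !vzeroK.
- have := vshift_map vV vW Ss Hxi; have := vshift_map vV' vW Pp Hxi'.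
  rewrite (tmap_map_vzero vV vW Ss) (tmap_map_vzero vV' vW Pp).
  rewrite -(tmap_vb_map_proj vV vW Ss) -(tmap_vb_map_proj vV' vW Pp) Sv => H1 H2.
  exact: (vshift_inj vW H2 H1).
- have := vshift_map vV vW Tt Hxi; rewrite (tmap_map_vzero vV vW Tt).
  rewrite -(tmap_vb_map_proj vV vW Tt) Tv (vshift_proj vW Hw').
  rewrite (tmap_tzero mB mY (vproj_smooth_at vW _)) vzeroK.
  rewrite (tmap_tzero mY mB (smooth_at_vzero vW _)) => H1.
  exact: (vshift_inj vW H1 Hw').
Qed.

End FibreProductFibre.

Section WhitneySums.
Context {R : realType} {E E' X : mfd R} (V : vb E X) (V' : vb E' X).
Hypotheses (vV : is_vb V) (vV' : is_vb V').

Lemma sval_wadd (w w' : whitney V V') : wproj w = wproj w' ->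
  sval (vadd (wvb V V') w w') =
  (vadd V (sval w).1 (sval w').1, vadd V' (sval w).2 (sval w').2).
Proof.
move=> H; have H' : vproj V' (sval w).2 = vproj V' (sval w').2 by rewrite -!wpt_proj.
by rewrite wpairP// (vproj_add vV)// (vproj_add vV')// wpt_proj.
Qed.

Lemma sval_wscale a (w : whitney V V') :
  sval (vscale (wvb V V') a w) = (vscale V a (sval w).1, vscale V' a (sval w).2).
Proof. by rewrite wpairP// (vproj_scale vV) (vproj_scale vV') wpt_proj. Qed.

End WhitneySums.

(** * Line bundle groupoids and multiplicative forms *)

Section VBGroupoids.
Context {R : realType} (L : vbg R).
Hypothesis vL : is_vbg L.

Lemma vbg_lie : is_liegpd (vgpd L). Proof. by case: vL => -[]. Qed.
Lemma vbg_base_lie : is_liegpd (bgpd L). Proof. by case: vL => -[]. Qed.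
Lemma vbg_varr : is_vb (varr L). Proof. by case: vL => _ []. Qed.
Lemma vbg_vobj : is_vb (vobj L). Proof. by case: vL => _ []. Qed.
Lemma vbg_src : vb_map (varr L) (vobj L) (@gsrc R (vgpd L)) (@gsrc R (bgpd L)).
Proof. by case: vL => _ _ []. Qed.
Lemma vbg_tgt : vb_map (varr L) (vobj L) (@gtgt R (vgpd L)) (@gtgt R (bgpd L)).
Proof. by case: vL => _ _ []. Qed.
Lemma vbg_unt : vb_map (vobj L) (varr L) (@gunt R (vgpd L)) (@gunt R (bgpd L)).
Proof. by case: vL => _ _ _ []. Qed.
Lemma vbg_mul_proj (e e' : arr (vgpd L)) : gsrc e = gtgt e' ->
  vproj (varr L) (gmul e e') = gmul (vproj (varr L) e) (vproj (varr L) e').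
Proof. by case: vL => _ _ _ _ [+ _ _]; apply. Qed.

Lemma vbg_src_surj g y : vproj (vobj L) y = gsrc g ->
  exists2 e, vproj (varr L) e = g & gsrc e = y.
Proof.
apply: (submersion_fibre_surj vbg_varr vbg_vobj vbg_src).
by case: vbg_lie => _ [].
Qed.

Lemma vbg_tgt_surj g y : vproj (vobj L) y = gtgt g ->
  exists2 e, vproj (varr L) e = g & gtgt e = y.
Proof.
apply: (submersion_fibre_surj vbg_varr vbg_vobj vbg_tgt).
by case: vbg_lie => _ [].
Qed.

End VBGroupoids.

Section LineBundleGroupoids.
Context {R : realType} (L : vbg R).
Hypothesis lL : is_lbg L.

Lemma lbg_vbg : is_vbg L. Proof. by case: lL. Qed.
Let vL := lbg_vbg.

Lemma lbg_src_inj (e e' : arr (vgpd L)) :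
  vproj (varr L) e = vproj (varr L) e' -> gsrc e = gsrc e' -> e = e'.
Proof.
case: lL => _ r1 r2 H; apply: (line_surj_inj (vbg_varr vL) (vbg_vobj vL) r1 r2
  (vbg_src vL) (x := vproj (varr L) e)) => //.
by move=> y; apply: vbg_src_surj.
Qed.

Lemma lbg_tgt_inj (e e' : arr (vgpd L)) :
  vproj (varr L) e = vproj (varr L) e' -> gtgt e = gtgt e' -> e = e'.
Proof.
case: lL => _ r1 r2 H; apply: (line_surj_inj (vbg_varr vL) (vbg_vobj vL) r1 r2
  (vbg_tgt vL) (x := vproj (varr L) e)) => //.
by move=> y; apply: vbg_tgt_surj.
Qed.

Definition src_inv g y := fibinv (varr L) (@gsrc R (vgpd L)) g y.

Lemma src_invP g y : vproj (vobj L) y = gsrc g ->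
  vproj (varr L) (src_inv g y) = g /\ gsrc (src_inv g y) = y.
Proof.
case: (lL) => _ r1 r2.
exact: (fibinvP (vbg_varr vL) (vbg_vobj vL) r1 r2 (vbg_src vL) lbg_src_inj).
Qed.

Lemma src_inv_uniq g y e : vproj (varr L) e = g -> gsrc e = y ->
  src_inv g y = e.
Proof. exact: (fibinv_uniq lbg_src_inj). Qed.

End LineBundleGroupoids.

Section MultiplicativeForms.
Context {R : realType} (L : vbg R) (theta : tanm (arr (bgpd L)) -> arr (vgpd L)).
Hypotheses (lL : is_lbg L) (fth : is_form theta) (mth : is_multiplicative theta).

Let vL := lbg_vbg lL.
Let lieL := vbg_lie vL.
Let lieG := vbg_base_lie vL.
Let vA := vbg_varr vL.
Let vO := vbg_vobj vL.
Let mG : is_mfd (arr (bgpd L)) := vb_base_mfd vA.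

Lemma form_proj v : vproj (varr L) (theta v) = foot v.
Proof. exact: (vb_map_proj fth). Qed.

Lemma form_smooth_at v : smooth_at theta v.
Proof. exact: (vb_map_smooth_at (tvb_is_vb mG) fth). Qed.

(** In the fibre of [L^(2)] over the composable pair, the pullbacks of [theta] along [pr_2], the
    multiplication and [pr_1] are [(a1, theta v')], [(b1, b2)] and [(theta v, c2)], completed to
    composable pairs by surjectivity of [gsrc] and [gtgt] on fibres. The first components give
    [b1 = a1 + theta v], and [b1] has the target of the product [b1 b2 = theta (v v')]. *)
Lemma form_tgt_mul (v v' : tanm (arr (bgpd L))) :
  tmap (@gsrc R (bgpd L)) v = tmap (@gtgt R (bgpd L)) v' ->
  exists a, [/\ vproj (varr L) a = foot v, gsrc a = gtgt (theta v') &
    gtgt (theta (@gmul R (tgpd (bgpd L)) v v')) = gtgt (vadd (varr L) a (theta v))].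
Proof.
move=> E; set vv := @gmul R (tgpd (bgpd L)) v v'.
have Fvv : foot vv = gmul (foot v) (foot v') by exact: foot_tmul.
have gg := foot_composable E.
have [a1 a1p a1s] : exists2 e, vproj (varr L) e = foot v & gsrc e = gtgt (theta v').
  apply: (vbg_src_surj vL); rewrite (vb_map_proj (vbg_tgt vL)) form_proj.
  by rewrite gg.
have [c2 c2p c2t] : exists2 e, vproj (varr L) e = foot v' & gtgt e = gsrc (theta v).
  apply: (vbg_tgt_surj vL); rewrite (vb_map_proj (vbg_src vL)) form_proj.
  by rewrite gg.
have [b2 b2p b2s] : exists2 e, vproj (varr L) e = foot v' & gsrc e = gsrc (theta vv).
  apply: (vbg_src_surj vL); rewrite (vb_map_proj (vbg_src vL)) form_proj Fvv.
  exact: (gsrc_gmul lieG gg).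
have [b1 b1p b1s] : exists2 e, vproj (varr L) e = foot v & gsrc e = gtgt b2.
  by apply: (vbg_src_surj vL); rewrite (vb_map_proj (vbg_tgt vL)) b2p gg.
have bb : gmul b1 b2 = theta vv.
  apply: (lbg_src_inj lL).
    by rewrite (vbg_mul_proj vL b1s) b1p b2p form_proj Fvv.
  by rewrite (gsrc_gmul lieL b1s).
pose over (p : prodm (arr (vgpd L)) (arr (vgpd L))) :=
  [/\ composable (vgpd L) p, vproj (varr L) p.1 = foot v &
    vproj (varr L) p.2 = foot v'].
have oa : over (a1, theta v') by split; rewrite ?form_proj.
have ob : over (b1, b2) by split.
have oc : over (theta v, c2) by split; rewrite ?form_proj// /composable /= c2t.
have [H1 _] := mth E oa ob oc erefl bb erefl.
exists a1; split=> //; rewrite -bb (gtgt_gmul lieL b1s); congr gtgt.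
by apply/(alt_eq0 vA); rewrite /= ?form_proj ?a1p ?b1p.
Qed.

(** This is [t(e e') = t(e)] in the Morita kernel, for [e = (v, l)] and [e' = (v', l')].
    Composability splits [l] as [k + a], where [k] has source [t(l')] and [a] comes from
    [form_tgt_mul]. Then [l'' = k l'], and the targets of [k], [a] and [theta v] add up on both
    sides. *)
Lemma form_tgt_add_mul (v v' : tanm (arr (bgpd L))) l l' l'' :
  tmap (@gsrc R (bgpd L)) v = tmap (@gtgt R (bgpd L)) v' ->
  vproj (varr L) l = foot v -> vproj (varr L) l' = foot v' ->
  gsrc l = gtgt (vadd (varr L) l' (theta v')) ->
  vproj (varr L) l'' = gmul (foot v) (foot v') -> gsrc l'' = gsrc l' ->
  gtgt (vadd (varr L) l'' (theta (@gmul R (tgpd (bgpd L)) v v'))) =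
  gtgt (vadd (varr L) l (theta v)).
Proof.
move=> E lp lp' ll' lp'' l''s.
have [a [ap asrc athe]] := form_tgt_mul E; have gg := foot_composable E.
have Tt := vbg_tgt vL; have Ss := vbg_src vL.
have [k kp ks] : exists2 e, vproj (varr L) e = foot v & gsrc e = gtgt l'.
  by apply: (vbg_src_surj vL); rewrite (vb_map_proj Tt) lp' gg.
have -> : l'' = gmul k l'.
  apply: (lbg_src_inj lL); first by rewrite (vbg_mul_proj vL ks) kp lp'.
  by rewrite (gsrc_gmul lieL ks).
have lE : l = vadd (varr L) k a.
  apply: (lbg_src_inj lL); first by rewrite (vproj_add vA) ?kp ?ap.
  by rewrite (vb_mapD Ss) ?kp ?ap// ks asrc -(vb_mapD Tt) ?form_proj.
have Fm : foot (@gmul R (tgpd (bgpd L)) v v') = gmul (foot v) (foot v').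
  exact: foot_tmul.
rewrite (vb_mapD Tt); last by rewrite form_proj Fm (vbg_mul_proj vL ks) kp lp'.
rewrite (gtgt_gmul lieL ks) athe -(vb_mapD Tt).
  by rewrite lE (vaddA vA) ?kp ?ap ?form_proj.
by rewrite (vproj_add vA) ?kp ?ap ?form_proj.
Qed.

(** A unit vector satisfies [u u = u], so [form_tgt_mul] forces [a = 0]; as [t(theta u) = s(a)], the
    value [theta u] vanishes too. *)
Lemma form_unt (x : tanm (obj (bgpd L))) :
  theta (tmap (@gunt R (bgpd L)) x) = vzero (varr L) (gunt (foot x)).
Proof.
set u := tmap (@gunt R (bgpd L)) x.
have Fu : foot u = gunt (foot x) by rewrite foot_tmap.
have E : tmap (@gsrc R (bgpd L)) u = tmap (@gtgt R (bgpd L)) u.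
  by rewrite (tsrc_tunt lieG) (ttgt_tunt lieG).
have uu : @gmul R (tgpd (bgpd L)) u u = u.
  by have := tmul1v lieG u; rewrite (ttgt_tunt lieG).
have Tt := vbg_tgt vL; have Ss := vbg_src vL.
have [a [ap asrc athe]] := form_tgt_mul E.
have a0 : a = vzero (varr L) (foot u).
  apply: (vaddI vA (e := theta u)); rewrite ?form_proj ?vzeroK ?ap//.
  rewrite (vaddr0 vA) ?form_proj// (vaddC vA) ?form_proj ?ap//.
  apply: (lbg_tgt_inj lL); first by rewrite (vproj_add vA) ?ap ?form_proj.
  by rewrite -athe uu.
apply: (lbg_tgt_inj lL); first by rewrite form_proj vzeroK Fu.
rewrite -asrc a0 (vb_map0 vA vO Ss) (vb_map0 vA vO Tt) Fu.
by rewrite (gsrc_gunt lieG) (gtgt_gunt lieG).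
Qed.

(** The case of the composable pair [(v^-1, v)] in [form_tgt_add_mul]: the product is a unit vector,
    on which [theta] vanishes. *)
Lemma form_tgt_inv (v : tanm (arr (bgpd L))) l l' :
  vproj (varr L) l = foot v -> vproj (varr L) l' = ginv (foot v) ->
  gsrc l' = gtgt (vadd (varr L) l (theta v)) ->
  gtgt (vadd (varr L) l' (theta (tmap (@ginv R (bgpd L)) v))) = gsrc l.
Proof.
move=> lp lp' ll'; set w := tmap (@ginv R (bgpd L)) v.
have E : tmap (@gsrc R (bgpd L)) w = tmap (@gtgt R (bgpd L)) v by exact: tsrc_tinv.
have Fw : foot w = ginv (foot v) by rewrite foot_tmap.
have Tt := vbg_tgt vL; have Ss := vbg_src vL; have Uu := vbg_unt vL.
pose l'' := gunt (gsrc l) : arr (vgpd L).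
have gg := foot_composable E.
have l''p : vproj (varr L) l'' = gmul (foot w) (foot v).
  rewrite (vb_map_proj Uu) (vb_map_proj Ss) lp Fw.
  by rewrite (gmulVg lieG).
have l''s : gsrc l'' = gsrc l by rewrite /l'' (gsrc_gunt lieL).
have lpw : vproj (varr L) l' = foot w by rewrite Fw.
rewrite -(form_tgt_add_mul E lpw lp ll' l''p l''s).
have -> : @gmul R (tgpd (bgpd L)) w v =
    tmap (@gunt R (bgpd L)) (tmap (@gsrc R (bgpd L)) v) by exact: tmulVv.
rewrite form_unt foot_tmap (vaddr0 vA); first exact: (gtgt_gunt lieL).
by rewrite (vb_map_proj Uu) (vb_map_proj Ss) lp.
Qed.

End MultiplicativeForms.

(** * Smoothness of composites *)

Section Compositions.
Context {R : realType}.
Implicit Types X Y Z : mfd R.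

Lemma smooth_at_fst_comp Z X Y (f : Z -> prodm X Y) z : is_mfd Z -> is_mfd X ->
  is_mfd Y -> smooth_at f z -> smooth_at (fun z => (f z).1) z.
Proof.
move=> mZ mX mY sf; have mP := prodm_mfd mX mY.
exact: (smooth_at_comp mZ mP mX sf (smooth_at_fst _ mX mY)).
Qed.

Lemma smooth_at_snd_comp Z X Y (f : Z -> prodm X Y) z : is_mfd Z -> is_mfd X ->
  is_mfd Y -> smooth_at f z -> smooth_at (fun z => (f z).2) z.
Proof.
move=> mZ mX mY sf; have mP := prodm_mfd mX mY.
exact: (smooth_at_comp mZ mP mY sf (smooth_at_snd _ mX mY)).
Qed.

Lemma smooth_at_tmap_comp Z X Y (f : Z -> tanm X) (g : X -> Y) z : is_mfd Z ->
  is_mfd X -> is_mfd Y -> smooth_at f z -> smooth_at g (foot (f z)) ->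
  smooth_at (fun z => tmap g (f z)) z.
Proof.
move=> mZ mX mY sf sg; have mTX := tanm_mfd mX; have mTY := tanm_mfd mY.
exact: (smooth_at_comp mZ mTX mTY sf (smooth_at_tmap mX mY sg)).
Qed.

Lemma smooth_at_foot_comp Z X (f : Z -> tanm X) z : is_mfd Z ->
  is_mfd X -> smooth_at f z -> smooth_at (fun z => foot (f z)) z.
Proof.
move=> mZ mX sf; have mTX := tanm_mfd mX.
exact: (smooth_at_comp mZ mTX mX sf (smooth_at_foot _ mX)).
Qed.

Lemma smooth_at_tpair_comp Z X Y (f : Z -> tanm X) (g : Z -> tanm Y) z :
  is_mfd Z -> is_mfd X -> is_mfd Y -> smooth_at f z -> smooth_at g z ->
  smooth_at (fun z => tpair (f z) (g z)) z.
Proof.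
move=> mZ mX mY sf sg; have mTX := tanm_mfd mX; have mTY := tanm_mfd mY.
have sp := smooth_at_pair mZ mTX mTY sf sg.
exact: (smooth_at_comp mZ (prodm_mfd mTX mTY) (tanm_mfd (prodm_mfd mX mY)) sp
  (smooth_at_tpair _ mX mY)).
Qed.

Context {E E' X : mfd R} (V : vb E X) (V' : vb E' X).
Hypotheses (vV : is_vb V) (vV' : is_vb V').

Lemma smooth_at_wfst_comp Z (f : Z -> whitney V V') z : is_mfd Z ->
  smooth_at f z -> smooth_at (fun z => (sval (f z)).1) z.
Proof.
move=> mZ sf; exact: (smooth_at_comp mZ (whitney_mfd vV vV') (vb_total_mfd vV) sf
  (smooth_at_wfst vV vV' _)).
Qed.

Lemma smooth_at_wsnd_comp Z (f : Z -> whitney V V') z : is_mfd Z ->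
  smooth_at f z -> smooth_at (fun z => (sval (f z)).2) z.
Proof.
move=> mZ sf; exact: (smooth_at_comp mZ (whitney_mfd vV vV') (vb_total_mfd vV') sf
  (smooth_at_wsnd vV vV' _)).
Qed.

End Compositions.

Section FibreAlgebra.
Context {R : realType} {E X : mfd R} (V : vb E X).
Hypothesis vV : is_vb V.

Lemma vaddACA a b c d : vproj V a = vproj V b -> vproj V a = vproj V c ->
  vproj V b = vproj V d ->
  vadd V (vadd V a b) (vadd V c d) = vadd V (vadd V a c) (vadd V b d).
Proof.
move=> ab ac bd; have [U [phi [psi [Ua T]]]] := triv_ex vV (vproj V a).
have cd : vproj V c = vproj V d by rewrite -ac -bd.
have Ub : U (vproj V b) by rewrite -ab.
have Uc : U (vproj V c) by rewrite -ac.
have P1 : vproj V (vadd V a b) = vproj V (vadd V c d) by rewrite !(vproj_add vV).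
have P2 : vproj V (vadd V a c) = vproj V (vadd V b d) by rewrite !(vproj_add vV).
apply: (triv_inj T).
- by rewrite (vproj_add vV P1) (vproj_add vV).
- by rewrite (vproj_add vV P1) (vproj_add vV P2) !(vproj_add vV).
rewrite (trivD T _ P1) ?(vproj_add vV)// (trivD T _ P2) ?(vproj_add vV)//.
by rewrite !(trivD T)// addrACA.
Qed.

Lemma vscaleDr k a b : vproj V a = vproj V b ->
  vscale V k (vadd V a b) = vadd V (vscale V k a) (vscale V k b).
Proof.
move=> ab; have [U [phi [psi [Ua T]]]] := triv_ex vV (vproj V a).
have Ub : U (vproj V b) by rewrite -ab.
have P : vproj V (vscale V k a) = vproj V (vscale V k b) by rewrite !(vproj_scale vV).
apply: (triv_inj T).
- by rewrite (vproj_scale vV) (vproj_add vV).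
- by rewrite (vproj_scale vV) (vproj_add vV)// (vproj_add vV P) (vproj_scale vV).
rewrite (trivZ T) ?(vproj_add vV)// (trivD T)// (trivD T _ P) ?(vproj_scale vV)//.
by rewrite !(trivZ T)// scalerDr.
Qed.

End FibreAlgebra.

(** * The Morita kernel *)

Section MoritaKernel.
Context {R : realType} (L : vbg R) (theta : tanm (arr (bgpd L)) -> arr (vgpd L)).
Hypotheses (lL : is_lbg L) (fth : is_form theta) (mth : is_multiplicative theta).

Let G := bgpd L.
Let vL := lbg_vbg lL.
Let lieL := vbg_lie vL.
Let lieG : is_liegpd G := vbg_base_lie vL.
Let vA := vbg_varr vL.
Let vO := vbg_vobj vL.
Let mG : is_mfd (arr G) := vb_base_mfd vA.
Let mM : is_mfd (obj G) := vb_base_mfd vO.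
Let mLA : is_mfd (arr (vgpd L)) := vb_total_mfd vA.
Let mLO : is_mfd (obj (vgpd L)) := vb_total_mfd vO.
Let VG := tvb (arr G).
Let VM := tvb (obj G).
Let vVG : is_vb VG := tvb_is_vb mG.
Let vVM : is_vb VM := tvb_is_vb mM.
Let K := vgpd (MK theta).
Let mA : is_mfd (arr K) := whitney_mfd vVG vA.
Let mO : is_mfd (obj K) := whitney_mfd vVM vO.
Let vKA : is_vb (varr (MK theta)) := whitney_is_vb vVG vA.
Let vKO : is_vb (vobj (MK theta)) := whitney_is_vb vVM vO.
Let Ss := vbg_src vL.
Let Tt := vbg_tgt vL.
Let Uu := vbg_unt vL.
Implicit Types e : arr K.

Let ttheta e := gtgt (vadd (varr L) (sval e).2 (theta (sval e).1)).

Lemma MK_foot e : foot (sval e).1 = vproj (varr L) (sval e).2.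
Proof. exact: (wpt_proj (V := VG) (V' := varr L) e). Qed.

Lemma MK_foot_obj (x : obj K) : foot (sval x).1 = vproj (vobj L) (sval x).2.
Proof. exact: (wpt_proj (V := VM) (V' := vobj L) x). Qed.

Lemma MK_form_foot e :
  vproj (varr L) (sval e).2 = vproj (varr L) (theta (sval e).1).
Proof. by rewrite -MK_foot (form_proj fth). Qed.

Lemma MK_ttheta_proj e : vproj (vobj L) (ttheta e) = gtgt (foot (sval e).1).
Proof.
by rewrite (vb_map_proj Tt) (vproj_add vA) -?MK_foot// (form_proj fth).
Qed.

Lemma MK_src e : sval (gsrc e) = (tmap (@gsrc R G) (sval e).1, gsrc (sval e).2).
Proof.
apply: (wpairP (V := VM) (V' := vobj L)).
by rewrite (vb_map_proj Ss) -MK_foot; exact: foot_tmap.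
Qed.

Lemma MK_tgt e : sval (gtgt e) = (tmap (@gtgt R G) (sval e).1, ttheta e).
Proof.
apply: (wpairP (V := VM) (V' := vobj L)).
by rewrite MK_ttheta_proj; exact: foot_tmap.
Qed.

Lemma MK_src_fst e : (sval (gsrc e)).1 = tmap (@gsrc R G) (sval e).1.
Proof. by rewrite MK_src. Qed.

Lemma MK_tgt_fst e : (sval (gtgt e)).1 = tmap (@gtgt R G) (sval e).1.
Proof. by rewrite MK_tgt. Qed.

Lemma MK_composable e e' : gsrc e = gtgt e' ->
  tmap (@gsrc R G) (sval e).1 = tmap (@gtgt R G) (sval e').1 /\
  gsrc (sval e).2 = ttheta e'.
Proof. by move=> /(congr1 sval); rewrite MK_src MK_tgt => -[]. Qed.

Lemma MK_src_inv g y : vproj (vobj L) y = gsrc g ->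
  vproj (varr L) (src_inv g y) = g /\ gsrc (src_inv g y) = y.
Proof. exact: src_invP. Qed.

Lemma MK_mul_proj e e' : gsrc e = gtgt e' ->
  vproj (vobj L) (gsrc (sval e').2) =
  gsrc (gmul (foot (sval e).1) (foot (sval e').1)).
Proof.
move=> /MK_composable[/(foot_composable) gg _].
by rewrite (gsrc_gmul lieG gg) (vb_map_proj Ss) MK_foot.
Qed.

Lemma MK_mul e e' : gsrc e = gtgt e' ->
  sval (gmul e e') = (@gmul R (tgpd G) (sval e).1 (sval e').1,
    src_inv (gmul (foot (sval e).1) (foot (sval e').1)) (gsrc (sval e').2)).
Proof.
move=> H; apply: (wpairP (V := VG) (V' := varr L)).
rewrite (MK_src_inv (MK_mul_proj H)).1.
exact: (foot_tmul lieG (MK_composable H).1).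
Qed.

Lemma MK_inv_proj e : vproj (vobj L) (ttheta e) = gsrc (ginv (foot (sval e).1)).
Proof. by rewrite MK_ttheta_proj (gsrc_ginv lieG). Qed.

Lemma MK_inv e : sval (ginv e) = (tmap (@ginv R G) (sval e).1,
  src_inv (ginv (foot (sval e).1)) (ttheta e)).
Proof.
apply: (wpairP (V := VG) (V' := varr L)).
by rewrite (MK_src_inv (MK_inv_proj e)).1; exact: foot_tmap.
Qed.

Lemma MK_unt (x : obj K) : sval (gunt x : arr K) =
  (tmap (@gunt R G) (sval x).1, gunt (sval x).2).
Proof.
apply: (wpairP (V := VG) (V' := varr L)).
by rewrite (vb_map_proj Uu) -MK_foot_obj; exact: foot_tmap.
Qed.

(** As [gsrc] is injective on the fibres of [L], the second component of an arrow is known from its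
    source. Groupoid identities thus reduce to those of the tangent groupoid and to equalities of
    sources. *)
Lemma MK_arr_eq e e' : (sval e).1 = (sval e').1 ->
  gsrc (sval e).2 = gsrc (sval e').2 -> e = e'.
Proof.
move=> E1 E2; apply: wpt_eq => //; apply: (lbg_src_inj lL) => //.
by rewrite -!MK_foot E1.
Qed.

Lemma MK_obj_eq (x y : obj K) : sval x = sval y -> x = y.
Proof. by move=> H; apply: wpt_eq; rewrite H. Qed.

Lemma MK_src_mul e e' : gsrc e = gtgt e' -> gsrc (gmul e e') = gsrc e'.
Proof.
move=> H; apply: MK_obj_eq; rewrite !MK_src (MK_mul H) /=.
by rewrite (tsrc_tmul lieG (MK_composable H).1) (MK_src_inv (MK_mul_proj H)).2.
Qed.

Lemma MK_tgt_mul e e' : gsrc e = gtgt e' -> gtgt (gmul e e') = gtgt e.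
Proof.
move=> H; have [H1 H2] := MK_composable H.
apply: MK_obj_eq; rewrite !MK_tgt /ttheta (MK_mul H) /=.
rewrite (ttgt_tmul lieG H1); congr pair.
have [P1 P2] := MK_src_inv (MK_mul_proj H).
exact: (form_tgt_add_mul lL fth mth H1 (esym (MK_foot e)) (esym (MK_foot e')) H2 P1 P2).
Qed.

Lemma MK_src_inverse e : gsrc (ginv e) = gtgt e.
Proof.
apply: MK_obj_eq; rewrite MK_src MK_tgt MK_inv /= (tsrc_tinv lieG).
by rewrite (MK_src_inv (MK_inv_proj e)).2.
Qed.

Lemma MK_tgt_inverse e : gtgt (ginv e) = gsrc e.
Proof.
apply: MK_obj_eq; rewrite MK_tgt /ttheta MK_src MK_inv /= (ttgt_tinv lieG).
congr pair; have [P1 P2] := MK_src_inv (MK_inv_proj e).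
exact: (form_tgt_inv lL fth mth (esym (MK_foot e)) P1 P2).
Qed.

Lemma MK_src_unt (x : obj K) : gsrc (gunt x : arr K) = x.
Proof.
apply: MK_obj_eq; rewrite MK_src MK_unt /= (tsrc_tunt lieG) (gsrc_gunt lieL).
by case: (sval x).
Qed.

Lemma MK_tgt_unt (x : obj K) : gtgt (gunt x : arr K) = x.
Proof.
apply: MK_obj_eq; rewrite MK_tgt /ttheta MK_unt /= (ttgt_tunt lieG).
rewrite (form_unt lL fth mth) (vaddr0 vA).
  by rewrite (gtgt_gunt lieL); case: (sval x).
by rewrite (vb_map_proj Uu) -MK_foot_obj.
Qed.

Lemma MK_mulA e e' e'' : gsrc e = gtgt e' -> gsrc e' = gtgt e'' ->
  gmul e (gmul e' e'') = gmul (gmul e e') e''.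
Proof.
move=> H H'; have H1 : gsrc e = gtgt (gmul e' e'') by rewrite MK_tgt_mul.
have H2 : gsrc (gmul e e') = gtgt e'' by rewrite MK_src_mul.
apply: MK_arr_eq.
  rewrite (MK_mul H1) (MK_mul H2) /= (MK_mul H) (MK_mul H') /=.
  exact: (tmulA lieG (MK_composable H).1 (MK_composable H').1).
have E (a : arr K) : gsrc (sval a).2 = (sval (gsrc a)).2 by rewrite MK_src.
by rewrite !E !MK_src_mul.
Qed.

Lemma MK_mul_unt_l e : gmul (gunt (gtgt e)) e = e.
Proof.
have H : gsrc (gunt (gtgt e) : arr K) = gtgt e by rewrite MK_src_unt.
have E (a : arr K) : gsrc (sval a).2 = (sval (gsrc a)).2 by rewrite MK_src.
apply: MK_arr_eq; last by rewrite !E MK_src_mul.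
rewrite (MK_mul H) MK_unt /= MK_tgt /=.
exact: tmul1v.
Qed.

Lemma MK_mul_unt_r e : gmul e (gunt (gsrc e)) = e.
Proof.
have H : gsrc e = gtgt (gunt (gsrc e) : arr K) by rewrite MK_tgt_unt.
have E (a : arr K) : gsrc (sval a).2 = (sval (gsrc a)).2 by rewrite MK_src.
apply: MK_arr_eq; last by rewrite !E MK_src_mul// MK_src_unt.
rewrite (MK_mul H) MK_unt /= MK_src /=.
exact: tmulv1.
Qed.

Lemma MK_mul_inv_r e : gmul e (ginv e) = gunt (gtgt e).
Proof.
have H : gsrc e = gtgt (ginv e) by rewrite MK_tgt_inverse.
have E (a : arr K) : gsrc (sval a).2 = (sval (gsrc a)).2 by rewrite MK_src.
apply: MK_arr_eq; last by rewrite !E MK_src_mul// MK_src_unt MK_src_inverse.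
rewrite (MK_mul H) MK_unt MK_inv /= MK_tgt /=.
exact: tmulvV.
Qed.

Lemma MK_mul_inv_l e : gmul (ginv e) e = gunt (gsrc e).
Proof.
have H : gsrc (ginv e) = gtgt e by rewrite MK_src_inverse.
have E (a : arr K) : gsrc (sval a).2 = (sval (gsrc a)).2 by rewrite MK_src.
apply: MK_arr_eq; last by rewrite !E MK_src_mul// MK_src_unt.
rewrite (MK_mul H) MK_unt MK_inv /= MK_src /=.
exact: tmulVv.
Qed.

Let s_fst e : smooth_at ((fun e => (sval e).1) : arr K -> tanm (arr G)) e.
Proof. exact: (smooth_at_wfst vVG vA). Qed.

Let s_snd e : smooth_at ((fun e => (sval e).2) : arr K -> arr (vgpd L)) e.
Proof. exact: (smooth_at_wsnd vVG vA). Qed.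

Let s_ofst (x : obj K) : smooth_at ((fun y => (sval y).1) : obj K -> tanm (obj G)) x.
Proof. exact: (smooth_at_wfst vVM vO). Qed.

Let s_osnd (x : obj K) : smooth_at ((fun y => (sval y).2) : obj K -> obj (vgpd L)) x.
Proof. exact: (smooth_at_wsnd vVM vO). Qed.

Lemma MK_ttheta_smooth e : smooth_at (ttheta : arr K -> obj (vgpd L)) e.
Proof.
have sth : smooth_at ((fun e => theta (sval e).1) : arr K -> arr (vgpd L)) e.
  exact: (smooth_at_comp mA (tanm_mfd mG) mLA (s_fst e) (form_smooth_at lL fth _)).
have sadd : smooth_at ((fun e => vadd (varr L) (sval e).2 (theta (sval e).1)) :
    arr K -> arr (vgpd L)) e.
  apply: (smooth_at_vadd vA mA (s_snd e) sth).
  by refine (@mnbhsW R (arr K) _ _ mA _) => q; exact: MK_form_foot.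
exact: (smooth_at_comp mA mLA mLO sadd (vb_map_smooth_at vA Tt _)).
Qed.

Lemma MK_src_smooth e : smooth_at (@gsrc R K) e.
Proof.
apply: (smooth_at_wpair vVM vO (z := e) mA).
- exact: (smooth_at_tmap_comp mA mG mM (s_fst e) (gsrc_smooth_at lieG _)).
- exact: (smooth_at_comp mA mLA mLO (s_snd e) (vb_map_smooth_at vA Ss _)).
- refine (@mnbhsW R (arr K) _ _ mA _) => q;
  rewrite (vb_map_proj Ss) -MK_foot; exact: foot_tmap.
Qed.

Lemma MK_tgt_smooth e : smooth_at (@gtgt R K) e.
Proof.
apply: (smooth_at_wpair vVM vO (z := e) mA).
- exact: (smooth_at_tmap_comp mA mG mM (s_fst e) (gtgt_smooth_at lieG _)).
- exact: MK_ttheta_smooth.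
- refine (@mnbhsW R (arr K) _ _ mA _) => q;
  rewrite MK_ttheta_proj; exact: foot_tmap.
Qed.

Lemma MK_unt_smooth (x : obj K) : smooth_at (@gunt R K) x.
Proof.
apply: (smooth_at_wpair vVG vA (z := x) mO).
- exact: (smooth_at_tmap_comp mO mM mG (s_ofst x) (gunt_smooth_at lieG _)).
- exact: (smooth_at_comp mO mLO mLA (s_osnd x) (vb_map_smooth_at vO Uu _)).
- refine (@mnbhsW R (obj K) _ _ mO _) => q;
  rewrite (vb_map_proj Uu) -MK_foot_obj; exact: foot_tmap.
Qed.

Lemma MK_inv_smooth e : smooth_at (@ginv R K) e.
Proof.
case: (lL) => _ r1 r2.
have sp : smooth_at ((fun e => foot (sval e).1) : arr K -> arr G) e.
  exact: (smooth_at_foot_comp mA mG (s_fst e)).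
have si : smooth_at ((fun e => ginv (foot (sval e).1)) : arr K -> arr G) e.
  exact: (smooth_at_comp mA mG mG sp (ginv_smooth_at lieG _)).
apply: (smooth_at_wpair vVG vA (z := e) mA).
- exact: (smooth_at_tmap_comp mA mG mG (s_fst e) (ginv_smooth_at lieG _)).
- apply: (smooth_at_fibinv vA vO r1 r2 Ss (lbg_src_inj lL) mA si (MK_ttheta_smooth e)).
  by refine (@mnbhsW R (arr K) _ _ mA _) => q; exact: MK_inv_proj.
- refine (@mnbhsW R (arr K) _ _ mA _) => q;
  rewrite (MK_src_inv (MK_inv_proj q)).1; exact: foot_tmap.
Qed.

(** The local extension pairs the tangent map of an extension [e0] of the multiplication of [G] with
    an extension [J] of the fibrewise inverse of [gsrc]. On composable pairs [tmap e0] is the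
    product of the tangent groupoid, by [tmul_ext]. *)
Lemma MK_mul_smooth : smooth_sub (composable K)
  ((fun p => gmul p.1 p.2) : prodm (arr K) (arr K) -> arr K).
Proof.
case: (lL) => _ r1 r2; have mP := prodm_mfd mA mA; have mGG := prodm_mfd mG mG.
apply/smooth_subP => // p H; have {}H : gsrc p.1 = gtgt p.2 by exact: H.
have [H1 H2] := MK_composable H; have gg := foot_composable H1.
have [e0 He0] := gmul_smooth_sub lieG
  (gg : composable G (foot (sval p.1).1, foot (sval p.2).1)).
have [se0 ne0] := (local_extP _ _ _ _ mGG mG).1 He0.
have e0E : e0 (foot (sval p.1).1, foot (sval p.2).1) =
    gmul (foot (sval p.1).1) (foot (sval p.2).1).
  by have := mnbhs_singleton ne0; apply.
have JP : vproj (vobj L) (gsrc (sval p.2).2) =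
    gsrc (e0 (foot (sval p.1).1, foot (sval p.2).1)).
  by rewrite e0E; exact: MK_mul_proj.
have [J sJ nJ] := fibinv_local_ext vA vO r1 r2 Ss (lbg_src_inj lL) JP.
have s1 := smooth_at_fst p mA mA; have s2 := smooth_at_snd p mA mA.
have s11 : smooth_at ((fun z => (sval z.1).1) : prodm (arr K) (arr K) -> tanm (arr G)) p.
  exact: (smooth_at_wfst_comp vVG vA mP s1).
have s21 : smooth_at ((fun z => (sval z.2).1) : prodm (arr K) (arr K) -> tanm (arr G)) p.
  exact: (smooth_at_wfst_comp vVG vA mP s2).
have s22 : smooth_at ((fun z => (sval z.2).2) : prodm (arr K) (arr K) -> arr (vgpd L)) p.
  exact: (smooth_at_wsnd_comp vVG vA mP s2).
have sf : smooth_at ((fun z => (foot (sval z.1).1, foot (sval z.2).1)) :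
    prodm (arr K) (arr K) -> prodm (arr G) (arr G)) p.
  by apply: smooth_at_pair => //; apply: smooth_at_foot_comp.
have se : smooth_at ((fun z => e0 (foot (sval z.1).1, foot (sval z.2).1)) :
    prodm (arr K) (arr K) -> arr G) p.
  exact: (smooth_at_comp mP mGG mG sf se0).
have ss : smooth_at ((fun z => gsrc (sval z.2).2) :
    prodm (arr K) (arr K) -> obj (vgpd L)) p.
  exact: (smooth_at_comp mP mLA mLO s22 (vb_map_smooth_at vA Ss _)).
have sJ' : smooth_at ((fun z => (e0 (foot (sval z.1).1, foot (sval z.2).1),
    gsrc (sval z.2).2)) : prodm (arr K) (arr K) -> prodm (arr G) (obj (vgpd L))) p.
  exact: smooth_at_pair.
have mGL := prodm_mfd mG mLO.
have nJ' := mnbhs_preim mP mGL sJ' nJ.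
(* At each nearby [z] the map [e0] has to extend the multiplication on a whole neighbourhood of the
   feet, because its differential is taken there; hence [mnbhs_nbhs]. *)
have ne0' := mnbhs_preim mP mGG sf (mnbhs_nbhs (mnbhsI mGG (smooth_at_nbhs mG se0) ne0)).
exists (fun z => wpair VG (varr L) (tmap e0 (tpair (sval z.1).1 (sval z.2).1))
  (J (e0 (foot (sval z.1).1, foot (sval z.2).1), gsrc (sval z.2).2))).
  apply: (smooth_at_wpair vVG vA mP).
  - apply: (smooth_at_tmap_comp mP mGG mG).
      exact: (smooth_at_tpair_comp mP mG mG s11 s21).
    by rewrite foot_tpair.
  - exact: (smooth_at_comp mP mGL mLA sJ' sJ).
  - apply: mnbhsS nJ' => z /= [Jz _]; rewrite Jz.
    by apply: etrans (foot_tmap _ _) _; rewrite foot_tpair.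
apply: mnbhsS (mnbhsI mP nJ' ne0') => z [/= [Jz1 Jz2] nz] Hz.
have {}Hz : gsrc z.1 = gtgt z.2 by exact: Hz.
have [Hz1 Hz2] := MK_composable Hz; have ggz := foot_composable Hz1.
have ze : e0 (foot (sval z.1).1, foot (sval z.2).1) =
    gmul (foot (sval z.1).1) (foot (sval z.2).1).
  by have [_] := mnbhs_singleton nz; apply.
have zext : local_ext (composable G)
    ((fun p => gmul p.1 p.2) : prodm (arr G) (arr G) -> arr G)
    (foot (sval z.1).1, foot (sval z.2).1) e0.
  apply/local_extP => //; split; first by have [] := mnbhs_singleton nz.
  by apply: mnbhsS nz => q [].
have tE := tmul_ext lieG Hz1 zext.
have PP := MK_mul_proj Hz.
have JE : J (e0 (foot (sval z.1).1, foot (sval z.2).1), gsrc (sval z.2).2) =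
    src_inv (gmul (foot (sval z.1).1) (foot (sval z.2).1)) (gsrc (sval z.2).2).
  apply/esym/(src_inv_uniq lL); first by rewrite Jz1.
  by apply: Jz2; rewrite ze.
have W : vproj VG (tmap e0 (tpair (sval z.1).1 (sval z.2).1)) =
    vproj (varr L) (J (e0 (foot (sval z.1).1, foot (sval z.2).1), gsrc (sval z.2).2)).
  by rewrite Jz1; apply: etrans (foot_tmap _ _) _; rewrite foot_tpair.
have {}W := wpairP W.
by apply: wpt_eq; rewrite W (MK_mul Hz) /=; [exact: esym tE|exact: JE].
Qed.

Lemma MK_src_proj e : vproj (vobj (MK theta)) (gsrc e) = gsrc (foot (sval e).1).
Proof. rewrite [LHS]/(foot (sval (gsrc e : obj K)).1) MK_src_fst; exact: foot_tmap. Qed.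

Lemma MK_tgt_proj e : vproj (vobj (MK theta)) (gtgt e) = gtgt (foot (sval e).1).
Proof. rewrite [LHS]/(foot (sval (gtgt e : obj K)).1) MK_tgt_fst; exact: foot_tmap. Qed.

Lemma MK_src_vb_map : vb_map (varr (MK theta)) (vobj (MK theta)) (@gsrc R K) (@gsrc R G).
Proof.
split.
- by apply/smoothP => // e; exact: MK_src_smooth.
- by apply/smoothP => // g; exact: gsrc_smooth_at.
- move=> e; rewrite [LHS]/(foot (sval (gsrc e : obj K)).1) MK_src; exact: foot_tmap.
- move=> e e' H; have H' : foot (sval e).1 = foot (sval e').1 by exact: H.
  have H2 : vproj (varr L) (sval e).2 = vproj (varr L) (sval e').2 by rewrite -!MK_foot.
  have HW : vproj (vobj (MK theta)) (gsrc e) = vproj (vobj (MK theta)) (gsrc e').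
    by rewrite !MK_src_proj H'.
  apply: MK_obj_eq; rewrite (sval_wadd vVM vO HW).
  rewrite !MK_src (sval_wadd vVG vA H) /= (vb_mapD Ss H2).
  by congr pair; exact: (tmap_add mG mM (gsrc_smooth_at lieG _) H').
- move=> a e; apply: MK_obj_eq; rewrite (sval_wscale vVM vO) !MK_src.
  rewrite (sval_wscale vVG vA) /= (vb_mapZ Ss).
  by congr pair; exact: (tmap_scale a mG mM (gsrc_smooth_at lieG _)).
Qed.

Lemma MK_tgt_vb_map : vb_map (varr (MK theta)) (vobj (MK theta)) (@gtgt R K) (@gtgt R G).
Proof.
split.
- by apply/smoothP => // e; exact: MK_tgt_smooth.
- by apply/smoothP => // g; exact: gtgt_smooth_at.
- move=> e; rewrite [LHS]/(foot (sval (gtgt e : obj K)).1) MK_tgt; exact: foot_tmap.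
- move=> e e' H; have H' : foot (sval e).1 = foot (sval e').1 by exact: H.
  have H2 : vproj (varr L) (sval e).2 = vproj (varr L) (sval e').2 by rewrite -!MK_foot.
  have HW : vproj (vobj (MK theta)) (gtgt e) = vproj (vobj (MK theta)) (gtgt e').
    by rewrite !MK_tgt_proj H'.
  apply: MK_obj_eq; rewrite (sval_wadd vVM vO HW).
  rewrite !MK_tgt /ttheta (sval_wadd vVG vA H) /=.
  congr pair; first exact: (tmap_add mG mM (gtgt_smooth_at lieG _) H').
  have -> : theta (vadd VG (sval e).1 (sval e').1) =
    vadd (varr L) (theta (sval e).1) (theta (sval e').1) by exact: (vb_mapD fth).
  have F := MK_form_foot e; have F' := MK_form_foot e'.
  rewrite -(vb_mapD Tt); last by rewrite !(vproj_add vA).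
  by congr gtgt; apply: (vaddACA vA).
- move=> a e; apply: MK_obj_eq; rewrite (sval_wscale vVM vO) !MK_tgt /ttheta.
  rewrite (sval_wscale vVG vA) /=.
  congr pair; first exact: (tmap_scale a mG mM (gtgt_smooth_at lieG _)).
  have -> : theta (vscale VG a (sval e).1) = vscale (varr L) a (theta (sval e).1).
    exact: (vb_mapZ fth).
  have F := MK_form_foot e; rewrite -(vb_mapZ Tt); congr gtgt.
  exact: esym (vscaleDr vA a F).
Qed.

Lemma MK_unt_fst (x : obj K) :
  (sval (gunt x : arr K)).1 = tmap (@gunt R G) (sval x).1.
Proof. by rewrite MK_unt. Qed.

Lemma MK_inv_fst e : (sval (ginv e)).1 = tmap (@ginv R G) (sval e).1.
Proof. by rewrite MK_inv. Qed.

Lemma MK_mul_fst e e' : gsrc e = gtgt e' ->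
  (sval (gmul e e')).1 = @gmul R (tgpd G) (sval e).1 (sval e').1.
Proof. by move=> H; rewrite (MK_mul H). Qed.

Lemma MK_unt_proj (x : obj K) :
  vproj (varr (MK theta)) (gunt x : arr K) = gunt (foot (sval x).1).
Proof. rewrite [LHS]/(foot (sval (gunt x : arr K)).1) MK_unt_fst; exact: foot_tmap. Qed.

Lemma MK_unt_vb_map : vb_map (vobj (MK theta)) (varr (MK theta)) (@gunt R K) (@gunt R G).
Proof.
split.
- by apply/smoothP => // x; exact: MK_unt_smooth.
- by apply/smoothP => // g; exact: gunt_smooth_at.
- exact: MK_unt_proj.
- move=> x y H; have H' : foot (sval x).1 = foot (sval y).1 by exact: H.
  have H2 : vproj (vobj L) (sval x).2 = vproj (vobj L) (sval y).2 by rewrite -!MK_foot_obj.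
  have HW : vproj (varr (MK theta)) (gunt x : arr K) =
      vproj (varr (MK theta)) (gunt y : arr K) by rewrite !MK_unt_proj H'.
  apply: wpt_eq; rewrite (sval_wadd vVG vA HW) !MK_unt (sval_wadd vVM vO H) /=.
  + exact: (tmap_add mM mG (gunt_smooth_at lieG _) H').
  + exact: (vb_mapD Uu H2).
- move=> a x; apply: wpt_eq; rewrite (sval_wscale vVG vA) ?MK_unt (sval_wscale vVM vO) /=.
  + exact: (tmap_scale a mM mG (gunt_smooth_at lieG _)).
  + exact: (vb_mapZ Uu).
Qed.

Lemma MK_arr_wproj e e' : vproj (varr (MK theta)) e = vproj (varr (MK theta)) e' ->
  gsrc e = gsrc e' -> (sval e).1 = (sval e').1 -> e = e'.
Proof.
by move=> _ /(congr1 sval); rewrite !MK_src => -[_ E2] E1; apply: MK_arr_eq.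
Qed.

Lemma MK_inv_vb_map : vb_map (varr (MK theta)) (varr (MK theta)) (@ginv R K) (@ginv R G).
Proof.
have Sv := MK_src_vb_map; have Tv := MK_tgt_vb_map.
have Pr e : vproj (varr (MK theta)) (ginv e) = ginv (vproj (varr (MK theta)) e).
  rewrite [LHS]/(foot (sval (ginv e)).1) MK_inv_fst; exact: foot_tmap.
split.
- by apply/smoothP => // e; exact: MK_inv_smooth.
- by apply/smoothP => // g; exact: ginv_smooth_at.
- exact: Pr.
- move=> e e' H; have H' : foot (sval e).1 = foot (sval e').1 by exact: H.
  have Hi : vproj (varr (MK theta)) (ginv e) = vproj (varr (MK theta)) (ginv e').
    by rewrite !Pr H.
  apply: MK_arr_wproj.
  + by rewrite Pr (vproj_add vKA H) (vproj_add vKA Hi) Pr.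
  + by rewrite MK_src_inverse (vb_mapD Sv Hi) !MK_src_inverse (vb_mapD Tv H).
  + rewrite MK_inv_fst (sval_wadd vVG vA H) (sval_wadd vVG vA Hi) /= !MK_inv_fst.
    exact: (tmap_add mG mG (ginv_smooth_at lieG _) H').
- move=> a e; apply: MK_arr_wproj.
  + by rewrite Pr !(vproj_scale vKA) Pr.
  + by rewrite MK_src_inverse (vb_mapZ Sv) MK_src_inverse (vb_mapZ Tv).
  + rewrite MK_inv_fst !(sval_wscale vVG vA) /= MK_inv_fst.
    exact: (tmap_scale a mG mG (ginv_smooth_at lieG _)).
Qed.

Lemma MK_src_submersion : submersion (@gsrc R K).
Proof.
apply: (vb_map_submersion vKA vKO MK_src_vb_map).
  by move=> g w; apply: gsrc_surj.
move=> g y yg; have {}yg : foot (sval y).1 = gsrc g by exact: yg.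
have [v vg vy] := gsrc_surj lieG yg.
have [|l lg ly] := vbg_src_surj vL (g := g) (y := (sval y).2).
  by rewrite -MK_foot_obj.
have H : vproj VG v = vproj (varr L) l by rewrite lg.
exists (wpair VG (varr L) v l); first by rewrite [LHS](wproj_wpair H).
by apply: MK_obj_eq; rewrite MK_src (wpairP H) /= vy ly; case: (sval y).
Qed.

Lemma MK_tgt_submersion : submersion (@gtgt R K).
Proof.
apply: (vb_map_submersion vKA vKO MK_tgt_vb_map).
  by move=> g w; apply: gtgt_surj.
move=> g y yg; have {}yg : foot (sval y).1 = gtgt g by exact: yg.
have [v vg vy] := gtgt_surj lieG yg.
have [|l lg ly] := vbg_tgt_surj vL (g := g) (y := (sval y).2).
  by rewrite -MK_foot_obj.
have thv : vproj (varr L) (theta v) = g by rewrite (form_proj fth).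
(* The target map adds [theta v] to the second component, so it is subtracted in advance. *)
pose l' := vadd (varr L) l (vscale (varr L) (-1) (theta v)).
have P1 : vproj (varr L) l = vproj (varr L) (vscale (varr L) (-1) (theta v)).
  by rewrite (vproj_scale vA) thv.
have H : vproj VG v = vproj (varr L) l' by rewrite (vproj_add vA P1) lg.
exists (wpair VG (varr L) v l'); first by rewrite [LHS](wproj_wpair H).
apply: MK_obj_eq; rewrite MK_tgt /ttheta (wpairP H) /= vy.
have -> : vadd (varr L) l' (theta v) = l.
  rewrite /l' -(vaddA vA) ?(vproj_scale vA) ?thv//.
  rewrite (vaddC vA (e' := theta v)) ?(vproj_scale vA)// (vaddN vA) (vaddr0 vA)//.
  by rewrite thv.
by rewrite ly; case: (sval y).
Qed.

Lemma MK_is_liegpd : is_liegpd K.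
Proof.
split.
- by [].
- by split; [exact: MK_src_submersion|exact: MK_tgt_submersion].
- split; first exact: MK_mul_smooth.
  + by apply/smoothP => // e; exact: MK_inv_smooth.
  + by apply/smoothP => // e; exact: MK_unt_smooth.
- split.
  + by move=> e e' H; rewrite MK_src_mul// MK_tgt_mul.
  + by move=> e; rewrite MK_src_inverse MK_tgt_inverse.
  + by move=> x; rewrite MK_src_unt MK_tgt_unt.
- split.
  + exact: MK_mulA.
  + by move=> e; rewrite MK_mul_unt_l MK_mul_unt_r.
  + by move=> e; rewrite MK_mul_inv_l MK_mul_inv_r.
Qed.

(** Linearity of the multiplication is tested by [MK_arr_wproj]: linearity of the source settles the
    [L]-component, and linearity of the tangent multiplication the other one. *)
Lemma MK_is_vbg : is_vbg (MK theta).
Proof.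
have Sv := MK_src_vb_map; have Tv := MK_tgt_vb_map.
have Pr e e' : gsrc e = gtgt e' -> vproj (varr (MK theta)) (gmul e e') =
    gmul (vproj (varr (MK theta)) e) (vproj (varr (MK theta)) e').
  move=> H; rewrite [LHS]/(foot (sval (gmul e e')).1) (MK_mul_fst H).
  exact: (foot_tmul lieG (MK_composable H).1).
split; [|by []|by []|by split; [exact: MK_inv_vb_map|exact: MK_unt_vb_map]|].
  by split; [exact: MK_is_liegpd|exact: lieG].
split; first exact: Pr.
- move=> e1 e2 e1' e2' H1 H2 E E'.
  have H : gsrc (vadd (varr (MK theta)) e1 e2) = gtgt (vadd (varr (MK theta)) e1' e2').
    by rewrite (vb_mapD Sv E) (vb_mapD Tv E') H1 H2.
  have EE : vproj (varr (MK theta)) (gmul e1 e1') = vproj (varr (MK theta)) (gmul e2 e2').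
    by rewrite !Pr// E E'.
  apply: MK_arr_wproj.
  + by rewrite Pr// (vproj_add vKA E) (vproj_add vKA E') (vproj_add vKA EE) Pr.
  + by rewrite MK_src_mul// (vb_mapD Sv E') (vb_mapD Sv EE) !MK_src_mul.
  + rewrite (MK_mul_fst H) (sval_wadd vVG vA E) (sval_wadd vVG vA E').
    rewrite (sval_wadd vVG vA EE) /= (MK_mul_fst H1) (MK_mul_fst H2).
    exact: (tmul_add lieG (MK_composable H1).1 (MK_composable H2).1 E E').
- move=> a e e' H0.
  have H : gsrc (vscale (varr (MK theta)) a e) = gtgt (vscale (varr (MK theta)) a e').
    by rewrite (vb_mapZ Sv) (vb_mapZ Tv) H0.
  apply: MK_arr_wproj.
  + by rewrite Pr// !(vproj_scale vKA) Pr.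
  + by rewrite MK_src_mul// !(vb_mapZ Sv) MK_src_mul.
  + rewrite (MK_mul_fst H) !(sval_wscale vVG vA) /= (MK_mul_fst H0).
    exact: (tmul_scale lieG a (MK_composable H0).1).
Qed.

End MoritaKernel.

Lemma vsubK {R : realType} {E X : mfd R} (V : vb E X) a b : is_vb V ->
  vproj V a = vproj V b -> vadd V (vadd V a (vscale V (-1) b)) b = a.
Proof.
move=> vV ab; rewrite -(vaddA vV) ?(vproj_scale vV)//.
rewrite (vaddC vV (e' := b)) ?(vproj_scale vV)// (vaddN vV) (vaddr0 vV)//.
Qed.

Lemma tmap_pair {R : realType} {X Y Z : mfd R} (f : X -> Y) (g : X -> Z)
    (v : tanm X) : is_mfd X -> is_mfd Y -> is_mfd Z ->
  smooth_at f (foot v) -> smooth_at g (foot v) ->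
  tmap ((fun x => (f x, g x)) : X -> prodm Y Z) v = tpair (tmap f v) (tmap g v).
Proof.
move=> mX mY mZ sf sg; have [c vc] := velocity_curve v mX.
have mP := prodm_mfd mY mZ.
have v1 := velocity_tmap mX mP (smooth_at_pair mX mY mZ sf sg) vc.
have v2 := velocity_pair mY mZ (velocity_tmap mX mY sf vc) (velocity_tmap mX mZ sg vc).
exact: (velocity_uniq mP v1 v2).
Qed.

(** * Morita maps *)

Section LineBundleMorita.
Context {R : realType} (L' L : vbg R)
    (F : gmap (vgpd L') (vgpd L)) (f : gmap (bgpd L') (bgpd L))
    (theta : tanm (arr (bgpd L)) -> arr (vgpd L)).
Hypotheses (lL' : is_lbg L') (lL : is_lbg L) (FM : is_vb_morita F f).
Hypotheses (fth : is_form theta) (mth : is_multiplicative theta).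

Let H := bgpd L'.
Let G := bgpd L.
Let vL' := lbg_vbg lL'.
Let vL := lbg_vbg lL.
Let lieH : is_liegpd H := vbg_base_lie vL'.
Let lieG : is_liegpd G := vbg_base_lie vL.
Let vA' := vbg_varr vL'.
Let vO' := vbg_vobj vL'.
Let vA := vbg_varr vL.
Let vO := vbg_vobj vL.
Let mH : is_mfd (arr H) := vb_base_mfd vA'.
Let mN : is_mfd (obj H) := vb_base_mfd vO'.
Let mG : is_mfd (arr G) := vb_base_mfd vA.
Let mM : is_mfd (obj G) := vb_base_mfd vO.
Let mLA' : is_mfd (arr (vgpd L')) := vb_total_mfd vA'.
Let mLO' : is_mfd (obj (vgpd L')) := vb_total_mfd vO'.
Let mLA : is_mfd (arr (vgpd L)) := vb_total_mfd vA.
Let mLO : is_mfd (obj (vgpd L)) := vb_total_mfd vO.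
Let Ss := vbg_src vL.
Let Tt := vbg_tgt vL.
Let Ss' := vbg_src vL'.
Let Tt' := vbg_tgt vL'.

Let gF : is_gmap F. Proof. by case: FM => _ _ []. Qed.
Let gf : is_gmap f. Proof. by case: FM => _ _ []. Qed.
Let Fa : vb_map (varr L') (varr L) (onarr F) (onarr f).
Proof. by case: FM => _ _ []. Qed.
Let Fo : vb_map (vobj L') (vobj L) (onobj F) (onobj f).
Proof. by case: FM => _ _ []. Qed.

Let sfa (h : arr H) : smooth_at (onarr f) h.
Proof. by case: gf => /(smoothP _ mH). Qed.
Let sfo (x : obj H) : smooth_at (onobj f) x.
Proof. by case: gf => _ /(smoothP _ mN). Qed.
Let f_src (h : arr H) : gsrc (onarr f h) = onobj f (gsrc h).
Proof. by case: gf => _ _ /(_ h)[]. Qed.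
Let f_tgt (h : arr H) : gtgt (onarr f h) = onobj f (gtgt h).
Proof. by case: gf => _ _ /(_ h)[]. Qed.
Let f_mul (h h' : arr H) : gsrc h = gtgt h' ->
  onarr f (gmul h h') = gmul (onarr f h) (onarr f h').
Proof. by case: gf => _ _ _ + _; apply. Qed.
Let f_unt (x : obj H) : onarr f (gunt x) = gunt (onobj f x).
Proof. by case: gf. Qed.
Let F_src (h : arr (vgpd L')) : gsrc (onarr F h) = onobj F (gsrc h).
Proof. by case: gF => _ _ /(_ h)[]. Qed.
Let F_tgt (h : arr (vgpd L')) : gtgt (onarr F h) = onobj F (gtgt h).
Proof. by case: gF => _ _ /(_ h)[]. Qed.
Let F_mul (h h' : arr (vgpd L')) : gsrc h = gtgt h' ->
  onarr F (gmul h h') = gmul (onarr F h) (onarr F h').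
Proof. by case: gF => _ _ _ + _; apply. Qed.
Let F_unt (x : obj (vgpd L')) : onarr F (gunt x) = gunt (onobj F x).
Proof. by case: gF. Qed.

(* The Morita conditions for the base map are those for [F] along the zero
   section. *)
Lemma base_essentially_surjective : essentially_surjective f.
Proof.
have [_ _ _ [_ _ _ _ [es1 es2]]] := FM; split.
  move=> y; have [e [x [ex ey]]] := es1 (vzero (vobj L) y).
  exists (vproj (varr L) e), (vproj (vobj L') x).
  rewrite -(vb_map_proj Ss) -(vb_map_proj Tt) -(vb_map_proj Fo) ex ey.
  by rewrite vzeroK.
move=> g x gx u ug.
have H0 : gsrc (vzero (varr L) g) = onobj F (vzero (vobj L') x).
  by rewrite (vb_map0 vA vO Ss) (vb_map0 vO' vO Fo) gx.
have [|v [w [vg wx vw vu]]] := es2 _ _ H0 (tmap (vzero (vobj L)) u).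
  by rewrite foot_tmap ug (vb_map0 vA vO Tt).
exists (tmap (vproj (varr L)) v), (tmap (vproj (vobj L')) w); split.
- by rewrite foot_tmap vg vzeroK.
- by rewrite foot_tmap wx vzeroK.
- rewrite -(tmap_vb_map_proj vA vO Ss) -(tmap_vb_map_proj vO' vO Fo).
  by congr tmap.
- rewrite -(tmap_vb_map_proj vA vO Tt) vu.
  exact: tmap_vproj_vzero.
Qed.

Let PG := prodm (arr G) (prodm (obj H) (obj H)).
Let Ag : set PG :=
  [set z : PG | gtgt z.1 = onobj f z.2.1 /\ gsrc z.1 = onobj f z.2.2].
Let mNN : is_mfd (prodm (obj H) (obj H)) := prodm_mfd mN mN.
Let mPG : is_mfd PG := prodm_mfd mG mNN.

Lemma base_fully_faithful : fully_faithful f.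
Proof.
have [_ _ _ [_ _ _ [K [sK K1 K2]] _]] := FM.
pose PL := prodm (arr (vgpd L)) (prodm (obj (vgpd L')) (obj (vgpd L'))).
have mLL := prodm_mfd mLO' mLO'.
have mPL : is_mfd PL by apply: prodm_mfd.
pose Z (z : PG) : PL := (vzero (varr L) z.1,
  (vzero (vobj L') z.2.1, vzero (vobj L') z.2.2)).
have sZ z : smooth_at Z z.
  have s1 := smooth_at_fst z mG mNN; have s2 := smooth_at_snd z mG mNN.
  have s21 := smooth_at_fst_comp mPG mN mN s2.
  have s22 := smooth_at_snd_comp mPG mN mN s2.
  apply: (smooth_at_pair mPG mLA mLL).
    exact: (smooth_at_comp mPG mG mLA s1 (smooth_at_vzero vA _)).
  apply: (smooth_at_pair mPG mLO' mLO').
    exact: (smooth_at_comp mPG mN mLO' s21 (smooth_at_vzero vO' _)).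
  exact: (smooth_at_comp mPG mN mLO' s22 (smooth_at_vzero vO' _)).
pose AL : set PL := [set z : PL | gtgt z.1 = onobj F z.2.1 /\ gsrc z.1 = onobj F z.2.2].
have AZ z : Ag z -> AL (Z z).
  move=> [z1 z2]; split; rewrite /Z /=.
    by rewrite (vb_map0 vA vO Tt) (vb_map0 vO' vO Fo) z1.
  by rewrite (vb_map0 vA vO Ss) (vb_map0 vO' vO Fo) z2.
exists (fun z => vproj (varr L') (K (Z z))); split.
- apply/smooth_subP => // z Az.
  have [e se ne] := (smooth_subP _ _ mPL mLA').1 sK (Z z) (AZ z Az).
  have seZ : smooth_at (fun z => e (Z z)) z.
    exact: (smooth_at_comp mPG mPL mLA' (sZ z) se).
  exists (fun z => vproj (varr L') (e (Z z))).
    exact: (smooth_at_proj vA' mPG seZ).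
  have := mnbhs_preim mPG mPL (sZ z) ne; apply: mnbhsS => q /= Hq Aq.
  by rewrite Hq//; exact: AZ.
- move=> h; rewrite /Z /=.
  rewrite -(vb_map0 vA' vA Fa) -(vb_map0 vA' vO' Tt') -(vb_map0 vA' vO' Ss') K1.
  by rewrite vzeroK.
- move=> z Az; have := K2 (Z z) (AZ z Az); rewrite /Z => -[E1 E2 E3].
  rewrite -(vb_map_proj Fa) -(vb_map_proj Tt') -(vb_map_proj Ss') E1 E2 E3.
  by rewrite !vzeroK; case: (z) => a [].
Qed.

(** Surjectivity on the fibre over [x] is shown at the unit arrow of [f x]. For [m] over [f x] there
    is [xi0] over this unit with source [m], and essential surjectivity of [F] along the zero
    sections yields [xi] with the target of [xi0] and source [F eta]. As [gtgt] is injective on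
    fibres, [xi = xi0], hence [m = F eta]. In rank one surjectivity gives injectivity. *)
Lemma morita_obj_inj y y' : vproj (vobj L') y = vproj (vobj L') y' ->
  onobj F y = onobj F y' -> y = y'.
Proof.
have [_ _ _ [_ _ _ _ [_ es2]]] := FM.
case: (lL') => _ _ r1; case: (lL) => _ _ r2 yy.
apply: (line_surj_inj vO' vO r1 r2 Fo (x := vproj (vobj L') y)) => // m mx.
set x := vproj (vobj L') y in mx *.
pose g := gunt (onobj f x) : arr G.
have [|xi0 xi0g xi0m] := vbg_src_surj vL (g := g) (y := m).
  by rewrite mx (gsrc_gunt lieG).
have [||xi [eta [xig etax xieta xit]]] :=
  @vb_fibre_product_fibre_surj _ _ _ _ _ _ _ _ _ _ vA vO' vO _ _ _ _ _ _
    Ss Tt Fo g x (gtgt xi0).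
- move=> w wg; apply: es2 => //.
  by rewrite (vb_map0 vA vO Ss) (vb_map0 vO' vO Fo) (gsrc_gunt lieG).
- by rewrite (vb_map_proj Tt) xi0g.
have E : xi = xi0 by apply: (lbg_tgt_inj lL); rewrite ?xig ?xi0g.
by exists eta; rewrite // -xieta E.
Qed.

Lemma morita_arr_inj e e' : vproj (varr L') e = vproj (varr L') e' ->
  onarr F e = onarr F e' -> e = e'.
Proof.
move=> ee E; apply: (lbg_src_inj lL') => //; apply: morita_obj_inj.
  by rewrite !(vb_map_proj Ss') ee.
by rewrite -!F_src E.
Qed.

Let th' := pullform F f theta.

Lemma pullform_proj_mapP v : vproj (varr L') (th' v) = foot v /\
  onarr F (th' v) = theta (tmap (onarr f) v).
Proof.
case: (lL') => _ r1 _; case: (lL) => _ r2 _.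
apply: (fibinvP vA' vA r1 r2 Fa morita_arr_inj).
by rewrite (form_proj fth) foot_tmap.
Qed.

Let th'_proj v : vproj (varr L') (th' v) = foot v.
Proof. exact: (pullform_proj_mapP v).1. Qed.
Let th'_map v : onarr F (th' v) = theta (tmap (onarr f) v).
Proof. exact: (pullform_proj_mapP v).2. Qed.

Lemma pullform_is_form : is_form th'.
Proof.
case: (lL') => _ r1 _; case: (lL) => _ r2 _; have mTH := tanm_mfd mH.
split.
- apply/smoothP => // v.
  apply: (smooth_at_fibinv vA' vA r1 r2 Fa morita_arr_inj mTH (smooth_at_foot v mH)).
    exact: (smooth_at_comp mTH (tanm_mfd mG) mLA (smooth_at_tmap mH mG (sfa _))
      (form_smooth_at lL fth _)).
  refine (@mnbhsW R (tanm (arr H)) _ _ mTH _) => q.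
  by rewrite (form_proj fth) foot_tmap.
- by apply/smoothP => // h; exact: smooth_at_id.
- exact: th'_proj.
- move=> v w vw; have {}vw : foot v = foot w by exact: vw.
  have [Fv _] := tadd_spec vw.
  have P : vproj (varr L') (th' v) = vproj (varr L') (th' w) by rewrite !th'_proj.
  apply: morita_arr_inj; first by rewrite th'_proj (vproj_add vA' P) th'_proj.
  rewrite th'_map (vb_mapD Fa P) !th'_map (tmap_add mH mG (sfa _) vw).
  by apply: (vb_mapD fth); rewrite /= !foot_tmap vw.
- move=> a v; have [Fv _] := tscale_spec a v.
  apply: morita_arr_inj; first by rewrite th'_proj (vproj_scale vA') th'_proj.
  rewrite th'_map (vb_mapZ Fa) th'_map (tmap_scale a mH mG (sfa _)).
  exact: (vb_mapZ fth).
Qed.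

Let tmap_src (v : tanm (arr H)) :
  tmap (@gsrc R G) (tmap (onarr f) v) = tmap (onobj f) (tmap (@gsrc R H) v).
Proof.
rewrite -(tmap_comp mH mG mM (sfa _) (gsrc_smooth_at lieG _)).
rewrite -(tmap_comp mH mN mM (gsrc_smooth_at lieH _) (sfo _)).
by congr tmap; apply/funext => h; rewrite f_src.
Qed.

Let tmap_tgt (v : tanm (arr H)) :
  tmap (@gtgt R G) (tmap (onarr f) v) = tmap (onobj f) (tmap (@gtgt R H) v).
Proof.
rewrite -(tmap_comp mH mG mM (sfa _) (gtgt_smooth_at lieG _)).
rewrite -(tmap_comp mH mN mM (gtgt_smooth_at lieH _) (sfo _)).
by congr tmap; apply/funext => h; rewrite f_tgt.
Qed.

Let tmap_unt (v : tanm (obj H)) :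
  tmap (onarr f) (tmap (@gunt R H) v) = tmap (@gunt R G) (tmap (onobj f) v).
Proof.
rewrite -(tmap_comp mN mH mG (gunt_smooth_at lieH _) (sfa _)).
rewrite -(tmap_comp mN mM mG (sfo _) (gunt_smooth_at lieG _)).
by congr tmap; apply/funext => h; rewrite f_unt.
Qed.

Let tmap_mul (v v' : tanm (arr H)) :
  tmap (@gsrc R H) v = tmap (@gtgt R H) v' ->
  tmap (onarr f) (@gmul R (tgpd H) v v') =
  @gmul R (tgpd G) (tmap (onarr f) v) (tmap (onarr f) v').
Proof.
move=> E; have [c vc] := velocity_curve v' mH.
have [b vb bc] := composable_lift lieH E vc.
have vbc := velocity_tmap mH mG (sfa _) (velocity_gmul lieH vb vc bc).
have vb' := velocity_tmap mH mG (sfa _) vb; have vc' := velocity_tmap mH mG (sfa _) vc.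
have bc' : \forall t \near (0 : R), gsrc (onarr f (b t)) = gtgt (onarr f (c t)).
  by apply: filterS bc => t bct; rewrite f_src f_tgt bct.
apply: (velocity_uniq mG vbc).
apply: velocity_germ (velocity_gmul lieG vb' vc' bc').
by apply: filterS bc => t bct; rewrite f_mul.
Qed.

(** [F x F] carries the three elements over a pair of vectors to those for [theta] over the image
    pair. Since [F] is linear and injective on fibres, vanishing of the alternating sums can be
    tested after applying it. *)
Lemma pullform_is_multiplicative : is_multiplicative th'.
Proof.
move=> v v' E over a b c oa ob oc Ea Eb Ec alt.
have E' : tmap (@gsrc R G) (tmap (onarr f) v) = tmap (@gtgt R G) (tmap (onarr f) v').
  by rewrite tmap_src tmap_tgt; congr tmap.
pose FF (p : prodm (arr (vgpd L')) (arr (vgpd L'))) :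
  prodm (arr (vgpd L)) (arr (vgpd L)) := (onarr F p.1, onarr F p.2).
pose overF (p : prodm (arr (vgpd L)) (arr (vgpd L))) :=
  [/\ composable (vgpd L) p, vproj (varr L) p.1 = foot (tmap (onarr f) v) &
    vproj (varr L) p.2 = foot (tmap (onarr f) v')].
have oF p : over p -> overF (FF p).
  move=> [p0 p1 p2]; split.
  - by rewrite /composable /= F_src F_tgt p0.
  - by rewrite /= (vb_map_proj Fa) p1 foot_tmap.
  - by rewrite /= (vb_map_proj Fa) p2 foot_tmap.
have Ea' : (FF a).2 = theta (tmap (onarr f) v') by rewrite /= Ea th'_map.
have Eb' : gmul (FF b).1 (FF b).2 =
    theta (@gmul R (tgpd G) (tmap (onarr f) v) (tmap (onarr f) v')).
  have [bb _ _] := ob.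
  by rewrite /= -F_mul// Eb th'_map tmap_mul.
have Ec' : (FF c).1 = theta (tmap (onarr f) v) by rewrite /= Ec th'_map.
have [H1 H2] := mth E' (oF a oa) (oF b ob) (oF c oc) Ea' Eb' Ec'.
have [_ a1 a2] := oa; have [_ b1 b2] := ob; have [_ c1 c2] := oc.
have key x y z h : vproj (varr L') x = h -> vproj (varr L') y = h ->
    vproj (varr L') z = h ->
    vadd (varr L) (vadd (varr L) (onarr F x) (vscale (varr L) (-1) (onarr F y)))
      (onarr F z) = vzero (varr L) (onarr f h) ->
    alt x y z = vzero (varr L') h.
  move=> xh yh zh; have P1 : vproj (varr L') x = vproj (varr L') (vscale (varr L') (-1) y).
    by rewrite (vproj_scale vA') xh yh.
  have P2 : vproj (varr L') (vadd (varr L') x (vscale (varr L') (-1) y)) = vproj (varr L') z.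
    by rewrite (vproj_add vA' P1) xh zh.
  rewrite -(vb_mapZ Fa) -(vb_mapD Fa P1) -(vb_mapD Fa P2) -(vb_map0 vA' vA Fa).
  apply: morita_arr_inj.
  by rewrite (vproj_add vA' P2) P2 zh vzeroK.
split.
- by apply: key => //; rewrite -foot_tmap.
- by apply: key => //; rewrite -foot_tmap.
Qed.

Let fth' : is_form th' := pullform_is_form.
Let mth' : is_multiplicative th' := pullform_is_multiplicative.
Let K' := vgpd (MK th').
Let K := vgpd (MK theta).
Let VG := tvb (arr G).
Let VM := tvb (obj G).
Let VH := tvb (arr H).
Let VN := tvb (obj H).
Let vVG : is_vb VG := tvb_is_vb mG.
Let vVM : is_vb VM := tvb_is_vb mM.
Let vVH : is_vb VH := tvb_is_vb mH.
Let vVN : is_vb VN := tvb_is_vb mN.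
Let mKA : is_mfd (arr K) := whitney_mfd vVG vA.
Let mKA' : is_mfd (arr K') := whitney_mfd vVH vA'.
Let mKO' : is_mfd (obj K') := whitney_mfd vVN vO'.
Let vKA : is_vb (varr (MK theta)) := whitney_is_vb vVG vA.
Let vKO : is_vb (vobj (MK theta)) := whitney_is_vb vVM vO.
Let vKO' : is_vb (vobj (MK th')) := whitney_is_vb vVN vO'.
Let MF : gmap K' K := MKmap F f theta.

Let K'_arr_pr (e : arr K') : vproj VG (tmap (onarr f) (sval e).1) =
  vproj (varr L) (onarr F (sval e).2).
Proof. by rewrite (vb_map_proj Fa) -MK_foot; exact: foot_tmap. Qed.

Let K'_obj_pr (x : obj K') : vproj VM (tmap (onobj f) (sval x).1) =
  vproj (vobj L) (onobj F (sval x).2).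
Proof. by rewrite (vb_map_proj Fo) -MK_foot_obj; exact: foot_tmap. Qed.

Lemma MKmap_arr (e : arr K') :
  sval (onarr MF e) = (tmap (onarr f) (sval e).1, onarr F (sval e).2).
Proof. exact: (wpairP (V := VG) (V' := varr L) (K'_arr_pr e)). Qed.

Lemma MKmap_obj (x : obj K') :
  sval (onobj MF x) = (tmap (onobj f) (sval x).1, onobj F (sval x).2).
Proof. exact: (wpairP (V := VM) (V' := vobj L) (K'_obj_pr x)). Qed.

Lemma MKmap_arr_proj (e : arr K') :
  vproj (varr (MK theta)) (onarr MF e) = onarr f (foot (sval e).1).
Proof.
rewrite [LHS]/(foot (sval (onarr MF e)).1) (congr1 fst (MKmap_arr e)).
exact: foot_tmap.
Qed.

Lemma MKmap_obj_proj (x : obj K') :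
  vproj (vobj (MK theta)) (onobj MF x) = onobj f (foot (sval x).1).
Proof.
rewrite [LHS]/(foot (sval (onobj MF x)).1) (congr1 fst (MKmap_obj x)).
exact: foot_tmap.
Qed.

Lemma MKmap_arr_vb_map :
  vb_map (varr (MK th')) (varr (MK theta)) (onarr MF) (onarr f).
Proof.
split.
- apply/smoothP => // e; apply: (smooth_at_wpair vVG vA (z := e) mKA').
  + exact: (smooth_at_tmap_comp mKA' mH mG (smooth_at_wfst vVH vA' e) (sfa _)).
  + exact: (smooth_at_comp mKA' mLA' mLA (smooth_at_wsnd vVH vA' e)
      (vb_map_smooth_at vA' Fa _)).
  + refine (@mnbhsW R (arr K') _ _ mKA' _) => q; exact: K'_arr_pr.
- by case: gf.
- exact: MKmap_arr_proj.
- move=> e e' E; have E1 : foot (sval e).1 = foot (sval e').1 by exact: E.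
  have E2 : vproj (varr L') (sval e).2 = vproj (varr L') (sval e').2.
    by rewrite -!MK_foot.
  have EF : vproj (varr (MK theta)) (onarr MF e) = vproj (varr (MK theta)) (onarr MF e').
    by rewrite !MKmap_arr_proj E1.
  apply: wpt_eq; rewrite (sval_wadd vVG vA EF) !MKmap_arr (sval_wadd vVH vA' E) /=.
    exact: (tmap_add mH mG (sfa _) E1).
  exact: (vb_mapD Fa E2).
- move=> a e; apply: wpt_eq; rewrite (sval_wscale vVG vA) !MKmap_arr (sval_wscale vVH vA') /=.
    exact: (tmap_scale a mH mG (sfa _)).
  exact: (vb_mapZ Fa).
Qed.

Lemma MKmap_obj_vb_map :
  vb_map (vobj (MK th')) (vobj (MK theta)) (onobj MF) (onobj f).
Proof.
split.
- apply/smoothP => // e; apply: (smooth_at_wpair vVM vO (z := e) mKO').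
  + exact: (smooth_at_tmap_comp mKO' mN mM (smooth_at_wfst vVN vO' e) (sfo _)).
  + exact: (smooth_at_comp mKO' mLO' mLO (smooth_at_wsnd vVN vO' e)
      (vb_map_smooth_at vO' Fo _)).
  + refine (@mnbhsW R (obj K') _ _ mKO' _) => q; exact: K'_obj_pr.
- by case: gf.
- exact: MKmap_obj_proj.
- move=> e e' E; have E1 : foot (sval e).1 = foot (sval e').1 by exact: E.
  have E2 : vproj (vobj L') (sval e).2 = vproj (vobj L') (sval e').2.
    by rewrite -!MK_foot_obj.
  have EF : vproj (vobj (MK theta)) (onobj MF e) = vproj (vobj (MK theta)) (onobj MF e').
    by rewrite !MKmap_obj_proj E1.
  apply: wpt_eq; rewrite (sval_wadd vVM vO EF) !MKmap_obj (sval_wadd vVN vO' E) /=.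
    exact: (tmap_add mN mM (sfo _) E1).
  exact: (vb_mapD Fo E2).
- move=> a e; apply: wpt_eq; rewrite (sval_wscale vVM vO) !MKmap_obj (sval_wscale vVN vO') /=.
    exact: (tmap_scale a mN mM (sfo _)).
  exact: (vb_mapZ Fo).
Qed.

Lemma MKmap_tgt_snd (e : arr K') :
  gtgt (vadd (varr L) (onarr F (sval e).2) (theta (tmap (onarr f) (sval e).1))) =
  onobj F (gtgt (vadd (varr L') (sval e).2 (th' (sval e).1))).
Proof.
rewrite -th'_map -(vb_mapD Fa) ?F_tgt//.
by rewrite th'_proj MK_foot.
Qed.

Lemma MKmap_src (e : arr K') : gsrc (onarr MF e) = onobj MF (gsrc e).
Proof.
apply: MK_obj_eq; rewrite (MK_src lL) MKmap_obj (MK_src lL') MKmap_arr /=.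
by rewrite F_src tmap_src.
Qed.

Lemma MKmap_tgt (e : arr K') : gtgt (onarr MF e) = onobj MF (gtgt e).
Proof.
apply: MK_obj_eq; rewrite (MK_tgt lL fth) MKmap_obj (MK_tgt lL' fth') MKmap_arr /=.
by rewrite MKmap_tgt_snd tmap_tgt.
Qed.

Lemma MKmap_is_gmap : is_gmap MF.
Proof.
split.
- by case: MKmap_arr_vb_map.
- by case: MKmap_obj_vb_map.
- by move=> e; rewrite MKmap_src MKmap_tgt.
- move=> e e' E.
  have EF : gsrc (onarr MF e) = gtgt (onarr MF e') by rewrite MKmap_src MKmap_tgt E.
  apply: (MK_arr_eq lL).
    rewrite MKmap_arr (MK_mul lL fth EF) (MK_mul lL' fth' E) !MKmap_arr /=.
    exact: (tmap_mul (MK_composable lL' fth' E).1).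
  have S1 (a : arr K) : gsrc (sval a).2 = (sval (gsrc a)).2 by rewrite (MK_src lL).
  rewrite !S1 MKmap_src (MK_src_mul lL fth EF) (MK_src_mul lL' fth' E).
  by rewrite MKmap_src.
- move=> x; apply: wpt_eq; rewrite MKmap_arr (MK_unt lL) (MK_unt lL') MKmap_obj /=.
    exact: tmap_unt.
  exact: F_unt.
Qed.

Lemma MKmap_essentially_surjective : essentially_surjective MF.
Proof.
have [es1 es2] := base_essentially_surjective.
case: (lL') => _ _ r1; case: (lL) => _ _ r2.
have obj_surj x m : vproj (vobj L) m = onobj f x ->
    exists2 m', vproj (vobj L') m' = x & onobj F m' = m.
  apply: (line_inj_surj vO' vO r1 r2 Fo) => m1 m2 m1x m2x.
  by apply: morita_obj_inj; rewrite m1x m2x.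
have tgt_surj (v : tanm (arr G)) y : vproj (vobj L) y = gtgt (foot v) ->
    exists2 l, vproj (varr L) l = foot v & gtgt (vadd (varr L) l (theta v)) = y.
  move=> yv; have [l lv ly] := vbg_tgt_surj vL yv.
  have P : vproj (varr L) l = vproj (varr L) (theta v) by rewrite (form_proj fth).
  exists (vadd (varr L) l (vscale (varr L) (-1) (theta v))); last by rewrite (vsubK vA P).
  by rewrite (vproj_add vA)// (vproj_scale vA).
split.
  move=> y; have [g [x [gx gy]]] := es1 (foot (sval y).1).
  have [v [w [vg wx vw vy]]] := es2 g x gx (sval y).1 (esym gy).
  have [|l lv ly] := tgt_surj v (sval y).2; first by rewrite -MK_foot_obj vg gy.
  have [|m mx ml] := obj_surj x (gsrc l).
    by rewrite (vb_map_proj Ss) lv vg gx.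
  have W1 : vproj VG v = vproj (varr L) l by rewrite lv.
  have W2 : vproj VN w = vproj (vobj L') m by rewrite mx -wx.
  exists (wpair VG (varr L) v l), (wpair VN (vobj L') w m); split.
    apply: MK_obj_eq; rewrite (MK_src lL) MKmap_obj (wpairP W1) (wpairP W2) /=.
    by rewrite vw ml.
  by apply: MK_obj_eq; rewrite (MK_tgt lL fth) (wpairP W1) /= vy ly; case: (sval y).
move=> e e' ee' w we.
apply: (vb_fibre_product_submersion vKA vKO' vKO (MK_src_vb_map theta lL)
  (MK_tgt_vb_map lL fth) MKmap_obj_vb_map) => //.
  have ge : gsrc (foot (sval e).1) = onobj f (foot (sval e').1).
    by rewrite -(MK_src_proj lL) ee' MKmap_obj_proj.
  by move=> u ue; exact: es2 _ _ ge u ue.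
have ge : gsrc (foot (sval e).1) = onobj f (foot (sval e').1).
  by rewrite -(MK_src_proj lL) ee' MKmap_obj_proj.
set g := foot (sval e).1 in ge *; set x := foot (sval e').1 in ge *.
move=> b1 b2 b1g b2g.
have {}b1g : foot (sval b1).1 = gsrc g by exact: b1g.
have {}b2g : foot (sval b2).1 = gtgt g by exact: b2g.
(* The tangent part is solved by [v0 + v1]: the source of [v0] is the tangent part of [b1], while
   [v1], from essential surjectivity of [f], has its source in the image of the tangent map of [f]
   and brings the target to that of [b2]. *)
have [v0 v0g v0b] := gsrc_surj lieG b1g.
have P0 : vproj VM (sval b2).1 = vproj VM (vscale VM (-1) (tmap (@gtgt R G) v0)).
  by rewrite (vproj_scale vVM) [LHS]b2g [RHS]foot_tmap v0g.
pose u := vadd VM (sval b2).1 (vscale VM (-1) (tmap (@gtgt R G) v0)).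
have ug : foot u = gtgt g by rewrite -b2g; exact: (vproj_add vVM P0).
have [v1 [w' [v1g w'x v1w v1u]]] := es2 g x ge u ug.
have v01 : foot v0 = foot v1 by rewrite v0g v1g.
pose v := tadd v0 v1.
have [vg _] := tadd_spec v01; rewrite v0g in vg.
have sv : tmap (@gsrc R G) v = vadd VM (sval b1).1 (tmap (onobj f) w').
  by rewrite /v (tmap_add mG mM (gsrc_smooth_at lieG _) v01) v0b v1w.
have tv : tmap (@gtgt R G) v = (sval b2).1.
  rewrite /v (tmap_add mG mM (gtgt_smooth_at lieG _) v01) v1u.
  have PP : vproj VM (sval b2).1 = vproj VM (tmap (@gtgt R G) v0).
    by rewrite P0 (vproj_scale vVM).
  rewrite -[RHS](vsubK vVM PP); apply: (vaddC vVM).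
  by rewrite (vproj_add vVM P0) PP.
(* In the [L]-part the target condition gives [l], and [m] is the preimage under [F] of the
   difference between the source of [l] and the [L]-part of [b1]. *)
have [|l lv lb] := tgt_surj v (sval b2).2.
  by rewrite -MK_foot_obj b2g /v vg.
have lbp : vproj (vobj L) (gsrc l) = vproj (vobj L) (sval b1).2.
  by rewrite (vb_map_proj Ss) lv -MK_foot_obj b1g /v vg.
have lbp' : vproj (vobj L) (gsrc l) =
    vproj (vobj L) (vscale (vobj L) (-1) (sval b1).2) by rewrite (vproj_scale vO).
have [|m mx ml] := obj_surj x (vadd (vobj L) (gsrc l) (vscale (vobj L) (-1) (sval b1).2)).
  by rewrite (vproj_add vO lbp') (vb_map_proj Ss) lv /v vg ge.
have W1 : vproj VG v = vproj (varr L) l by rewrite lv.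
have W2 : vproj VN w' = vproj (vobj L') m by rewrite mx -w'x.
have S1 := wpairP W1; have S2 := wpairP W2.
exists (wpair VG (varr L) v l), (wpair VN (vobj L') w' m); split.
- by rewrite [LHS](wproj_wpair W1) [LHS]vg.
- by rewrite [LHS](wproj_wpair W2) [LHS]w'x.
- have Eb : vproj (vobj (MK theta)) b1 =
      vproj (vobj (MK theta)) (onobj MF (wpair VN (vobj L') w' m)).
    by rewrite MKmap_obj_proj S2 w'x -ge; exact: b1g.
  apply: MK_obj_eq; rewrite (sval_wadd vVM vO Eb) MKmap_obj (MK_src lL) S1 S2.
  congr pair; first exact: sv.
  rewrite -[LHS](vsubK vO lbp) [onobj F _]ml; apply: (vaddC vO).
  by rewrite (vproj_add vO lbp') lbp.
- by apply: MK_obj_eq; rewrite (MK_tgt lL fth) S1 /= tv lb; case: (sval b2).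
Qed.

(** [Ag] is the equalizer of [(t, s)] and [f x f]. Transversality is checked in two steps: a vector
    with the prescribed source, then a correction of the target from essential surjectivity, whose
    source lies in the image of the tangent map of [f] and is absorbed by the last factor of the
    product. *)
Lemma tangent_fibre_product (v : tanm (arr G)) (w1 w2 : tanm (obj H)) :
  tmap (@gtgt R G) v = tmap (onobj f) w1 ->
  tmap (@gsrc R G) v = tmap (onobj f) w2 ->
  tangent_to Ag (tpair v (tpair w1 w2)).
Proof.
move=> E1 E2; have [_ es2] := base_essentially_surjective.
have mMM := prodm_mfd mM mM.
pose u : tanm PG := tpair v (tpair w1 w2).
have Fu : foot u = (foot v, (foot w1, foot w2)) by rewrite /u !foot_tpair.
pose P (z : PG) : prodm (obj G) (obj G) := (gtgt z.1, gsrc z.1).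
pose Q (z : PG) : prodm (obj G) (obj G) := (onobj f z.2.1, onobj f z.2.2).
have s1 z := @smooth_at_fst R _ _ z mG mNN; have s2 z := @smooth_at_snd R _ _ z mG mNN.
have s21 z := smooth_at_fst_comp mPG mN mN (s2 z).
have s22 z := smooth_at_snd_comp mPG mN mN (s2 z).
have sP1 z : smooth_at ((fun z => gtgt z.1) : PG -> obj G) z.
  exact: (smooth_at_comp mPG mG mM (s1 z) (gtgt_smooth_at lieG _)).
have sP2 z : smooth_at ((fun z => gsrc z.1) : PG -> obj G) z.
  exact: (smooth_at_comp mPG mG mM (s1 z) (gsrc_smooth_at lieG _)).
have sQ1 z : smooth_at ((fun z => onobj f z.2.1) : PG -> obj G) z.
  exact: (smooth_at_comp mPG mN mM (s21 z) (sfo _)).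
have sQ2 z : smooth_at ((fun z => onobj f z.2.2) : PG -> obj G) z.
  exact: (smooth_at_comp mPG mN mM (s22 z) (sfo _)).
have sP z : smooth_at P z by exact: smooth_at_pair.
have sQ z : smooth_at Q z by exact: smooth_at_pair.
have dP a b c : tmap P (tpair a (tpair b c)) =
    tpair (tmap (@gtgt R G) a) (tmap (@gsrc R G) a).
  rewrite (tmap_pair mPG mM mM (sP1 _) (sP2 _)); congr tpair.
    rewrite (tmap_comp mPG mG mM (s1 _) (gtgt_smooth_at lieG _)).
    by rewrite (tpair_fst _ _ mG mNN).
  rewrite (tmap_comp mPG mG mM (s1 _) (gsrc_smooth_at lieG _)).
  by rewrite (tpair_fst _ _ mG mNN).
have dQ a b c : tmap Q (tpair a (tpair b c)) =
    tpair (tmap (onobj f) b) (tmap (onobj f) c).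
  rewrite (tmap_pair mPG mM mM (sQ1 _) (sQ2 _)); congr tpair.
    rewrite (tmap_comp mPG mN mM (s21 _) (sfo _)).
    rewrite (tmap_comp mPG mNN mN (s2 _) (smooth_at_fst _ mN mN)).
    by rewrite (tpair_snd _ _ mG mNN) (tpair_fst _ _ mN mN).
  rewrite (tmap_comp mPG mN mM (s22 _) (sfo _)).
  rewrite (tmap_comp mPG mNN mN (s2 _) (smooth_at_snd _ mN mN)).
  by rewrite (tpair_snd _ _ mG mNN) (tpair_snd _ _ mN mN).
have F1 : gtgt (foot v) = onobj f (foot w1).
  by have := congr1 (@foot _ _) E1; rewrite !foot_tmap.
have F2 : gsrc (foot v) = onobj f (foot w2).
  by have := congr1 (@foot _ _) E2; rewrite !foot_tmap.
have [j1 j1P] := chart_cover (gtgt (foot v)) mM.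
have [j2 j2P] := chart_cover (gsrc (foot v)) mM.
have [||||gamma vg ng] := @velocity_equalizer R PG (prodm (obj G) (obj G)) P Q u
  (j1, j2) mPG mMM (sP _) (sQ _).
- by rewrite Fu /P /Q /= F1 F2.
- by rewrite Fu.
- move=> a.
  have [b bs bj] := tangent_ex (rsubmx a) mM j2P.
  have [v0 v0g v0b] := gsrc_surj lieG bs.
  have [c ct cj] := tangent_ex (lsubmx a - comps (tmap (@gtgt R G) v0) j1) mM j1P.
  have [v1 [w [v1g wx v1w v1c]]] := es2 _ _ F2 c ct.
  have v01 : foot v0 = foot v1 by rewrite v0g v1g.
  have [Fv _] := tadd_spec v01; rewrite v0g in Fv.
  exists (tpair (tadd v0 v1) (tpair (tzero (foot w1)) w)).
    by rewrite Fu !foot_tpair// Fv wx.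
  rewrite dP dQ.
  have T1 : tmap (@gtgt R G) (tadd v0 v1) = tadd (tmap (@gtgt R G) v0) c.
    by rewrite (tmap_add mG mM (gtgt_smooth_at lieG _) v01) v1c.
  have T2 : tmap (@gsrc R G) (tadd v0 v1) = tadd b (tmap (onobj f) w).
    by rewrite (tmap_add mG mM (gsrc_smooth_at lieG _) v01) v0b v1w.
  have C1 : foot (tmap (@gtgt R G) v0) = foot c by rewrite foot_tmap v0g ct.
  have C2 : foot b = foot (tmap (onobj f) w) by rewrite foot_tmap wx bs.
  have [G1 H1] := tadd_spec C1; have [G2 H2] := tadd_spec C2.
  rewrite T1 T2 (tmap_tzero mN mM (sfo _)) (tpair_comps mM mM); first last.
  + by rewrite G2 bs.
  + by rewrite G1 C1 ct.
  rewrite (tpair_comps mM mM); first last.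
  + by rewrite foot_tmap wx -F2.
  + by rewrite -F1.
  rewrite H1 H2 cj bj.
  rewrite opp_row_mx add_row_mx -[RHS]hsubmxK; congr row_mx.
    by rewrite subr0 addrC subrK.
  by rewrite addrK.
- by rewrite /u dP dQ E1 E2.
exists gamma; first exact: vg.
by apply: filterS ng => t; rewrite /P /Q => -[].
Qed.

Lemma MKmap_fully_faithful : fully_faithful MF.
Proof.
have [Kf [sKf Kf1 Kf2]] := base_fully_faithful.
case: (lL') => _ r1 _; case: (lL) => _ r2 _.
have mKK := prodm_mfd mKO' mKO'; have mPK := prodm_mfd mKA mKK.
pose PK := prodm (arr K) (prodm (obj K') (obj K')).
pose A := [set z : PK | gtgt z.1 = onobj MF z.2.1 /\ gsrc z.1 = onobj MF z.2.2].
pose pt (z : PK) : PG := (foot (sval z.1).1, (foot (sval z.2.1).1, foot (sval z.2.2).1)).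
pose tz (z : PK) : tanm PG := tpair (sval z.1).1 (tpair (sval z.2.1).1 (sval z.2.2).1).
have foot_tz z : foot (tz z) = pt z by rewrite /tz !foot_tpair.
have AE z : A z -> [/\ tmap (@gtgt R G) (sval z.1).1 = tmap (onobj f) (sval z.2.1).1,
    gtgt (vadd (varr L) (sval z.1).2 (theta (sval z.1).1)) = onobj F (sval z.2.1).2,
    tmap (@gsrc R G) (sval z.1).1 = tmap (onobj f) (sval z.2.2).1 &
    gsrc (sval z.1).2 = onobj F (sval z.2.2).2].
  move=> [/(congr1 sval) + /(congr1 sval)].
  by rewrite (MK_tgt lL fth) (MK_src lL) !MKmap_obj => -[? ?] [? ?].
have Atan z : A z -> tangent_to Ag (tz z).
  by move=> /AE[? _ ? _]; apply: tangent_fibre_product.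
have Apt z : A z -> Ag (pt z).
  move=> /Atan[c vc Ac]; rewrite -foot_tz -vc.1; exact: nbhs_singleton Ac.
have fKf z : A z -> onarr f (Kf (pt z)) = foot (sval z.1).1.
  by move=> Az; exact: (congr1 fst (Kf2 _ (Apt _ Az))).
(* The tangent map of [Kf] along the subset [Ag]; at [tz z] it does not depend on the local
   extension, because [Atan] makes this vector tangent to [Ag]. *)
pose k (z : PK) : tanm (arr H) := tmap_sub Ag Kf (tz z).
have foot_k z : A z -> foot (k z) = Kf (pt z).
  move=> Az; have [c vc Ac] := Atan z Az.
  by rewrite -(velocity_tmap_sub mPG mH sKf vc Ac).1 vc.1 foot_tz.
have lP z : A z -> vproj (varr L) (sval z.1).2 = onarr f (Kf (pt z)).
  by move=> Az; rewrite fKf// MK_foot.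
pose lam (z : PK) := fibinv (varr L') (onarr F) (Kf (pt z)) (sval z.1).2.
have lamP z : A z -> vproj (varr L') (lam z) = Kf (pt z) /\ onarr F (lam z) = (sval z.1).2.
  by move=> /lP; apply: (fibinvP vA' vA r1 r2 Fa morita_arr_inj).
pose KK (z : PK) : arr K' := wpair VH (varr L') (k z) (lam z).
have KKE z : A z -> sval (KK z) = (k z, lam z).
  by move=> Az; apply: wpairP; rewrite (lamP z Az).1; exact: foot_k.
exists KK; split.
- apply/smooth_subP => // z0 Az0.
  have [e0 He0] := sKf _ (Apt z0 Az0).
  have [se0 ne0] := (local_extP _ _ _ _ mPG mH).1 He0.
  have e0E : e0 (pt z0) = Kf (pt z0).
    by have := mnbhs_singleton ne0; apply; exact: Apt.
  have JP : vproj (varr L) (sval z0.1).2 = onarr f (e0 (pt z0)) by rewrite e0E lP.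
  have [J sJ nJ] := fibinv_local_ext vA' vA r1 r2 Fa morita_arr_inj JP.
  have s1 := smooth_at_fst z0 mKA mKK; have s2 := smooth_at_snd z0 mKA mKK.
  have s21 := smooth_at_fst_comp mPK mKO' mKO' s2.
  have s22 := smooth_at_snd_comp mPK mKO' mKO' s2.
  have t1 : smooth_at ((fun z => (sval z.1).1) : PK -> tanm (arr G)) z0.
    exact: (smooth_at_wfst_comp vVG vA mPK s1).
  have t21 : smooth_at ((fun z => (sval z.2.1).1) : PK -> tanm (obj H)) z0.
    exact: (smooth_at_wfst_comp vVN vO' mPK s21).
  have t22 : smooth_at ((fun z => (sval z.2.2).1) : PK -> tanm (obj H)) z0.
    exact: (smooth_at_wfst_comp vVN vO' mPK s22).
  have sl : smooth_at ((fun z => (sval z.1).2) : PK -> arr (vgpd L)) z0.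
    exact: (smooth_at_wsnd_comp vVG vA mPK s1).
  have spt : smooth_at pt z0.
    apply: (smooth_at_pair mPK mG mNN).
      exact: (smooth_at_foot_comp mPK mG t1).
    apply: (smooth_at_pair mPK mN mN).
      exact: (smooth_at_foot_comp mPK mN t21).
    exact: (smooth_at_foot_comp mPK mN t22).
  have stz : smooth_at tz z0.
    apply: (smooth_at_tpair_comp mPK mG mNN t1).
    exact: (smooth_at_tpair_comp mPK mN mN t21 t22).
  have sept : smooth_at (fun z => e0 (pt z)) z0.
    exact: (smooth_at_comp mPK mPG mH spt se0).
  have mHL := prodm_mfd mH mLA.
  have sJ' : smooth_at ((fun z => (e0 (pt z), (sval z.1).2)) :
      PK -> prodm (arr H) (arr (vgpd L))) z0 by exact: smooth_at_pair.
  have nJ' := mnbhs_preim mPK mHL sJ' nJ.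
  have ne0' := mnbhs_preim mPK mPG spt (mnbhs_nbhs
    (mnbhsI mPG (smooth_at_nbhs mH se0) ne0)).
  (* As for the multiplication of the Morita kernel, the tangent map of an extension [e0] of [Kf] is
     paired with an extension [J] of the fibrewise inverse of [F]. *)
  exists (fun z => wpair VH (varr L') (tmap e0 (tz z)) (J (e0 (pt z), (sval z.1).2))).
    apply: (smooth_at_wpair vVH vA' mPK).
    + apply: (smooth_at_tmap_comp mPK mPG mH stz).
      by rewrite foot_tz.
    + exact: (smooth_at_comp mPK mHL mLA' sJ' sJ).
    + apply: mnbhsS nJ' => z /= [Jz _]; rewrite Jz.
      by apply: etrans (foot_tmap _ _) _; rewrite foot_tz.
  apply: mnbhsS (mnbhsI mPK nJ' ne0') => z [/= [Jz1 Jz2] nz] Az.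
  have ze : e0 (pt z) = Kf (pt z).
    by have [_] := mnbhs_singleton nz; apply; exact: Apt.
  have zext : local_ext Ag Kf (foot (tz z)) e0.
    apply/local_extP => //; rewrite foot_tz.
    by split; [have [] := mnbhs_singleton nz|apply: mnbhsS nz => q []].
  have tE : k z = tmap e0 (tz z) by exact: (tmap_subE mPG mH (Atan z Az) zext).
  have JE : J (e0 (pt z), (sval z.1).2) = lam z.
    apply/esym/(fibinv_uniq morita_arr_inj); first by rewrite Jz1.
    by apply: Jz2; rewrite ze lP.
  have W : vproj VH (tmap e0 (tz z)) =
      vproj (varr L') (J (e0 (pt z), (sval z.1).2)).
    by rewrite Jz1; apply: etrans (foot_tmap _ _) _; rewrite foot_tz.
  have {}W := wpairP W.
  by apply: wpt_eq; rewrite W (KKE z Az) /=; [exact: esym tE|exact: JE].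
- move=> e; set z : PK := (onarr MF e, (gtgt e, gsrc e)).
  have Az : A z by split; [exact: (MKmap_tgt e)|exact: (MKmap_src e)].
  have z1 : sval z.1 = (tmap (onarr f) (sval e).1, onarr F (sval e).2) by exact: MKmap_arr.
  have z21 : (sval z.2.1).1 = tmap (@gtgt R H) (sval e).1 by exact: (MK_tgt_fst lL' fth').
  have z22 : (sval z.2.2).1 = tmap (@gsrc R H) (sval e).1 by exact: (MK_src_fst lL').
  have ptE : pt z = (onarr f (foot (sval e).1),
      (gtgt (foot (sval e).1), gsrc (foot (sval e).1))).
    by rewrite /pt z1 z21 z22 !foot_tmap.
  have [c vc] := velocity_curve (sval e).1 mH.
  (* The vector [tz z] is the velocity of the image of [c] under [h |-> (f h, (t h, s h))], which
     [Kf] undoes pointwise; so [k z] is the velocity of [c], the tangent part of [e]. *)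
  have vz : velocity ((fun t => (onarr f (c t), (gtgt (c t), gsrc (c t)))) : R -> PG) (tz z).
    rewrite /tz z1 z21 z22; apply: (velocity_pair mG mNN).
      exact: (velocity_tmap mH mG (sfa _) vc).
    apply: (velocity_pair mN mN).
      exact: (velocity_tgt lieH vc).
    exact: (velocity_src lieH vc).
  have Ac : \forall t \near (0 : R), Ag (onarr f (c t), (gtgt (c t), gsrc (c t))).
    by apply: near0W => t; split; rewrite /= ?f_src ?f_tgt.
  have vk := velocity_tmap_sub mPG mH sKf vz Ac.
  apply: wpt_eq; rewrite (KKE z Az) /=.
    apply: (velocity_uniq mH vk); apply: velocity_germ vc.
    by apply: near0W => t; rewrite Kf1.
  apply: (fibinv_uniq morita_arr_inj); last by rewrite z1.
  by rewrite ptE Kf1 -MK_foot.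
- move=> z Az; have [c vc Ac] := Atan z Az.
  have [a1 a2 a3 a4] := AE z Az; have [l1 l2] := lamP z Az.
  have vk := velocity_tmap_sub mPG mH sKf vc Ac.
  have vz1 := velocity_tmap mPG mG (smooth_at_fst _ mG mNN) vc.
  have vz2 := velocity_tmap mPG mNN (smooth_at_snd _ mG mNN) vc.
  have vz21 := velocity_tmap mNN mN (smooth_at_fst _ mN mN) vz2.
  have vz22 := velocity_tmap mNN mN (smooth_at_snd _ mN mN) vz2.
  rewrite (tpair_fst _ _ mG mNN) in vz1.
  rewrite (tpair_snd _ _ mG mNN) (tpair_fst _ _ mN mN) in vz21.
  rewrite (tpair_snd _ _ mG mNN) (tpair_snd _ _ mN mN) in vz22.
  (* The three components of [Kf2] are differentiated along the curve [c] in [Ag], one in each of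
     [k1], [k2] and [k3]. *)
  have k1 : tmap (onarr f) (k z) = (sval z.1).1.
    apply: (velocity_uniq mG (velocity_tmap mH mG (sfa _) vk)).
    apply: velocity_germ vz1; apply: filterS Ac => t /Kf2.
    by case: (c t) => x y /(congr1 fst).
  have k2 : tmap (@gtgt R H) (k z) = (sval z.2.1).1.
    apply: (velocity_uniq mN (velocity_tgt lieH vk)).
    apply: velocity_germ vz21; apply: filterS Ac => t /Kf2.
    by case: (c t) => x [y y'] /(congr1 (fun q => q.2.1)).
  have k3 : tmap (@gsrc R H) (k z) = (sval z.2.2).1.
    apply: (velocity_uniq mN (velocity_src lieH vk)).
    apply: velocity_germ vz22; apply: filterS Ac => t /Kf2.
    by case: (c t) => x [y y'] /(congr1 (fun q => q.2.2)).
  have e1 : onarr MF (KK z) = z.1.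
    by apply: wpt_eq; rewrite MKmap_arr (KKE z Az).
  have e2 : gtgt (KK z) = z.2.1.
    apply: MK_obj_eq; rewrite (MK_tgt lL' fth') (KKE z Az) /= k2.
    (* The second components lie in one fibre, so they may be compared after applying [F], where the
       condition [a2] of the fibre product applies. *)
    rewrite [RHS]surjective_pairing; congr pair; apply: morita_obj_inj.
      rewrite (vb_map_proj Tt') (vproj_add vA') ?l1 ?th'_proj ?foot_k//.
      apply: etrans (MK_foot_obj z.2.1).
      by move/(congr1 (@foot R (obj H))): k2 => <-; rewrite foot_tmap foot_k.
    rewrite -a2 -F_tgt (vb_mapD Fa) ?l1 ?th'_proj ?foot_k//.
    by rewrite l2 th'_map k1.
  have e3 : gsrc (KK z) = z.2.2.
    apply: MK_obj_eq; rewrite (MK_src lL') (KKE z Az) /= k3.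
    rewrite [RHS]surjective_pairing; congr pair; apply: morita_obj_inj.
      rewrite (vb_map_proj Ss') l1.
      apply: etrans (MK_foot_obj z.2.2).
      by move/(congr1 (@foot R (obj H))): k3 => <-; rewrite foot_tmap foot_k.
    by rewrite -a4 -F_src l2.
  by rewrite e1 e2 e3; case: (z) => ? [].
Qed.

Lemma MKmap_is_vb_morita : is_vb_morita (V := MK th') (W := MK theta) MF f.
Proof.
have vK' := MK_is_vbg lL' fth' mth'; have vK := MK_is_vbg lL fth mth.
split; [exact: vK'|exact: vK| |].
  split; [exact: MKmap_is_gmap|exact: gf|exact: MKmap_arr_vb_map|].
  exact: MKmap_obj_vb_map.
split; [exact: vbg_lie vK'|exact: vbg_lie vK|exact: MKmap_is_gmap| |].
  exact: MKmap_fully_faithful.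
exact: MKmap_essentially_surjective.
Qed.

End LineBundleMorita.

Theorem proposition5p10 (R : realType) (L' L : vbg R)
    (F : gmap (vgpd L') (vgpd L)) (f : gmap (bgpd L') (bgpd L))
    (theta : tanm (arr (bgpd L)) -> arr (vgpd L)) :
  is_lbg L' -> is_lbg L -> is_vb_morita F f ->
  is_form theta -> is_multiplicative theta ->
  is_vb_morita (V := MK (pullform F f theta)) (W := MK theta)
    (MKmap F f theta) f.
Proof. by move=> lL' lL FM fth mth; apply: MKmap_is_vb_morita. Qed.
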